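(* Let $\mathcal{C}$ be a class of Cayley permutations with only finitely many simple members. Its ordinary generating function $G(x)=\sum_{\omega\in\mathcal{C}}x^{|\omega|}$ is algebraic over $\mathbb{Q}(x)$. Moreover, given the simple members and the basis of $\mathcal{C}$, one can compute (there is an algorithm producing) a nonzero polynomial $q(x,T)\in\mathbb{Q}[x,T]$ such that $q(x,G(x))=0$.
   Context: Write $[n]=\{1,\ldots,n\}$. A Cayley permutation of length $n$ is a word $\omega=w_1\cdots w_n$ of positive integers whose set of letters is $[m]$ for some $m\leq n$ (the empty word is allowed for $n=0$); equivalently a map $\omega:[n]\to[n]$, $\omega(i)=w_i$, with image $[m]$; $|\omega|=n$ is its length. $\mathrm{Cay}$ is the set of all Cayley permutations. A nonempty interval of positions $I=[a,b]\subseteq[n]$ is an H-interval of a Cayley permutation $\omega$ of length $n$ if there is an interval of values $J=[c,d]$ with $\omega(I)=J$ and $\omega^{-1}(J)=I$. $\omega$ is simple if every H-interval of $\omega$ is a singleton or equals $[n]$. The standardization $\mathrm{st}(w)$ of a word $w$ replaces its smallest letter by $1$, the next smallest by $2$, and so on, keeping repetitions equal. For Cayley permutations $\tau,\omega$, write $\tau\leq\omega$ if $\omega$ has a (not necessarily contiguous) subsequence $\alpha$ with $\mathrm{st}(\alpha)=\tau$. A class of Cayley permutations is a subset $\mathcal{C}\subseteq\mathrm{Cay}$ that is an order ideal: $\tau\leq\omega\in\mathcal{C}$ implies $\tau\in\mathcal{C}$. The basis of $\mathcal{C}$ is the set of $\leq$-minimal Cayley permutations not in $\mathcal{C}$; for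 a class with only finitely many simple members the basis is a finite set, so the input of the algorithm is a pair of finite lists of words. *)

(* Defs.v *)
From mathcomp Require Import all_boot all_order all_algebra.
From mathcomp Require Import boolp classical_sets cardinality.
Set Implicit Arguments. Unset Strict Implicit. Unset Printing Implicit Defensive.
Import GRing.Theory.

Definition word := seq nat.

Definition cayley (w : word) : Prop := exists2 m, m <= size w & w =i iota 1 m.

(* Positions are numbered from 0. Nonemptiness of the interval of values
   [c, d] follows from that of the interval of positions [a, b]. *)
Definition H_interval (w : word) (a b : nat) : Prop :=
  a <= b < size w /\
  exists c d,
    (forall v, (exists2 i, a <= i <= b & nth 0 w i = v) <-> c <= v <= d) /\
    (forall i, i < size w -> (c <= nth 0 w i <= d <-> a <= i <= b)).

Definition simple_cayley (w : word) : Prop :=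
  cayley w /\
  forall a b, H_interval w a b -> a = b \/ (a = 0 /\ b.+1 = size w).

(* A letter is replaced by the number of distinct letters not exceeding it. *)
Definition st (w : word) : word :=
  [seq size (undup [seq y <- w | y <= x]) | x <- w].

Definition contained (t w : word) : Prop := exists2 u, subseq u w & st u = t.

Definition cayley_class (C : set word) : Prop :=
  (forall w, C w -> cayley w) /\
  (forall t w, cayley t -> contained t w -> C w -> C t).

Definition simples (C : set word) : set word :=
  [set w | C w /\ simple_cayley w]%classic.

Definition basis (C : set word) : set word :=
  [set w | [/\ cayley w, ~ C w &
    forall t, cayley t -> ~ C t -> contained t w -> t = w]]%classic.

(* Formal power series over Q, given by their coefficients. *)
Section Series.
Local Open Scope ring_scope.

Definition series := nat -> rat.

Definition mul_series (f g : series) : series :=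
  fun n => \sum_(i < n.+1) f i * g (n - i)%N.

Definition one_series : series := fun n => (n == 0%N)%:R.

Definition exp_series (f : series) (k : nat) : series :=
  iter k (mul_series f) one_series.

Definition series_of_poly (p : {poly rat}) : series := fun n => p`_n.

(* q(x, G(x)); the outer variable of q is T and the inner one is x. *)
Definition subst_series (q : {poly {poly rat}}) (G : series) : series :=
  fun n => \sum_(k < size q)
    mul_series (series_of_poly q`_k) (exp_series G k) n.

Definition annihilates (q : {poly {poly rat}}) (G : series) : Prop :=
  forall n, subst_series q G n = 0.

(* Algebraicity over Q(x), with denominators cleared. *)
Definition algebraic_series (G : series) : Prop :=
  exists2 q : {poly {poly rat}}, q != 0 & annihilates q G.

(* The letters of a Cayley permutation of length n are at most n, so for a
   class C this counts all the members of length n. *)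
Definition gen_fun (C : set word) : series :=
  fun n => #|[pred t : n.-tuple 'I_n.+1 | `[< C [seq val i | i <- t] >]]|%:R.

End Series.

(* Kleene's partial recursive functions. Arities are not tracked: a missing
   argument reads as 0 and superfluous arguments are ignored. *)
Inductive recfun : Type :=
| Zero
| Succ
| Proj of nat
| Comp of recfun & seq recfun
| PrimRec of recfun & recfun
| Mu of recfun.

(* computes f xs y : f is defined at xs, with value y. *)
Fixpoint computes (f : recfun) (xs : seq nat) (y : nat) {struct f} : Prop :=
  match f with
  | Zero => y = 0
  | Succ => y = (nth 0 xs 0).+1
  | Proj i => y = nth 0 xs i
  | Comp g hs =>
      exists2 ys,
        (fix computes_all (hs : seq recfun) (ys : seq nat) {struct hs} : Prop :=
           match hs, ys with
           | [::], [::] => True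
           | h :: hs', z :: ys' => computes h xs z /\ computes_all hs' ys'
           | _, _ => False
           end) hs ys
        & computes g ys y
  | PrimRec g h =>
      (fix iterate (n z : nat) {struct n} : Prop :=
         if n is n'.+1 then
           exists2 r, iterate n' r & computes h (n' :: r :: behead xs) z
         else computes g (behead xs) z) (nth 0 xs 0) y
  | Mu g =>
      computes g (y :: xs) 0 /\
      forall z, z < y -> exists r, computes g (z :: xs) r.+1
  end.

Lemma computes_inj f xs y1 y2 :
  computes f xs y1 -> computes f xs y2 -> y1 = y2.
Proof.
move: f xs y1 y2; fix IH 1.
case=> [||i|g hs|g h|g] xs y1 y2 /=; try by move=> -> ->.
- case=> s1 H1 G1 [s2 H2 G2]; suff E : s1 = s2.
    by move: G1 G2; rewrite E; apply: IH.
  move: s1 s2 H1 H2 {G1 G2}; elim: hs => [|h hs IHs] [|z1 s1] [|z2 s2] //=.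
  by move=> [A1 B1] [A2 B2]; rewrite (IH h xs z1 z2 A1 A2) (IHs s1 s2 B1 B2).
- elim: (nth 0 xs 0) y1 y2 => [|n IHn] y1 y2; first exact: IH.
  case=> r1 A1 B1 [r2 A2 B2]; move: B1 B2; rewrite (IHn _ _ A1 A2); exact: IH.
- move=> [A1 B1] [A2 B2]; case: (ltngtP y1 y2) => // L.
  + by case: (B2 _ L) => r Hr; have := IH g _ _ _ A1 Hr.
  + by case: (B1 _ L) => r Hr; have := IH g _ _ _ A2 Hr.
Qed.

(* CodeSeq.code is a bijection from seq nat to nat with inverse
   CodeSeq.decode. *)
Definition code_words (s : seq word) : nat :=
  CodeSeq.code [seq CodeSeq.code w | w <- s].

Section Decoding.
Local Open Scope ring_scope.

(* The code of a list a, b, c stands for (a - b) / (c + 1). *)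
Definition rat_of_code (k : nat) : rat :=
  let s := CodeSeq.decode k in
  ((nth 0%N s 0)%:R - (nth 0%N s 1)%:R) / (nth 0%N s 2).+1%:R.

Definition poly_of_code (k : nat) : {poly rat} :=
  Poly [seq rat_of_code c | c <- CodeSeq.decode k].

Definition bipoly_of_code (k : nat) : {poly {poly rat}} :=
  Poly [seq poly_of_code c | c <- CodeSeq.decode k].

End Decoding.

(* Main.v *)
Require Import Defs.
From HB Require Import structures.
From mathcomp Require Import all_boot all_order perm all_algebra.
From mathcomp Require Import boolp classical_sets cardinality.
From mathcomp Require Import ring lra zify.
Set Implicit Arguments. Unset Strict Implicit. Unset Printing Implicit Defensive.
Import GRing.Theory.

(* Every Cayley permutation of length at least two is an inflation of a simple
   one, uniquely up to the choice of the first block of a sum or skew sum. Sort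
   the members of the class by their state, the set of short patterns that they
   contain. The state of an inflation is determined by the states of its blocks
   and contains them, so the generating functions of the states satisfy a
   polynomial system in which the equation of a state involves only that state
   and smaller ones. Solving it one state at a time keeps all the series inside
   a finite-dimensional Q(x)-space that they stabilize, with explicit bounds on
   its dimension and on the degrees. A determinant then gives an annihilating
   polynomial; moreover, if q(x, G(x)) is not zero, then it divides a nonzero
   polynomial in x of bounded degree, so its order of vanishing is bounded by a
   computable function of the data. The algorithm searches for an integer
   polynomial q such that q(x, G(x)) vanishes beyond that order, the coefficients
   of G being counted by brute force from the basis. When the basis is not given,
   Higman's theorem for the inflations of finitely many simple words shows that
   finitely many excluded patterns define the class inside their closure. *)

(** * The ring of formal power series *)

(** The search needs a stopping rule: a candidate $q$ has to be certified from finitely many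
    coefficients. Algebraicity alone does not give this, so each step of the elimination carries a
    degree bound that depends on sizes only. The bounds concern a finite family of series that need
    not be independent over $\mathbb{Q}(x)$; one nonzero member is enough for the determinant,
    because series form a domain. No series is ever inverted: to divide, one multiplies by a
    cofactor that turns the divisor into a polynomial in $x$. The system is triangular but not
    linear, since a block may have the same state as the whole word. Within one state the unknowns
    are the series of all words, of the sum-indecomposable ones and of the skew-indecomposable ones;
    the last two are fractions in the first, $F$. The equation left for $F$ is nontrivial because
    modulo $x$ and $F^2$ it reads $F=0$. Repeated letters of a simple word are what distinguishes
    the situation from that of permutations: such a position can only receive a single letter,
    whence the factors $x$ in the monomials. *)

Section SeriesRing.
Local Open Scope ring_scope.
Implicit Types (f g h : series) (p q : {poly rat}).

HB.instance Definition _ := gen_eqMixin series.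
HB.instance Definition _ := gen_choiceMixin series.

Definition add_series f g : series := fun n => f n + g n.
Definition opp_series f : series := fun n => - f n.
Definition zero_series : series := fun=> 0.

Fact add_seriesA : associative add_series.
Proof. by move=> f g h; apply/funext => n; apply: addrA. Qed.
Fact add_seriesC : commutative add_series.
Proof. by move=> f g; apply/funext => n; apply: addrC. Qed.
Fact add_0series : left_id zero_series add_series.
Proof. by move=> f; apply/funext => n; apply: add0r. Qed.
Fact add_Nseries : left_inverse zero_series opp_series add_series.
Proof. by move=> f; apply/funext => n; apply: addNr. Qed.

HB.instance Definition _ :=
  GRing.isZmodule.Build series add_seriesA add_seriesC add_0series add_Nseries.

Definition trunc_series f n : {poly rat} := \poly_(i < n.+1) f i.

Lemma coef_trunc_series f n i : (i <= n)%N -> (trunc_series f n)`_i = f i.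
Proof. by move=> lein; rewrite coef_poly ltnS lein. Qed.

(** Coefficients up to [n] of a product depend only on the factors up to degree [n], so the ring
    laws of series are read off from polynomial truncations. *)
Lemma mul_seriesE f g p q n :
  (forall i, (i <= n)%N -> p`_i = f i) -> (forall i, (i <= n)%N -> q`_i = g i) ->
  forall i, (i <= n)%N -> (p * q)`_i = mul_series f g i.
Proof.
move=> pf qg i lein; rewrite coefM; apply: eq_bigr => j _.
by have := ltn_ord j => ltj; rewrite pf ?qg //; lia.
Qed.

Fact mul_seriesA : associative mul_series.
Proof.
move=> f g h; apply/funext => n.
have F := @coef_trunc_series f n; have G := @coef_trunc_series g n.
have H := @coef_trunc_series h n.
rewrite -(mul_seriesE F (mul_seriesE G H) (leqnn n)).
by rewrite -(mul_seriesE (mul_seriesE F G) H (leqnn n)) mulrA.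
Qed.

Fact mul_seriesC : commutative mul_series.
Proof.
move=> f g; apply/funext => n.
have F := @coef_trunc_series f n; have G := @coef_trunc_series g n.
by rewrite -(mul_seriesE F G (leqnn n)) mulrC (mul_seriesE G F).
Qed.

Fact mul_1series : left_id one_series mul_series.
Proof.
move=> f; apply/funext => n; rewrite /mul_series big_ord_recl subn0 mul1r.
by rewrite big1 ?addr0 // => i _; rewrite mul0r.
Qed.

Fact mul_seriesDl : left_distributive mul_series add_series.
Proof.
move=> f g h; apply/funext => n; rewrite /mul_series /add_series -big_split.
by apply: eq_bigr => i _; rewrite mulrDl.
Qed.

Fact one_series_neq0 : one_series != zero_series.
Proof.
by apply/eqP => /(congr1 (fun f => f 0%N)) /eqP; rewrite oner_eq0.
Qed.

HB.instance Definition _ := GRing.Zmodule_isComNzRing.Build series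
  mul_seriesA mul_seriesC mul_1series mul_seriesDl one_series_neq0.

Lemma seriesD f g n : (f + g) n = f n + g n. Proof. by []. Qed.
Lemma series0 n : (0 : series) n = 0. Proof. by []. Qed.
Lemma series1 n : (1 : series) n = (n == 0%N)%:R. Proof. by []. Qed.
Lemma seriesM f g n : (f * g) n = \sum_(i < n.+1) f i * g (n - i)%N.
Proof. by []. Qed.

Lemma exp_seriesE f k : exp_series f k = f ^+ k.
Proof. by elim: k => [|k IHk] //=; rewrite exprS -IHk. Qed.

Lemma series_sum (I : Type) (r : seq I) (P : pred I) (F : I -> series) n :
  (\sum_(i <- r | P i) F i) n = \sum_(i <- r | P i) F i n.
Proof. by elim/big_rec2: _ => // i x y _ <-. Qed.

(** In degree [m + k], the sum of the two orders, only the product of the lowest nonzero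
    coefficients survives. *)
Lemma mul_series_eq0 f g : f * g = 0 -> f = 0 \/ g = 0.
Proof.
have [-> | /eqP nzf] := pselect (f = 0); first by left.
have [-> | /eqP nzg] := pselect (g = 0); first by right.
have min (h : series) : h != 0 ->
    exists2 m, h m != 0 & forall i, (i < m)%N -> h i = 0.
  move=> nzh; have exh : exists m, h m != 0.
    apply: contrapT => noh; case/eqP: nzh; apply/funext => m.
    by apply: contrapT => /eqP hm; apply: noh; exists m.
  case: (ex_minnP exh) => m hm minm; exists m => // i ltim.
  by apply/eqP; apply: contraLR ltim => /minm; rewrite leqNgt.
have [m fm fmin] := min _ nzf; have [k gk gmin] := min _ nzg.
move=> /(congr1 (fun h => h (m + k)%N)); rewrite seriesM series0.
have ltm : (m < (m + k).+1)%N by rewrite ltnS leq_addr.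
rewrite (bigD1 (Ordinal ltm)) //= big1 => [|i nim].
  by rewrite addr0 addKn => /eqP; rewrite mulf_eq0 (negPf fm) (negPf gk).
have := nim; rewrite -val_eqE /= neq_ltn => /orP[ltim|ltmi].
  by rewrite fmin ?mul0r.
by rewrite gmin ?mulr0 //; have := ltn_ord i; lia.
Qed.

Fact series_of_poly_zmod_morphism : zmod_morphism series_of_poly.
Proof. by move=> p q; apply/funext => n; rewrite /series_of_poly coefB. Qed.
HB.instance Definition _ :=
  GRing.isZmodMorphism.Build {poly rat} series series_of_poly
    series_of_poly_zmod_morphism.

Fact series_of_poly_monoid_morphism : monoid_morphism series_of_poly.
Proof.
split=> [|p q]; apply/funext => n; rewrite /series_of_poly ?coef1 //.
exact: coefM.
Qed.
HB.instance Definition _ :=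
  GRing.isMonoidMorphism.Build {poly rat} series series_of_poly
    series_of_poly_monoid_morphism.

(** Reduction modulo $x$. As a ring morphism it certifies later that a series or a polynomial is not
    zero. *)
Definition cst_series f : rat := f 0%N.
Fact cst_series_zmod_morphism : zmod_morphism cst_series.
Proof. by []. Qed.
HB.instance Definition _ :=
  GRing.isZmodMorphism.Build series rat cst_series cst_series_zmod_morphism.
Fact cst_series_monoid_morphism : monoid_morphism cst_series.
Proof. by split=> // f g; rewrite /cst_series seriesM big_ord1. Qed.
HB.instance Definition _ :=
  GRing.isMonoidMorphism.Build series rat cst_series cst_series_monoid_morphism.

Lemma subst_seriesE (q : {poly {poly rat}}) f :
  subst_series q f = (map_poly series_of_poly q).[f].
Proof.
apply/funext => n; rewrite (horner_coef_wide _ (size_poly _ _)) series_sum.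
by apply: eq_bigr => i _; rewrite exp_seriesE coef_map.
Qed.

Lemma annihilatesE (q : {poly {poly rat}}) f :
  annihilates q f <-> (map_poly series_of_poly q).[f] = 0.
Proof.
rewrite -subst_seriesE; split=> [q0|q0 n]; [exact/funext | by rewrite q0].
Qed.

End SeriesRing.

(** * Algebraic series with bounded degrees *)

Section Boundedness.
Local Open Scope ring_scope.
Implicit Types (f g a b : series) (p q c m : {poly rat}) (v : seq series).
Local Notation emb := series_of_poly.

(** The generators need not be linearly independent. The coefficients form a total function on
    [nat], which avoids index types depending on [size v]. *)
Definition lattice D v f := exists2 p : nat -> {poly rat},
  forall i, (size (p i) <= D.+1)%N & f = \sum_(i < size v) emb (p i) * v`_i.

(* Multiplication by f maps the Q(x)-span of v to itself, with numerators and
   a common denominator of degree at most D. *)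
Definition bounded D v f := exists2 c : {poly rat},
  (c != 0) && (size c <= D.+1)%N &
  forall i, (i < size v)%N -> lattice D v (emb c * f * v`_i).

Lemma lattice0 D v : lattice D v 0.
Proof.
exists (fun=> 0) => [i|]; first by rewrite size_poly0.
by rewrite big1 // => i _; rewrite rmorph0 mul0r.
Qed.

Lemma latticeD D v f g : lattice D v f -> lattice D v g -> lattice D v (f + g).
Proof.
move=> [p sp ->] [q sq ->]; exists (fun i => p i + q i) => [i|].
  by apply: leq_trans (size_polyD _ _) _; rewrite geq_max sp sq.
by rewrite -big_split; apply: eq_bigr => i _; rewrite rmorphD mulrDl.
Qed.

Lemma lattice_sum (I : Type) (r : seq I) (P : pred I) (F : I -> series) D v :
  (forall i, P i -> lattice D v (F i)) -> lattice D v (\sum_(i <- r | P i) F i).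
Proof. by move=> ?; elim/big_ind: _ => //; [apply: lattice0|apply: latticeD]. Qed.

Lemma size_mul_leq_succ (R : nzRingType) (p q : {poly R}) d e :
  (size p <= d.+1)%N -> (size q <= e.+1)%N -> (size (p * q)%R <= (d + e).+1)%N.
Proof. by move=> sp sq; apply: leq_trans (size_polyMleq _ _) _; lia. Qed.

Lemma latticeZ D E v c f :
  (size c <= E.+1)%N -> lattice D v f -> lattice (E + D) v (emb c * f).
Proof.
move=> sc [p sp ->]; exists (fun i => c * p i) => [i|].
  exact: size_mul_leq_succ.
by rewrite mulr_sumr; apply: eq_bigr => i _; rewrite rmorphM mulrA.
Qed.

Lemma lattice_le D E v f : (D <= E)%N -> lattice D v f -> lattice E v f.
Proof. by move=> leDE [p sp ->]; exists p => // i; apply: leq_trans (sp i) _. Qed.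

Lemma lattice_nth D v i : lattice D v v`_i.
Proof.
have [lti|lei] := ltnP i (size v); last by rewrite nth_default //; apply: lattice0.
exists (fun j => (j == i)%:R) => [j|].
  by case: eqP => _; rewrite ?size_poly1 ?size_poly0.
rewrite (bigD1 (Ordinal lti)) //= eqxx rmorph1 mul1r big1 ?addr0 // => j nji.
have /negPf->: (j : nat) != i by [].
by rewrite rmorph0 mul0r.
Qed.

(** Composition of matrices: degrees add. Source and target families may differ, as the passage to a
    larger family requires. *)
Lemma lattice_mul D E v w f g : lattice D v f ->
  (forall i, (i < size v)%N -> lattice E w (g * v`_i)) ->
  lattice (D + E) w (g * f).
Proof.
move=> [p sp ->] latg; rewrite mulr_sumr; apply: lattice_sum => i _.
by rewrite mulrCA; apply: latticeZ => //; apply: latg.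
Qed.

Lemma bounded_le D E v f : (D <= E)%N -> bounded D v f -> bounded E v f.
Proof.
move=> leDE [c /andP[nzc sc] latf]; exists c.
  by rewrite nzc (leq_trans sc).
by move=> i lti; apply: lattice_le leDE _; apply: latf.
Qed.

Lemma bounded_emb D v p : (size p <= D.+1)%N -> bounded D v (emb p).
Proof.
move=> sp; exists 1; rewrite ?oner_eq0 ?size_poly1 // => i lti.
by rewrite rmorph1 mul1r -[D]addn0; apply: latticeZ => //; apply: lattice_nth.
Qed.

Lemma bounded0 D v : bounded D v 0.
Proof. by rewrite -(rmorph0 emb); apply: bounded_emb; rewrite size_poly0. Qed.

Lemma bounded1 D v : bounded D v 1.
Proof. by rewrite -(rmorph1 emb); apply: bounded_emb; rewrite size_poly1. Qed.

Lemma boundedN D v f : bounded D v f -> bounded D v (- f).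
Proof.
move=> [c cP latf]; exists c => // i lti.
rewrite mulrN mulNr -mulN1r -(rmorph1 emb) -rmorphN -[D]add0n.
by apply: latticeZ; [rewrite size_polyN size_poly1|apply: latf].
Qed.

Lemma boundedD D E v f g :
  bounded D v f -> bounded E v g -> bounded (D + E) v (f + g).
Proof.
move=> [c /andP[nzc sc] latf] [d /andP[nzd sd] latg]; exists (c * d).
  by rewrite mulf_neq0 //= size_mul_leq_succ.
move=> i lti; rewrite mulrDr mulrDl rmorphM; apply: latticeD.
  rewrite addnC (_ : _ * _ = emb d * (emb c * f * v`_i)); last by ring.
  by apply: latticeZ => //; apply: latf.
rewrite (_ : _ * _ = emb c * (emb d * g * v`_i)); last by ring.
by apply: latticeZ => //; apply: latg.
Qed.

Lemma boundedM D E v f g :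
  bounded D v f -> bounded E v g -> bounded (D + E) v (f * g).
Proof.
move=> [c /andP[nzc sc] latf] [d /andP[nzd sd] latg]; exists (c * d).
  by rewrite mulf_neq0 //= size_mul_leq_succ.
move=> i lti; rewrite rmorphM.
rewrite (_ : _ * _ = (emb c * f) * (emb d * g * v`_i)); last by ring.
by rewrite addnC; apply: lattice_mul => [|j ltj]; [apply: latg|apply: latf].
Qed.

Lemma bounded_sum (I : eqType) (r : seq I) (F : I -> series) D v :
  (forall i, i \in r -> bounded D v (F i)) ->
  bounded (size r * D) v (\sum_(i <- r) F i).
Proof.
elim: r => [|i r IHr] bF; first by rewrite big_nil; apply: bounded0.
rewrite big_cons; apply: boundedD; first by apply: bF; rewrite mem_head.
by apply: IHr => j rj; apply: bF; rewrite inE rj orbT.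
Qed.

Lemma bounded_sum_fin (I : finType) (P : pred I) (F : I -> series) D v :
  (forall i, P i -> bounded D v (F i)) -> bounded (#|I| * D) v (\sum_(i | P i) F i).
Proof.
move=> bF; rewrite big_mkcond -big_enum cardT; apply: bounded_sum => i _.
by case: ifP => Pi; [apply: bF|apply: bounded0].
Qed.

Lemma boundedX D v f k : bounded D v f -> bounded (k * D) v (f ^+ k).
Proof.
move=> bf; elim: k => [|k IHk]; first by rewrite expr0; apply: bounded1.
by rewrite exprS; apply: boundedM.
Qed.

Lemma bounded_div D E v m f : m != 0 -> (size m <= E.+1)%N ->
  bounded D v (emb m * f) -> bounded (D + E) v f.
Proof.
move=> nzm sm [c /andP[nzc sc] latf]; exists (c * m).
  by rewrite mulf_neq0 //= size_mul_leq_succ.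
move=> i /latf; rewrite rmorphM !mulrA; apply: lattice_le; exact: leq_addr.
Qed.

Lemma bounded_horner (q : {poly {poly rat}}) s E D v f :
  (size q <= s)%N -> (forall i, (size (q`_i)%R <= E.+1)%N) -> bounded D v f ->
  bounded (s * (E + s * D)) v (map_poly emb q).[f].
Proof.
move=> sq xq bf; rewrite (horner_coef_wide _ (leq_trans (size_poly _ _) sq)).
rewrite -(big_mkord xpredT (fun i => (map_poly emb q)`_i * f ^+ i)).
have -> : (s * (E + s * D) = size (index_iota 0 s) * (E + s * D))%N.
  by rewrite size_iota subn0.
apply: bounded_sum => i; rewrite mem_index_iota coef_map => /= lti; apply: bounded_le (boundedM (bounded_emb v (xq i)) (boundedX i bf)).
by rewrite leq_add2l leq_mul2r ltnW ?orbT //; lia.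
Qed.

Definition xdeg_le D (q : {poly {poly rat}}) := forall i, (size (q`_i)%R <= D.+1)%N.

Lemma xdeg_leM D E (p q : {poly {poly rat}}) : xdeg_le D p -> xdeg_le E q -> xdeg_le (D + E) (p * q).
Proof.
move=> dp dq i; rewrite coefM; apply: (leq_trans (size_sum _ _ _)).
by apply/bigmax_leqP => j _; apply: size_mul_leq_succ.
Qed.

Lemma xdeg_leD D (p q : {poly {poly rat}}) : xdeg_le D p -> xdeg_le D q -> xdeg_le D (p + q).
Proof.
move=> dp dq i; rewrite coefD; apply: leq_trans (size_polyD _ _) _.
by rewrite geq_max dp dq.
Qed.

Lemma xdeg_leC D c : (size c <= D.+1)%N -> xdeg_le D c%:P.
Proof. by move=> sc i; rewrite coefC; case: ifP; rewrite ?size_poly0. Qed.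

(** The polynomial is $\det(cT-M)$, where $M$ is the matrix of multiplication by $cf$ on [v]. At
    $T=f$ the matrix kills the vector [v], so its determinant kills a nonzero entry of [v] and is
    zero in the domain of series. *)
Lemma annihilator D v f : has (fun g => g != 0) v -> bounded D v f ->
  exists q : {poly {poly rat}}, [/\ q != 0, (size q <= (size v).+1)%N,
    xdeg_le (size v * D) q & (map_poly emb q).[f] = 0].
Proof.
move=> nzv [c /andP[nzc sc] latf]; set n := size v.
have [M sM latM] : exists2 M : 'M[{poly rat}]_n, forall i j, (size (M i j) <= D.+1)%N
    & forall i : 'I_n, emb c * f * v`_i = \sum_j emb (M i j) * v`_j.
  have /choice[p pP] (i : 'I_n) : exists p : nat -> {poly rat},
      (forall j, (size (p j) <= D.+1)%N) /\
      emb c * f * v`_i = \sum_(j < n) emb (p j) * v`_j.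
    by have [p sp e] := latf i (ltn_ord i); exists p.
  exists (\matrix_(i, j) p i j) => [i j|i]; first by rewrite mxE (pP i).1.
  by rewrite (pP i).2; apply: eq_bigr => j _; rewrite mxE.
pose A : 'M[{poly {poly rat}}]_n := (c%:P * 'X)%:M - map_mx polyC M.
have AE i j : A i j = (c%:P * 'X) *+ (i == j) - (M i j)%:P by rewrite !mxE.
(* Being the characteristic polynomial of [M] at $cT$ with $c\neq 0$, it has degree exactly [n], so
   it is not zero. *)
have detA : \det A = char_poly M \Po (c%:P * 'X).
  rewrite /char_poly -det_map_mx; congr (\det _); apply/matrixP => i j.
  by rewrite AE !mxE rmorphB rmorphMn /= comp_polyX comp_polyC.
have nzcX : size (c%:P * 'X) = 2%N by rewrite size_mulX ?polyC_eq0 // size_polyC nzc.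
have szA : size (\det A) = n.+1 by rewrite detA size_comp_poly2 // size_char_poly.
exists (\det A); split; rewrite ?szA //.
- by rewrite -size_poly_gt0 szA.
(* Each product in the Leibniz formula has [n] entries of degree at most [D] in $x$. *)
- rewrite /determinant; elim/big_ind: _ => [i||s _]; [by rewrite coef0 size_poly0|exact: xdeg_leD|].
  rewrite -(rmorph_sign polyC) -[(n * D)%N]add0n; apply: xdeg_leM.
    by apply: xdeg_leC; case: (perm.odd_perm _); rewrite ?size_polyN size_poly1.
  rewrite -[n in (n * D)%N]card_ord cardE; rewrite -big_enum /=.
  elim: (enum 'I_n) => [|i r IHr].
    by rewrite big_nil; apply: xdeg_leC; rewrite size_poly1.
  rewrite big_cons /=; apply: xdeg_leM => // j; rewrite AE coefB coefC.
  rewrite coefMn coefMX coefC; case: (i == s i); rewrite ?mulr1n ?mulr0n.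
    by case: j => [|[|j]] /=; rewrite ?sub0r ?subr0 ?size_polyN ?size_poly0.
  by case: ifP; rewrite ?sub0r ?subr0 ?size_polyN ?size_poly0.
- pose B : 'M[series]_n := (emb c * f)%:M - map_mx emb M.
  have -> : (map_poly emb (\det A)).[f] = \det B.
    rewrite -det_map_mx -horner_evalE -det_map_mx; congr (\det _).
    apply/matrixP => i j; rewrite !mxE /= /horner_eval rmorphB rmorphMn rmorphM /=.
    by rewrite map_polyX !map_polyC !hornerE hornerMn !hornerE.
  have /hasP[g /(nthP 0)[k ltk <-] nzk] := nzv.
  have Bv : B *m \col_i v`_i = 0.
    apply/matrixP => i j; rewrite mulmxBl !mxE.
    rewrite (bigD1 i) //= big1 => [|l nli]; last by rewrite !mxE eq_sym (negPf nli) mul0r.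
    rewrite !mxE eqxx mulr1n addr0 latM; apply/eqP; rewrite subr_eq0; apply/eqP.
    by apply: eq_bigr => l _; rewrite !mxE.
  have : (\det B) *: \col_i v`_i = 0 :> 'cV_n.
    by rewrite -mul_scalar_mx -mul_adj_mx -mulmxA Bv mulmx0.
  move=> /matrixP /(_ (Ordinal ltk) 0); rewrite !mxE => /mul_series_eq0[] // /eqP.
  by rewrite (negPf nzk).
Qed.

(* The constant term of an annihilator of f, once nonzero, is a multiple of f.
   This replaces inverting f. *)
Lemma norm_multiple D v f : has (fun g => g != 0) v -> f != 0 -> bounded D v f ->
  let n := size v in
  exists2 b, bounded (n * (n * D + n * D)) v b &
  exists2 m : {poly rat}, (m != 0) && (size m <= (n * D).+1)%N & emb m = b * f.
Proof.
move=> nzv /eqP nzf bf n; have [q0 [nzq0 szq0 xdq0 q0f]] := annihilator nzv bf.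
have [k] := ubnP (size q0); elim: k q0 nzq0 szq0 xdq0 q0f => // k IHk q nzq szq xdq qf ltk.
have qE : q = (\poly_(i < n) q`_i.+1) * 'X + (q`_0)%:P.
  apply/polyP => i; rewrite coefD coefMX coefC coef_poly.
  case: i => [|i] /=; first by rewrite add0r.
  by rewrite addr0; case: ltnP => // lei; rewrite nth_default // (leq_trans szq).
set r := \poly_(i < n) _ in qE.
have szr : (size r <= n)%N by apply: size_poly.
have xdr : xdeg_le (n * D) r.
  by move=> i; rewrite coef_poly; case: ifP => _; [apply: xdq|rewrite size_poly0].
have bE : (map_poly emb r).[f] * f + emb q`_0 = 0.
  by rewrite -qf {2}qE rmorphD rmorphM /= map_polyX map_polyC !hornerE.
(* If the constant term vanishes, then $q=rT$; as [f] is not zero and there are no zero divisors,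
   [r] annihilates [f] too and is shorter. *)
have [q00|nzq00] := eqVneq (q`_0) 0.
  have rf : (map_poly emb r).[f] = 0.
    by move: bE; rewrite q00 rmorph0 addr0 => /mul_series_eq0[].
  have nzr : r != 0 by apply: contraNneq nzq => r0; rewrite qE r0 q00 mul0r add0r.
  apply: (IHk r) => //; first exact: leqW.
  rewrite -ltnS (leq_trans _ ltk) // ltnS qE q00 addr0 size_mulX // .
(* Here $r(f)f=-q_0$. The bound is that of [bounded_horner] for [n] coefficients of degree at most
   [n * D]. *)
exists (- (map_poly emb r).[f]).
  by apply: boundedN; apply: bounded_horner.
exists q`_0; first by rewrite nzq00 xdq.
by rewrite mulNr; apply/eqP; rewrite -subr_eq0 opprK addrC bE.
Qed.

(** An algebraic relation involves all its coefficients at once, so a single denominator has to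
    clear them: the product of the [d] individual ones. *)
Lemma common_denominator D v (F : nat -> series) d :
  (forall l, (l < d)%N -> bounded D v (F l)) ->
  exists2 c : {poly rat}, (c != 0) && (size c <= (d * D).+1)%N &
  forall l i, (l < d)%N -> (i < size v)%N -> lattice (d * D) v (emb c * F l * v`_i).
Proof.
elim: d => [|d IHd] bF; first by exists 1; rewrite ?oner_eq0 ?size_poly1.
have [l ltl|c /andP[nzc sc] latc] := IHd; first by apply: bF; apply: ltnW.
have [c' /andP[nzc' sc'] latc'] := bF d (ltnSn d).
exists (c' * c); first by rewrite mulf_neq0 //= mulSn size_mul_leq_succ.
move=> l i; rewrite ltnS leq_eqVlt rmorphM mulSn => /predU1P[->|ltl] lti.
  rewrite addnC.
  rewrite (_ : _ * _ = emb c * (emb c' * F d * v`_i)); last by ring.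
  by apply: latticeZ => //; apply: latc'.
by rewrite -!mulrA; apply: latticeZ => //; rewrite mulrA; apply: latc.
Qed.

End Boundedness.

(** * Adjoining an algebraic series to the family *)

Section Extension.
Local Open Scope ring_scope.
Implicit Types (f g a b : series) (c m : {poly rat}) (v : seq series).
Local Notation emb := series_of_poly.

Lemma lattice_mem D v f : f \in v -> lattice D v f.
Proof. by move=> /(nthP 0)[i _ <-]; apply: lattice_nth. Qed.

(** Each of the [d] products of a lower coefficient by the cofactor [b] is bounded by the norm bound
    plus [D], whence their common denominator. The last summand is the degree of the polynomial into
    which [b] turns the leading coefficient. *)
Definition extension_bound n D d := (d * (n * (n * D + n * D) + D) + n * D)%N.

(* The new family consists of the v_i f^j with j < deg p; the leading
   coefficient of p is first turned into a polynomial in x by norm_multiple. *)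
Lemma bounded_extension D d v f (p : {poly series}) :
  has (fun g => g != 0) v -> p != 0 -> (size p <= d.+1)%N ->
  (forall i, bounded D v p`_i) -> p.[f] = 0 ->
  exists w, [/\ has (fun g => g != 0) w, (size w <= size v * d)%N,
    forall E g, bounded E v g -> bounded E w g &
    bounded (extension_bound (size v) D d) w f].
Proof.
move=> nzv nzp szp bp pf0; pose n := size v; pose d' := (size p).-1.
have szpE : size p = d'.+1 by rewrite prednK ?size_poly_gt0.
have led : (d' <= d)%N by rewrite -ltnS -szpE.
have d'gt0 : (0 < d')%N.
  rewrite lt0n; apply: contraNneq nzp => d'0.
  have pC : p = (p`_0)%:P by apply: size1_polyC; rewrite szpE d'0.
  by move: pf0; rewrite pC hornerC => ->.
have [b bb [m /andP[nzm szm] mE]] :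
    exists2 b, bounded (n * (n * D + n * D)) v b &
    exists2 m : {poly rat}, (m != 0) && (size m <= (n * D).+1)%N & emb m = b * lead_coef p.
  by apply: (norm_multiple nzv _ (bp _)); rewrite -[X in X != 0]/(lead_coef p) lead_coef_eq0.
set Db := (n * (n * D + n * D))%N in bb.
have [l _|c /andP[nzc szc] latc] := @common_denominator (Db + D) v (fun l => b * p`_l) d'.
  exact: boundedM.
pose w := [seq g * f ^+ j | g <- v, j <- iota 0 d'].
have mem_w g j : g \in v -> (j < d')%N -> g * f ^+ j \in w.
  by move=> vg ltj; apply: allpairs_f => //; rewrite mem_iota.
exists w; split.
- have /hasP[g vg nzg] := nzv; apply/hasP; exists (g * f ^+ 0) => //; first exact: mem_w.
  by rewrite expr0 mulr1.
- by rewrite size_allpairs size_iota leq_mul2l led orbT.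
(* Multiplication by [g] commutes with powers of [f], so the same denominator and degree serve for
   the larger family. *)
- move=> E g [e eP latg]; exists e => // i lti.
  have /allpairsP[[h j] /= [vh ltj ->]] := mem_nth 0 lti.
  have [k ltk <-] := nthP 0 vh; rewrite mulrA mulrC -[E]addn0.
  apply: lattice_mul (latg _ ltk) _ => i' lti'; apply: lattice_mem.
  by rewrite mulrC; apply: mem_w; [apply: mem_nth | rewrite mem_iota in ltj].
apply: (@bounded_le (d' * (Db + D) + n * D)%N).
  by rewrite leq_add2r leq_mul2r led orbT.
exists (c * m); first by rewrite mulf_neq0 //= size_mul_leq_succ.
move=> i lti; have /allpairsP[[h j] /= [vh]] := mem_nth 0 lti.
rewrite mem_iota => /= ltj ->.
rewrite (_ : _ * _ = emb (c * m) * (h * f ^+ j.+1)); last by rewrite exprS; ring.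
have [ltj1|lej1] := ltnP j.+1 d'.
  rewrite -[(_ + _)%N]addn0; apply: latticeZ; first exact: size_mul_leq_succ.
  exact/lattice_mem/mem_w.
(* The only product to leave the family has the factor [f ^+ d']; the equation multiplied by [b]
   rewrites it in lower powers. *)
have -> : j.+1 = d' by apply/eqP; rewrite eqn_leq ltj lej1.
have -> : emb (c * m) * (h * f ^+ d') =
    - \sum_(l < d') emb c * (b * p`_l) * h * f ^+ l.
  have mE' : emb m = b * p`_d' by [].
  have : b * p.[f] = 0 by rewrite pf0 mulr0.
  rewrite horner_coef szpE big_ord_recr /= mulrDr [b * (_ * _)]mulrA -mE'.
  move=> /eqP; rewrite addrC addr_eq0 => /eqP mfE.
  rewrite rmorphM (_ : _ * _ = emb c * h * (emb m * f ^+ d')); last by ring.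
  rewrite mfE mulrN; congr (- _); rewrite !mulr_sumr; apply: eq_bigr => l _; ring.
rewrite -mulN1r -(rmorph1 emb) -rmorphN -[(_ + _)%N]add0n.
apply: latticeZ; first by rewrite size_polyN size_poly1.
apply: lattice_sum => l _; have [k ltk <-] := nthP 0 vh.
rewrite mulrC; apply: lattice_le (leq_addr _ _) _; rewrite -[(_ * _)%N]addn0.
apply: lattice_mul (latc _ _ (ltn_ord l) ltk) _ => k' ltk'.
by rewrite mulrC; apply/lattice_mem/mem_w; rewrite ?mem_nth.
Qed.

End Extension.

(** * Polynomials over series with bounded coefficients *)

Section BoundedPoly.
Local Open Scope ring_scope.
Implicit Types (p : {poly series}) (v : seq series).
Local Notation emb := series_of_poly.

Definition bounded_poly D d v p :=
  (size p <= d.+1)%N /\ forall i, bounded D v p`_i.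

Lemma bounded_poly_le D E d e v p : (D <= E)%N -> (d <= e)%N ->
  bounded_poly D d v p -> bounded_poly E e v p.
Proof.
move=> leDE lede [szp bp]; split; first exact: leq_trans szp _.
by move=> i; apply: bounded_le leDE _.
Qed.

Lemma bounded_polyC D v f : bounded D v f -> bounded_poly D 0 v f%:P.
Proof.
move=> bf; split=> [|i]; first by rewrite size_polyC; case: eqP.
by rewrite coefC; case: ifP => // _; apply: bounded0.
Qed.

Lemma bounded_polyX v : bounded_poly 0 1 v 'X.
Proof.
split=> [|i]; first by rewrite size_polyX.
by rewrite coefX; case: eqP => _; [apply: bounded1|apply: bounded0].
Qed.

Lemma bounded_polyN D d v p : bounded_poly D d v p -> bounded_poly D d v (- p).
Proof.
by move=> [szp bp]; split=> [|i]; rewrite ?size_polyN // coefN; apply: boundedN.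
Qed.

Lemma bounded_polyD D E d e v p q : bounded_poly D d v p -> bounded_poly E e v q ->
  bounded_poly (D + E) (maxn d e) v (p + q).
Proof.
move=> [szp bp] [szq bq]; split=> [|i]; last by rewrite coefD; apply: boundedD.
by apply: leq_trans (size_polyD _ _) _; lia.
Qed.

Lemma bounded_polyM D E d e v p q : bounded_poly D d v p -> bounded_poly E e v q ->
  bounded_poly ((d + e).+1 * (D + E)) (d + e) v (p * q).
Proof.
move=> [szp bp] [szq bq]; have szpq := size_mul_leq_succ szp szq.
split=> // i; have [lti|lei] := ltnP i (d + e).+1; last first.
  by rewrite nth_default ?(leq_trans szpq) //; apply: bounded0.
rewrite coefM -(big_mkord xpredT (fun j => p`_j * q`_(i - j))).
apply: (@bounded_le (size (index_iota 0 i.+1) * (D + E))).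
  by rewrite size_iota subn0 leq_mul2r lti orbT.
by apply: bounded_sum => j _; apply: boundedM.
Qed.

Lemma bounded_poly_sum (I : eqType) (r : seq I) (P : I -> {poly series}) D d v :
  (forall i, i \in r -> bounded_poly D d v (P i)) ->
  bounded_poly (size r * D) d v (\sum_(i <- r) P i).
Proof.
elim: r => [|i r IHr] bP.
  by rewrite big_nil; apply: bounded_poly_le (bounded_polyC (bounded0 0 v)).
rewrite big_cons -[d]maxnn; apply: bounded_polyD; first by apply: bP; rewrite mem_head.
by apply: IHr => j rj; apply: bP; rewrite inE rj orbT.
Qed.

(** ['X] only shifts and a constant only scales, so [D] adds up without the factor that
    [bounded_polyM] pays for the terms of a convolution. *)
Lemma bounded_poly_prod_linear (I : eqType) (r : seq I) (P : I -> {poly series}) D v :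
  (forall i, i \in r -> P i = 'X \/ exists2 f, bounded D v f & P i = f%:P) ->
  bounded_poly (size r * D) (size r) v (\prod_(i <- r) P i).
Proof.
elim: r => [|i r IHr] bP; first by rewrite big_nil; apply/bounded_polyC/bounded1.
have [j rj|szr br] := IHr; first by apply: bP; rewrite inE rj orbT.
rewrite big_cons /= mulSn; set p := \prod_(_ <- r) _ in szr br *.
have [-> | [f bf ->]] := bP i (mem_head _ _).
  rewrite mulrC; split=> [|j].
    by apply: leq_trans (size_polyMleq _ _) _; rewrite size_polyX addn2.
  rewrite coefMX; case: eqP => _; first exact: bounded0.
  by apply: bounded_le (br _); apply: leq_addl.
split=> [|j]; last by rewrite coefCM; apply: boundedM.
rewrite mul_polyC; apply: leq_trans (size_scale_leq _ _) _; exact: leqW.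
Qed.

(** Coefficients modulo $x$. Those of index 0 and 1 amount to computing modulo $x$ and $T^2$, which
    is how the equation of a state is seen to be nontrivial. *)
Definition cst_coef p i := cst_series p`_i.

Lemma cst_sum_eq0 (I : eqType) (r : seq I) (P : pred I) (f : I -> series) :
  (forall i, i \in r -> P i -> cst_series (f i) = 0) ->
  cst_series (\sum_(i <- r | P i) f i) = 0.
Proof. by move=> f0; rewrite rmorph_sum big1_seq //= => i /andP[Pi ri]; apply: f0. Qed.

Lemma cst_coefD p q i : cst_coef (p + q) i = cst_coef p i + cst_coef q i.
Proof. by rewrite /cst_coef coefD rmorphD. Qed.

Lemma cst_coefN p i : cst_coef (- p) i = - cst_coef p i.
Proof. by rewrite /cst_coef coefN rmorphN. Qed.

Lemma cst_coefM0 p q : cst_coef (p * q) 0 = cst_coef p 0 * cst_coef q 0.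
Proof. by rewrite /cst_coef coefM big_ord1 rmorphM. Qed.

Lemma cst_coefM1 p q :
  cst_coef (p * q) 1 = cst_coef p 0 * cst_coef q 1 + cst_coef p 1 * cst_coef q 0.
Proof. by rewrite /cst_coef coefM big_ord_recl big_ord1 rmorphD !rmorphM. Qed.

Lemma cst_coefC f i : cst_coef f%:P i = if i == 0%N then cst_series f else 0.
Proof. by rewrite /cst_coef coefC; case: eqP => // _; rewrite rmorph0. Qed.

Lemma cst_coefX i : cst_coef 'X i = (i == 1%N)%:R.
Proof. by rewrite /cst_coef coefX; case: eqP => // _; rewrite ?rmorph1 ?rmorph0. Qed.

End BoundedPoly.

(** * Triangular systems *)

(* F, A and M stand for the generating functions of a state: all words, the
   sum-indecomposable ones and the skew-indecomposable ones. In a monomial,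
   None stands for x. *)
Section System.
Local Open Scope ring_scope.
Local Notation emb := series_of_poly.

Variables (Q : finType) (F A M : Q -> series) (cp cm : Q -> Q -> pred Q).
Variables (terms : Q -> seq (seq (option Q))) (rk : Q -> nat) (L d : nat).

(** Equality has to be allowed, since a block may contain as many of the patterns as the whole
    word. *)
Let le q' q := (q' == q) || (rk q' < rk q)%N.
Let x : series := emb 'X.
Hypotheses (F0 : forall q, cst_series (F q) = 0)
  (A0 : forall q, cst_series (A q) = 0) (M0 : forall q, cst_series (M q) = 0).
Hypotheses (cpP : forall q1 q2 q, cp q1 q2 q -> le q1 q /\ le q2 q)
  (cmP : forall q1 q2 q, cm q1 q2 q -> le q1 q /\ le q2 q).
Hypotheses
  (FA : forall q, F q = A q +
     \sum_(q1 : Q) \sum_(q2 : Q) (cp q1 q2 q)%:R * (A q1 * F q2))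
  (FM : forall q, F q = M q +
     \sum_(q1 : Q) \sum_(q2 : Q) (cm q1 q2 q)%:R * (M q1 * F q2))
  (FR : forall q, A q + M q = F q +
     \sum_(m <- terms q) \prod_(o <- m) oapp F x o).
Hypotheses (size_terms : forall q, (size (terms q) <= L)%N)
  (termP : forall q m, m \in terms q ->
     [/\ (size m <= d)%N, m = [:: None] \/ (1 < size m)%N &
         forall q', Some q' \in m -> le q' q]).

Lemma extension_bound_le n n' D e : (n <= n')%N ->
  (extension_bound n D e <= extension_bound n' D e)%N.
Proof.
by move=> lenn'; rewrite /extension_bound !(leq_add, leq_mul).
Qed.

(** [B1] bounds the coefficients of the numerators and denominators, [B2] and [e] the coefficients
    and the degree of the equation for [F q], [B3] the series [F q]; [C] bounds the denominators of
    [A q] and [M q], and [n] the size of the new family. The final sum dominates every size and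
    degree of the stage, so that a single number is iterated. *)
Definition system_step_bound k L d z : nat :=
  let B1 := (k * k * (2 * z) + k * z)%N in
  let B2 := (12 * B1 + (d + 4) * (L * (d * z.+1) + 6 * B1))%N in
  let e := (d + 3)%N in
  let B3 := extension_bound z B2 e in
  let C := (k * z + B3)%N in
  let n := (z * e)%N in
  (n + z + B3 + (n * (n * C + n * C) + (B3 + k * z + k * k * (2 * z)) + n * C))%N.

Section Stage.
Variables (q : Q) (v : seq series) (z : nat).
Hypotheses (nzv : has (fun g => g != 0) v) (szv : (size v <= z)%N).
Hypothesis bv : forall q', (rk q' < rk q)%N ->
  [/\ bounded z v (F q'), bounded z v (A q') & bounded z v (M q')].

Let le_neq q' : q' != q -> le q' q -> (rk q' < rk q)%N.
Proof. by rewrite /le => /negPf->. Qed.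

Section Half.
Variables (G : Q -> series) (c : Q -> Q -> pred Q).
Hypotheses (G0 : forall q, cst_series (G q) = 0)
  (cP : forall q1 q2, c q1 q2 q -> le q1 q /\ le q2 q)
  (bG : forall q', (rk q' < rk q)%N -> bounded z v (G q'))
  (FG : F q = G q + \sum_(q1 : Q) \sum_(q2 : Q) (c q1 q2 q)%:R * (G q1 * F q2)).

(* Isolating the terms with F q and G q makes G q a fraction of degree one in
   F q, with coefficients in the part of the system already solved. *)
Lemma half_equation : exists u w a : series, exists e : bool,
  [/\ [/\ cst_series u = 0, cst_series w = 0 & cst_series a = 0],
      [/\ bounded (#|Q| * z) v u, bounded (#|Q| * z) v w &
          bounded (#|Q| * #|Q| * (2 * z)) v a] &
      G q * (1 + u + e%:R * F q) = F q * (1 - w) - a].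
Proof.
pose u := \sum_(q2 | q2 != q) (c q q2 q)%:R * F q2.
pose w := \sum_(q1 | q1 != q) (c q1 q q)%:R * G q1.
pose a := \sum_(q1 | q1 != q) \sum_(q2 | q2 != q) (c q1 q2 q)%:R * (G q1 * F q2).
exists u, w, a, (c q q q); split.
- split; apply: cst_sum_eq0 => q1 _ _; rewrite ?rmorphM /= ?F0 ?G0 ?mulr0 //.
  by apply: cst_sum_eq0 => q2 _ _; rewrite !rmorphM /= F0 !mulr0.
- have b1 q1 q2 f : (c q1 q2 q -> bounded z v f) -> bounded z v ((c q1 q2 q)%:R * f).
    case: (c q1 q2 q) => bf; rewrite ?mul1r ?mul0r; [exact: bf|exact: bounded0].
  have le_c := cP.
  split; rewrite -?mulnA.
  + apply: bounded_sum_fin => q2 nq2; apply: b1 => /le_c[_ le2].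
    by case: (bv (le_neq nq2 le2)).
  + by apply: bounded_sum_fin => q1 nq1; apply: b1 => /le_c[le1 _]; apply/bG/le_neq.
  + apply: bounded_sum_fin => q1 nq1; apply: bounded_sum_fin => q2 nq2.
    case: (boolP (c q1 q2 q)) => [/le_c[le1 le2]|_]; rewrite ?mul1r ?mul0r; last exact: bounded0.
    rewrite mul2n -addnn; apply: boundedM; first exact/bG/le_neq.
    by case: (bv (le_neq nq2 le2)).
- set e : series := (c q q q)%:R.
  have SE : \sum_(q1 : Q) \sum_(q2 : Q) (c q1 q2 q)%:R * (G q1 * F q2) =
      e * (G q * F q) + G q * u + F q * w + a.
    rewrite (bigD1 q) //= (bigD1 q) //= -/e -!addrA; congr (_ + _).
    rewrite mulr_sumr; congr (_ + _); first by apply: eq_bigr => q2 _; rewrite mulrCA.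
    rewrite mulr_sumr -big_split; apply: eq_bigr => q1 _ /=.
    by rewrite (bigD1 q) //= [G q1 * _]mulrC mulrCA.
  move: FG; rewrite SE => /eqP; rewrite -subr_eq0 => /eqP FGE.
  apply/eqP; rewrite -subr_eq0 -oppr_eq0 -[X in _ == X]FGE; apply/eqP; ring.
Qed.

End Half.

Let R : {poly series} := \sum_(m <- terms q)
  \prod_(o <- m) oapp (fun q' => if q' == q then 'X else (F q')%:P) x%:P o.

Let R_horner : R.[F q] = \sum_(m <- terms q) \prod_(o <- m) oapp F x o.
Proof.
rewrite horner_sum; apply: eq_bigr => m _; rewrite horner_prod.
apply: eq_bigr => -[q'|] _ /=; last by rewrite hornerC.
by case: eqP => [->|_]; rewrite ?hornerX ?hornerC.
Qed.

Let R_bounded : bounded_poly (L * (d * z.+1)) d v R.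
Proof.
apply: (@bounded_poly_le (size (terms q) * (d * z.+1)) _ d) => //.
  by rewrite leq_mul2r size_terms orbT.
apply: bounded_poly_sum => m qm; have [szm _ le_m] := termP qm.
apply: (@bounded_poly_le (size m * z.+1) _ (size m)) => //.
  by rewrite leq_mul2r szm orbT.
apply: bounded_poly_prod_linear => -[q'|] mo /=; last first.
  by right; exists x => //; apply: bounded_emb; rewrite size_polyX.
case: eqP => [_|/eqP nq']; [by left|right; exists (F q') => //].
by apply: bounded_le (leqnSn _) _; case: (bv (le_neq nq' (le_m _ mo))).
Qed.

(** A monomial is $x$ itself or has at least two factors, each vanishing modulo $x$ and $T$; either
    way it vanishes modulo $x$ and $T^2$. *)
Let R_cst i : (i < 2)%N -> cst_coef R i = 0.
Proof.
move=> lti; rewrite /R /cst_coef coef_sum; apply: cst_sum_eq0 => m /termP[_ lm _] _.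
rewrite -/(cst_coef _ i); case: lm => [->|].
  rewrite big_seq1 /= cst_coefC /cst_series /x /series_of_poly coefX.
  by case: ifP.
case: m => [//|o1 [//|o2 m]] _; rewrite !big_cons.
have c0 o : cst_coef (oapp (fun q' => if q' == q then 'X else (F q')%:P) x%:P o) 0 = 0.
  case: o => [q'|] /=; last by rewrite cst_coefC /cst_series /x /series_of_poly coefX.
  by case: eqP => _; rewrite ?cst_coefX ?cst_coefC ?F0.
case: i lti => [|[|//]] _; first by rewrite cst_coefM0 c0 mul0r.
by rewrite cst_coefM1 cst_coefM0 !c0 !mul0r mulr0 addr0.
Qed.

(** Only [F q] is adjoined to the family; [A q] and [M q], being fractions in [F q], need no further
    generators. *)
Lemma system_step : exists w : seq series,
  let Z := system_step_bound #|Q| L d z in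
  [/\ has (fun g => g != 0) w, (size w <= Z)%N,
     forall g, bounded z v g -> bounded Z w g &
     [/\ bounded Z w (F q), bounded Z w (A q) & bounded Z w (M q)]].
Proof.
have bA q' : (rk q' < rk q)%N -> bounded z v (A q') by move/bv; case.
have bM q' : (rk q' < rk q)%N -> bounded z v (M q') by move/bv; case.
have [u [w [a [e [[u0 w0 a0] [bu bw ba] EA]]]]] := half_equation A0 (fun q1 q2 => @cpP q1 q2 q) bA (FA q).
have [u' [w' [a' [e' [[u0' w0' a0'] [bu' bw' ba'] EM]]]]] := half_equation M0 (fun q1 q2 => @cmP q1 q2 q) bM (FM q).
set k := #|Q| in bu bw ba bu' bw' ba' *.
pose B1 := (k * k * (2 * z) + k * z)%N.
have den_bounded (t : series) (b : bool) : bounded (k * z) v t ->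
    bounded_poly B1 1 v ((1 + t)%:P + b%:R *: 'X).
  move=> bt; apply: (@bounded_poly_le (k * z + 0)%N _ (maxn 0 1)) => //.
    by rewrite addn0 leq_addl.
  apply: bounded_polyD; first by apply/bounded_polyC/(boundedD (bounded1 0 v) bt).
  case: b; rewrite ?scale1r ?scale0r; first exact: bounded_polyX.
  by apply: bounded_poly_le (bounded_polyC (bounded0 0 v)).
have num_bounded (t s : series) : bounded (k * z) v t -> bounded (k * k * (2 * z)) v s ->
    bounded_poly B1 1 v ((1 - t) *: 'X - s%:P).
  move=> bt bs; rewrite /B1 addnC -[1%N]/(maxn 1 0); apply: bounded_polyD => //; last first.
    exact/bounded_polyN/bounded_polyC.
  rewrite -mul_polyC; split=> [|i].
    apply: leq_trans (size_polyMleq _ _) _; rewrite size_polyX size_polyC; by case: eqP.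
  rewrite coefCM coefX; case: eqP => _; rewrite ?mulr0 ?mulr1; last exact: bounded0.
  by apply: (boundedD (bounded1 0 v)); apply: boundedN.
have bD := den_bounded _ e bu; have bD' := den_bounded _ e' bu'.
have bN := num_bounded _ _ bw ba; have bN' := num_bounded _ _ bw' ba'.
set D := (1 + u)%:P + _ in bD; set D' := (1 + u')%:P + _ in bD'.
set N := (1 - w) *: _ - _ in bN; set N' := (1 - w') *: _ - _ in bN'.
(* A q = N / D and M q = N' / D' at F q, so FR becomes a polynomial equation
   for F q; it is not trivial because its linear coefficient is 1 modulo x. *)
pose E := N * D' + N' * D - ('X + R) * (D * D').
pose B2 := (12 * B1 + (d + 4) * (L * (d * z.+1) + 6 * B1))%N.
have bE : bounded_poly B2 (d + 3) v E.
  have bND := bounded_polyD (bounded_polyM bN bD') (bounded_polyM bN' bD).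
  have bXR := bounded_polyM (bounded_polyD (bounded_polyX v) R_bounded) (bounded_polyM bD bD').
  have := bounded_polyD bND (bounded_polyN bXR).
  apply: bounded_poly_le; last by lia.
  (* A product of two linear polynomials costs [6 * B1], and the sum has two of them. ['X + R] has
     degree at most [maxn 1 d] and is multiplied by a quadratic polynomial, hence the factor
     [d + 4]. *)
  rewrite /B2; apply: leq_add; first by lia.
  by apply: leq_mul; lia.
have E_root : E.[F q] = 0.
  have NE : N.[F q] = A q * D.[F q].
    apply: etrans (_ : F q * (1 - w) - a = _); first by rewrite /N !hornerE; ring.
    by rewrite -EA /D !hornerE; ring.
  have NE' : N'.[F q] = M q * D'.[F q].
    apply: etrans (_ : F q * (1 - w') - a' = _); first by rewrite /N' !hornerE; ring.
    by rewrite -EM /D' !hornerE; ring.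
  move: NE NE'; rewrite /E; move: (N) (N') (D) (D') => N1 N2 D1 D2 NE NE'.
  rewrite !(hornerD, hornerN, hornerM) NE NE' hornerX R_horner -FR; ring.
have nzE : E != 0.
  (* Modulo $x$ and $T^2$, [N] and [N'] are $T$, [D] and [D'] have constant term 1 and [R] is 0, so
     [E] reduces to $T+T-T$. *)
  have : cst_coef E 1 = 1.
    rewrite /E !(cst_coefD, cst_coefN, cst_coefM1, cst_coefM0) !(cst_coefX, R_cst) //=.
    rewrite /D /D' /N /N' !(cst_coefD, cst_coefN, cst_coefC) /=.
    rewrite -!mul_polyC !(cst_coefM1, cst_coefM0, cst_coefX, cst_coefC) /=.
    rewrite ?rmorphD ?rmorphN ?rmorph1 /= ?u0 ?u0' ?w0 ?w0' ?a0 ?a0'; ring.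
  by apply: contra_eqN => /eqP ->; rewrite /cst_coef coef0 rmorph0 eq_sym oner_eq0.
have [y [nzy szy by_ bFy]] := bounded_extension nzv nzE bE.1 bE.2 E_root.
set B3 := extension_bound _ _ _ in bFy.
move: bFy => /(bounded_le (extension_bound_le B2 (d + 3) szv)); clear B3.
set B3 := extension_bound _ _ _ => bFy.
pose C := (k * z + B3)%N; pose n := (z * (d + 3))%N.
have lesy : (size y <= n)%N by apply: leq_trans szy _; rewrite leq_mul2r szv orbT.
(* The denominator has constant term 1, so it is not zero and [norm_multiple] applies; the cofactor
   [h] turns it into a polynomial [m], by which [bounded_div] divides. *)
have half (t s r G : series) (b : bool) :
    bounded (k * z) v t -> bounded (k * z) v s -> bounded (k * k * (2 * z)) v r ->
    cst_series t = 0 -> G * (1 + t + b%:R * F q) = F q * (1 - s) - r ->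
    bounded ((n * (n * C + n * C) + (B3 + k * z + k * k * (2 * z)) + n * C))%N y G.
  move=> /by_ bt /by_ bs /by_ br t0 EG.
  have bden : bounded C y (1 + t + b%:R * F q).
    apply: boundedD; first exact: (boundedD (bounded1 0 y) bt).
    by case: b {EG}; rewrite ?mul1r ?mul0r //; apply: bounded0.
  have nzden : 1 + t + b%:R * F q != 0.
    apply/eqP => /(congr1 cst_series)/eqP.
    by rewrite !rmorphD rmorphM /= t0 F0 rmorph1 rmorph0 mulr0 !addr0 oner_eq0.
  have [h bh [m /andP[nzm szm] mE]] := norm_multiple nzy nzden bden.
  apply: (@bounded_le (size y * (size y * C + size y * C) +
    (B3 + k * z + k * k * (2 * z)) + size y * C)%N).
    by rewrite !leq_add ?leq_mul ?leq_add ?leq_mul.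
  apply: (bounded_div nzm szm); rewrite mE -mulrA [_ * G]mulrC EG.
  apply: (boundedM bh); apply: boundedD; last exact: boundedN.
  by apply: (boundedM bFy); apply: (boundedD (bounded1 0 y)); apply: boundedN.
set Y := (n * (n * C + n * C) + _ + _)%N in half.
have ZE : system_step_bound k L d z = (n + z + B3 + Y)%N by [].
exists y; rewrite ZE; split=> //.
- by apply: leq_trans lesy _; rewrite -!addnA leq_addr.
- by move=> g /by_; apply: bounded_le; lia.
split.
- by apply: bounded_le bFy; lia.
- by apply: bounded_le (half _ _ _ _ _ bu bw ba u0 EA); lia.
- by apply: bounded_le (half _ _ _ _ _ bu' bw' ba' u0' EM); lia.
Qed.

End Stage.

Definition system_bound k := iter k (system_step_bound k L d) 1.

(** States are treated in order of rank. Ties may come in any order, because a stage uses only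
    states of strictly smaller rank. *)
Lemma system_bounded : exists v : seq series,
  let Z := system_bound #|Q| in
  [/\ has (fun g => g != 0) v, (size v <= Z)%N & forall q, bounded Z v (F q)].
Proof.
pose ss := sort (relpre rk leq) (enum Q).
have ss_mem q : q \in ss by rewrite mem_sort mem_enum.
have sz_ss : size ss = #|Q| by rewrite size_sort cardE.
have ss_sorted : sorted (relpre rk leq) ss by apply: sort_sorted => ? ?; apply: leq_total.
suff stage j : (j <= #|Q|)%N -> exists v : seq series,
    let Z := iter j (system_step_bound #|Q| L d) 1 in
    [/\ has (fun g => g != 0) v, (size v <= Z)%N & forall q, (index q ss < j)%N ->
       [/\ bounded Z v (F q), bounded Z v (A q) & bounded Z v (M q)]].
  have [v [nzv szv bv]] := stage _ (leqnn _).
  exists v; split=> // q; have ltq : (index q ss < #|Q|)%N by rewrite -sz_ss index_mem.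
  by case: (bv q ltq).
elim: j => [|j IHj] ltj.
  exists [:: 1]; split=> //=; by rewrite oner_eq0.
have [v [nzv szv bv]] := IHj (ltnW ltj).
have [q0 _] : exists q0 : Q, True by case/card_gt0P: (leq_ltn_trans (leq0n _) ltj) => q0; exists q0.
pose q := nth q0 ss j.
have [q' ltq'|w [nzw szw bw bq]] := @system_step q v _ nzv szv.
  apply: bv; rewrite ltnNge; apply/negP => lej.
  move: ltq'; rewrite ltnNge => /negP[].
  rewrite -[q'](nth_index q0 (ss_mem q')).
  have trans_rk : transitive (relpre rk leq) by move=> ? ? ?; apply: leq_trans.
  apply: (sorted_leq_nth trans_rk _ q0 ss_sorted) => //=; rewrite ?inE ?sz_ss //; last by rewrite -sz_ss index_mem.
    by move=> ?; apply: leqnn.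
exists w; split=> // q'; rewrite ltnS leq_eqVlt => /predU1P[e|/bv[bF bA bM]].
  have -> : q' = q by rewrite /q -e nth_index.
  exact: bq.
by split; apply: bw.
Qed.

End System.

(** * Patterns and inflations *)

Section Words.
Implicit Types (u v w t s : word) (bs us ts : seq word).

Definition rank w x := size (undup [seq y <- w | y <= x]).

Lemma rank_mono w : {in w &, {mono rank w : x y / x <= y}}.
Proof.
move=> x y wx wy; have [lexy|ltyx] := leqP x y.
  apply: uniq_leq_size; first exact: undup_uniq.
  by move=> z; rewrite !mem_undup !mem_filter => /andP[/leq_trans->].
apply/negbTE; rewrite -ltnNge.
apply: (@leq_trans (size (x :: undup [seq z <- w | z <= y]))) => //.
apply: uniq_leq_size => [|z].
  by rewrite /= undup_uniq mem_undup mem_filter leqNgt ltyx.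
rewrite inE !mem_undup !mem_filter => /predU1P[->|/andP[lezy ->]].
  by rewrite leqnn.
by rewrite (leq_trans lezy (ltnW ltyx)).
Qed.

(** As [i] and [j] may be exchanged, equalities between letters are recorded too; the relation
    amounts to equality of standardizations ([st_oisoE]). *)
Definition oiso u v := size u = size v /\
  forall i j, i < size u -> j < size u ->
    (nth 0 u i <= nth 0 u j) = (nth 0 v i <= nth 0 v j).

Lemma oiso_sym u v : oiso u v -> oiso v u.
Proof. by move=> [szE ord]; split=> // i j; rewrite -szE => lti ltj; rewrite ord. Qed.

Lemma oiso_trans u v w : oiso u v -> oiso v w -> oiso u w.
Proof.
move=> [szE ord] [szE' ord']; split=> [|i j lti ltj]; first by rewrite szE.
by rewrite ord // ord' -?szE.
Qed.

Lemma oiso_map (f : nat -> nat) u :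
  {in u &, {mono f : x y / x <= y}} -> oiso (map f u) u.
Proof.
move=> fmono; split=> [|i j]; rewrite size_map // => lti ltj.
by rewrite !(nth_map 0) // fmono ?mem_nth.
Qed.

Lemma st_oiso w : oiso (st w) w.
Proof. exact/oiso_map/rank_mono. Qed.

Lemma mono_leq_inj_in (f : nat -> nat) u :
  {in u &, {mono f : x y / x <= y}} -> {in u &, injective f}.
Proof.
move=> fmono x y ux uy fE; apply/eqP.
by rewrite eqn_leq -fmono // fE leqnn -fmono // fE leqnn.
Qed.

Lemma st_map (f : nat -> nat) u :
  {in u &, {mono f : x y / x <= y}} -> st (map f u) = st u.
Proof.
move=> fmono; rewrite /st -map_comp; apply/eq_in_map => x ux /=.
have fsub : {in [seq y <- u | y <= x] &, injective f}.
  by move=> y z; rewrite !mem_filter => /andP[_ uy] /andP[_ uz];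
    apply: (mono_leq_inj_in fmono).
rewrite -/(rank u x) /rank -[RHS](size_map f); apply/perm_size/uniq_perm.
- exact: undup_uniq.
- rewrite map_inj_in_uniq ?undup_uniq // => y z; rewrite !mem_undup; exact: fsub.
move=> y; rewrite mem_undup mem_filter.
apply/andP/mapP => [[lefy /mapP[z uz yE]]|[z]].
  by exists z; rewrite // mem_undup mem_filter uz -fmono // -yE lefy.
rewrite mem_undup mem_filter => /andP[lez uz] ->.
by rewrite fmono // lez map_f.
Qed.

Lemma oiso_mapE u v : oiso u v ->
  exists2 f, {in u &, {mono f : x y / x <= y}} & v = map f u.
Proof.
move=> [szE ord]; exists (fun x => nth 0 v (index x u)) => [x y ux uy|].
  by rewrite -ord ?index_mem // !nth_index.
apply: (@eq_from_nth _ 0) => [|i]; rewrite -szE ?size_map // => lti.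
rewrite (nth_map 0) //; have lt' : index (nth 0 u i) u < size u.
  by rewrite index_mem mem_nth.
by apply/eqP; rewrite eqn_leq -!ord // !nth_index ?mem_nth ?leqnn.
Qed.

Lemma oiso_st u v : oiso u v -> st u = st v.
Proof. by move=> /oiso_mapE[f fmono ->]; rewrite st_map. Qed.

Lemma st_oisoE u v : st u = st v <-> oiso u v.
Proof.
split=> [stE|/oiso_st//]; apply: oiso_trans (oiso_sym (st_oiso u)) _.
rewrite stE; exact: st_oiso.
Qed.

Lemma size_st w : size (st w) = size w. Proof. exact: size_map. Qed.

(** The ranks of the distinct letters are distinct and lie between 1 and their number, so by
    counting they fill this range. *)
Lemma cayley_st w : cayley (st w).
Proof.
exists (size (undup w)); first by rewrite size_st size_undup.
have inj : {in undup w &, injective (rank w)}.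
  by move=> x y; rewrite !mem_undup; apply: (mono_leq_inj_in (@rank_mono w)).
have sub : {subset map (rank w) (undup w) <= iota 1 (size (undup w))}.
  move=> y /mapP[x]; rewrite mem_undup => wx ->; rewrite mem_iota add1n ltnS.
  apply/andP; split.
    by rewrite -has_predT; apply/hasP; exists x => //; rewrite mem_undup mem_filter leqnn.
  apply: uniq_leq_size; first exact: undup_uniq.
  by move=> z; rewrite !mem_undup mem_filter => /andP[].
have [||_ eqi] := uniq_min_size _ sub.
- by rewrite map_inj_in_uniq // undup_uniq.
- by rewrite size_iota size_map.
move=> y; rewrite -eqi; apply/mapP/mapP => -[x].
  by move=> wx ->; exists x; rewrite ?mem_undup.
by rewrite mem_undup => wx ->; exists x.
Qed.

Lemma st_cayley w : cayley w -> st w = w.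
Proof.
move=> [m _ wE]; rewrite /st -[RHS]map_id; apply/eq_in_map => x wx.
rewrite -[RHS](size_iota 1); apply/perm_size/uniq_perm; rewrite ?undup_uniq ?iota_uniq //.
move=> y; rewrite mem_undup mem_filter wE !mem_iota.
by move: wx; rewrite wE mem_iota; lia.
Qed.

Lemma oiso_cayley u v : cayley u -> cayley v -> oiso u v -> u = v.
Proof. by move=> cu cv /oiso_st; rewrite !st_cayley. Qed.

Lemma st_st w : st (st w) = st w.
Proof. exact/st_cayley/cayley_st. Qed.

Lemma contained_oiso t w :
  cayley t -> contained t w <-> exists2 u, subseq u w & oiso u t.
Proof.
move=> ct; split=> [[u su ut]|[u su ut]]; exists u => //.
  by rewrite -ut; apply/oiso_sym/st_oiso.
by rewrite (oiso_st ut) st_cayley.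
Qed.

Lemma subseq_map_inv (f : nat -> nat) u w :
  subseq u (map f w) -> exists2 u', subseq u' w & u = map f u'.
Proof.
move=> /subseqP[m szm ->]; exists (mask m w); last by rewrite map_mask.
exact: mask_subseq.
Qed.

Lemma contained_st t w : contained t (st w) <-> contained t w.
Proof.
have mono u : subseq u w -> {in u &, {mono rank w : x y / x <= y}}.
  by move=> /mem_subseq su x y /su wx /su wy; apply: rank_mono.
split=> [[_ /subseq_map_inv[u su ->] ut]|[u su ut]].
  by exists u => //; rewrite -ut st_map //; apply: mono.
exists (map (rank w) u); first exact: map_subseq.
by rewrite st_map //; apply: mono.
Qed.

Lemma contained_refl w : cayley w -> contained w w.
Proof. by move=> cw; exists w => //; apply: st_cayley. Qed.

Lemma contained_trans s t w : contained s t -> contained t w -> contained s w.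
Proof.
move=> st' [u su ut]; move: st'; rewrite -ut => /contained_st[u' su' u't].
by exists u' => //; apply: subseq_trans su' su.
Qed.

Lemma contained_cayley t w : contained t w -> cayley t.
Proof. by move=> [u _ <-]; apply: cayley_st. Qed.

Lemma contained_size t w : contained t w -> size t <= size w.
Proof. by move=> [u /size_subseq + <-]; rewrite size_st. Qed.

Lemma contained_size_eq t w : cayley w -> contained t w -> size t = size w -> t = w.
Proof.
move=> cw [u su <-]; rewrite size_st => szE.
have -> : u = w by apply/eqP; rewrite -(size_subseq_leqif su) szE.
exact: st_cayley.
Qed.

Lemma cayley_letter w x : cayley w -> x \in w -> 0 < x <= size w.
Proof. by move=> [m lem wE]; rewrite wE mem_iota; lia. Qed.

(** Both comparisons are tested because [pairwise] visits each pair of blocks in one order only. *)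
Definition cross (a b : nat * word) :=
  all (fun x => all (fun y =>
    ((x <= y) == (a.1 <= b.1)) && ((y <= x) == (b.1 <= a.1))) b.2) a.2.

(* bs cuts a word into factors whose letters compare like those of s. *)
Definition infl s bs := (size bs == size s) && pairwise cross (zip s bs).

Lemma inflP s bs : reflect (size bs = size s /\ forall i j x y,
    i < size s -> j < size s -> i != j -> x \in nth [::] bs i -> y \in nth [::] bs j ->
    (x <= y) = (nth 0 s i <= nth 0 s j)) (infl s bs).
Proof.
apply: (iffP andP) => [[/eqP szE /(pairwiseP (0, [::])) pw]|[szE cr]].
  have pw' i j x y : i < size s -> j < size s -> i < j ->
      x \in nth [::] bs i -> y \in nth [::] bs j ->
      (x <= y) = (nth 0 s i <= nth 0 s j) /\ (y <= x) = (nth 0 s j <= nth 0 s i).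
    move=> lti ltj ltij bx by_.
    have := pw i j; rewrite !inE !size_zip szE minnn !nth_zip // => /(_ lti ltj ltij).
    by move=> /allP/(_ _ bx)/allP/(_ _ by_)/andP[/eqP-> /eqP->].
  split=> // i j x y lti ltj; rewrite neq_ltn => /orP[ltij|ltji] bx by_.
    by case: (pw' i j x y).
  by case: (pw' j i y x).
split; first exact/eqP.
apply/(pairwiseP (0, [::])) => i j; rewrite !inE !size_zip szE minnn => lti ltj ltij.
rewrite !nth_zip //; apply/allP => x bx; apply/allP => y by_.
by rewrite (cr i j x y) ?(cr j i y x) ?eqxx //= neq_ltn ltij ?orbT.
Qed.

Lemma infl_map (f : nat -> nat) s bs :
  {in flatten bs &, {mono f : x y / x <= y}} -> infl s bs -> infl s (map (map f) bs).
Proof.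
move=> fmono /inflP[szE cr]; apply/inflP; rewrite size_map; split=> // i j x y lti ltj nij.
rewrite !(nth_map [::]) ?szE // => /mapP[x' bx ->] /mapP[y' by_ ->].
rewrite fmono; first exact: cr.
  by apply/flattenP; exists (nth [::] bs i); rewrite ?mem_nth ?szE.
by apply/flattenP; exists (nth [::] bs j); rewrite ?mem_nth ?szE.
Qed.

Lemma infl_sub s bs us : infl s bs -> size us = size bs ->
  (forall i, i < size s -> {subset nth [::] us i <= nth [::] bs i}) -> infl s us.
Proof.
move=> /inflP[szE cr] szE' sub; apply/inflP; split=> [|i j x y lti ltj nij ux uy].
  by rewrite szE' szE.
by apply: cr => //; apply: sub.
Qed.

Lemma infl_oiso s s' bs : oiso s s' -> infl s bs -> infl s' bs.
Proof.
move=> [szE ord] /inflP[szE' cr]; apply/inflP; rewrite szE' szE; split=> // i j x y.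
by rewrite -szE => lti ltj nij bx by_; rewrite -ord //; apply: cr.
Qed.

Lemma oiso_flatten s us ts : infl s us -> infl s ts ->
  (forall i, i < size s -> oiso (nth [::] us i) (nth [::] ts i)) ->
  oiso (flatten us) (flatten ts).
Proof.
move=> /inflP[szu cru] /inflP[szt crt] iso.
have shE : shape us = shape ts.
  apply: (@eq_from_nth _ 0) => [|i]; rewrite !size_map ?szu ?szt // => lti.
  by rewrite !(nth_map [::]) ?szu ?szt // (iso i lti).1.
split=> [|i j]; rewrite !size_flatten ?shE // => lti ltj; rewrite !nth_flatten shE.
set r1 := reshape_index _ i; set c1 := reshape_offset _ i.
set r2 := reshape_index _ j; set c2 := reshape_offset _ j.
have szE : size (shape ts) = size s by rewrite size_map.
have ltr1 : r1 < size s by rewrite -szE reshape_indexP.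
have ltr2 : r2 < size s by rewrite -szE reshape_indexP.
have ltc1 : c1 < size (nth [::] ts r1) by rewrite -(nth_map _ 0) ?szt // reshape_offsetP.
have ltc2 : c2 < size (nth [::] ts r2) by rewrite -(nth_map _ 0) ?szt // reshape_offsetP.
have [er|ner] := eqVneq r1 r2.
  by rewrite er in ltc1 *; have [szE' ord] := iso r2 ltr2; rewrite ord // szE'.
rewrite [RHS](crt r1 r2 _ _ ltr1 ltr2 ner) ?mem_nth //.
by apply: cru => //; rewrite mem_nth // (iso _ _).1.
Qed.

Lemma subseq_flatten u bs : subseq u (flatten bs) <->
  exists us, [/\ size us = size bs, u = flatten us &
    forall i, i < size bs -> subseq (nth [::] us i) (nth [::] bs i)].
Proof.
split=> [|[us [szE -> sub]]]; last first.
  elim: bs us szE sub => [|b bs IHbs] [|u' us] //= [szE] sub.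
  apply: cat_subseq; first exact: (sub 0).
  by apply: IHbs => // i lti; apply: (sub i.+1).
elim: bs u => [|b bs IHbs] u /=; first by move=> /eqP->; exists [::].
move=> /subseqP[m szm ->]; rewrite -[m](cat_take_drop (size b)) mask_cat; last first.
  by rewrite size_takel // szm size_cat leq_addr.
have [|us [szE -> sub]] := IHbs (mask (drop (size b) m) (flatten bs)).
  exact: mask_subseq.
exists (mask (take (size b) m) b :: us); rewrite /= szE; split=> // -[|i] lti /=.
  exact: mask_subseq.
exact: sub.
Qed.

Lemma mem_subseq_flatten b bs : b \in bs -> subseq b (flatten bs).
Proof.
case/path.splitPr=> p1 p2; rewrite flatten_cat /=.
exact: subseq_trans (prefix_subseq _ _) (suffix_subseq _ _).
Qed.

(** An occurrence of a pattern is cut by the blocks, and some pieces may be empty. [infl] puts no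
    condition on the letters of an empty block; nonemptiness belongs to [tight]. *)
Lemma contained_flatten s bs t : infl s bs -> contained t (flatten bs) <->
  exists ts, [/\ infl s ts, t = flatten ts &
    forall i, i < size s -> contained (st (nth [::] ts i)) (nth [::] bs i)]
    /\ cayley t.
Proof.
move=> ibs; have /inflP[szE _] := ibs; split=> [[u /subseq_flatten[us [szu uE sub]] ut]|].
  have ius : infl s us.
    by apply: infl_sub ibs szu _ => i lti; apply/mem_subseq/sub; rewrite szE.
  exists (map (map (rank u)) us); split; [split|by rewrite -ut; apply: cayley_st].
  - by apply: infl_map => //; rewrite -uE; apply: rank_mono.
  - by rewrite -map_flatten -uE -ut.
  move=> i lti; have ltu : i < size us by rewrite szu szE.
  rewrite (nth_map [::]) // st_map; first by exists (nth [::] us i); rewrite ?sub ?szE.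
  move=> x y ux uy; apply: rank_mono; rewrite uE; apply/flattenP.
    by exists (nth [::] us i); rewrite ?mem_nth.
  by exists (nth [::] us i); rewrite ?mem_nth.
move=> [ts [[its -> con] ct]]; have /inflP[szt _] := its.
have /choice[f fP] (i : nat) : exists u, i < size s ->
    subseq u (nth [::] bs i) /\ oiso u (nth [::] ts i).
  have [lti|] := ltnP i (size s); last by exists [::].
  by have [u su ut] := con i lti; exists u => _; split=> //; apply/st_oisoE.
pose us := mkseq f (size s).
have ius : infl s us.
  apply: infl_sub ibs _ _ => [|i lti]; first by rewrite size_mkseq szE.
  by rewrite nth_mkseq //; apply: mem_subseq; case: (fP i lti).
exists (flatten us).
  apply/subseq_flatten; exists us; rewrite size_mkseq szE; split=> // i lti.
  by rewrite nth_mkseq //; case: (fP i lti).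
rewrite -[RHS]st_cayley //; apply/st_oisoE/(oiso_flatten ius its) => i lti.
by rewrite nth_mkseq //; case: (fP i lti).
Qed.

End Words.

(** * Simple words and the blocks of a decomposition *)

Section Decomposition.
Implicit Types (w t s : word) (bs us ts : seq word).

(* A letter of s that is repeated can only be replaced by a single letter. *)
Definition tight s bs := forall i, i < size s -> 0 < size (nth [::] bs i) /\
  (1 < size (nth [::] bs i) -> forall j, j < size s -> nth 0 s j = nth 0 s i -> j = i).

Definition decomp s bs w := [/\ infl s bs, tight s bs & w = flatten bs].

(** H-intervals by convexity, without an interval of values: this makes sense for all words, and
    agrees with [H_interval] on Cayley permutations because their letters have no gaps. *)
Definition order_interval w a b := a <= b < size w /\
  forall i j k, a <= i <= b -> a <= j <= b -> k < size w ->
    nth 0 w i <= nth 0 w k <= nth 0 w j -> a <= k <= b.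

Lemma H_interval_order w a b : H_interval w a b -> order_interval w a b.
Proof.
move=> [leab [c [d [img pre]]]]; split=> // i j k iab jab ltk /andP[leik lekj].
have inI l : a <= l <= b -> c <= nth 0 w l <= d by move=> lab; apply/img; exists l.
by apply/pre => //; move: (inI _ iab) (inI _ jab); lia.
Qed.

Lemma order_interval_H w a b : cayley w -> order_interval w a b -> H_interval w a b.
Proof.
move=> [m _ wE] [/andP[leab ltb] conv]; split; first by rewrite leab.
pose P (v : nat) := has (fun i => nth 0 w i == v) (iota a (b.+1 - a)).
have PP (v : nat) : P v <-> exists2 i, a <= i <= b & nth 0 w i = v.
  split=> [/hasP[i]|[i iab <-]].
    by rewrite mem_iota subnKC ?ltnS 1?leqW // => iab /eqP <-; exists i.
  by apply/hasP; exists i; rewrite // mem_iota subnKC ?ltnS ?leqW.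
have exv : exists v : nat, P v by exists (nth 0 w a); apply/PP; exists a; rewrite ?leqnn.
have Pw i : a <= i <= b -> i < size w by move=> /andP[_ /leq_ltn_trans->].
have bound (v : nat) : P v -> v <= m.
  by move/PP => [i /Pw lti <-]; have := mem_nth 0 lti; rewrite wE mem_iota add1n ltnS => /andP[].
have [c /PP[i0 i0ab i0c] minc] := ex_minnP exv.
have [d /PP[i1 i1ab i1d] maxd] := ex_maxnP exv bound.
exists c, d; split=> [v|i lti]; last first.
  split=> [cd|iab].
    by apply: (conv i0 i1 i) => //; rewrite i0c i1d.
  have Pi : P (nth 0 w i) by apply/PP; exists i.
  by rewrite minc ?maxd.
split=> [/PP Pv|/andP[cv vd]]; first by rewrite minc ?maxd.
have : v \in w.
  have := mem_nth 0 (Pw _ i0ab); have := mem_nth 0 (Pw _ i1ab).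
  rewrite i0c i1d !wE !mem_iota !add1n !ltnS => /andP[_ ledm] /andP[c_gt0 _].
  by rewrite (leq_trans c_gt0 cv) (leq_trans vd ledm).
move=> /(nthP 0)[k ltk kv]; exists k => //.
by apply: (conv i0 i1 k) => //; rewrite i0c i1d kv cv.
Qed.

Lemma simple_order_interval s a b : simple_cayley s -> order_interval s a b ->
  a = b \/ (a = 0 /\ b.+1 = size s).
Proof. by move=> [cs simp] /(order_interval_H cs); apply: simp. Qed.

Lemma simple_extreme_letter s e : simple_cayley s -> 1 < size s ->
  e = 0 \/ e.+1 = size s ->
  (forall i, i < size s -> i != e -> nth 0 s e < nth 0 s i) \/
  (forall i, i < size s -> i != e -> nth 0 s i < nth 0 s e) ->
  s = [:: 1; 2] \/ s = [:: 2; 1].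
Proof.
move=> simp szs ends ext.
have sz2 : size s = 2.
  have [a [b [ab szE ne]]] : exists a b, [/\ a <= b < size s, b + 2 = size s + a &
      forall i, i < size s -> (a <= i <= b) = (i != e)].
    case: ends => eE; first by exists 1, (size s).-1; split=> [||i lti]; lia.
    by exists 0, e.-1; split=> [||i lti]; lia.
  have ltn_b i : a <= i <= b -> i < size s by move: ab; lia.
  have I : order_interval s a b.
    split=> // i j k iab jab ltk; rewrite ne //; have [->|//] := eqVneq k e.
    have ni := ne i (ltn_b _ iab); have nj := ne j (ltn_b _ jab).
    move: ext => [/(_ i (ltn_b _ iab))|/(_ j (ltn_b _ jab))].
      by rewrite -ni iab => /(_ isT); lia.
    by rewrite -nj jab => /(_ isT); lia.
  by case: (simple_order_interval simp I); lia.
have [cs _] := simp.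
case: s sz2 {simp szs} cs ends ext => [//|x [//|y [|//]]] _ cs ends ext.
have xy : x != y.
  case: ends ext => [->|[->]] [] ext.
  - by have := ext 1 isT isT => /=; lia.
  - by have := ext 1 isT isT => /=; lia.
  - by have := ext 0 isT isT => /=; lia.
  - by have := ext 0 isT isT => /=; lia.
have cayley12 : cayley [:: 1; 2] by exists 2.
have cayley21 : cayley [:: 2; 1].
  by exists 2 => // z; rewrite !inE orbC.
have [ltxy|leyx] := ltnP x y; [left|right]; apply: oiso_cayley => //.
  by split=> // -[|[|i]] [|[|j]] //= _ _; lia.
by split=> // -[|[|i]] [|[|j]] //= _ _; lia.
Qed.

(* r sends a position of w to the index of its block. *)
Definition block_map s w (r : nat -> nat) :=
  [/\ forall i, i < size w -> r i < size s,
      {in [pred i | i < size w] &, {homo r : i j / i <= j}},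
      forall e, e < size s -> exists2 i, i < size w & r i = e,
      forall i j, i < size w -> j < size w -> r i != r j ->
        (nth 0 w i <= nth 0 w j) = (nth 0 s (r i) <= nth 0 s (r j)) &
      forall i j, i < size w -> j < size w -> i != j -> r i = r j ->
        forall e, e < size s -> nth 0 s e = nth 0 s (r i) -> e = r i].

Lemma decomp_block_map s bs w : decomp s bs w ->
  block_map s w (reshape_index (shape bs)).
Proof.
move=> [/inflP[szE cr] ti ->]; set r := reshape_index _.
have ltr i : i < size (flatten bs) -> r i < size s.
  by rewrite size_flatten => /reshape_indexP; rewrite size_map szE.
have inb i : i < size (flatten bs) -> nth 0 (flatten bs) i \in nth [::] bs (r i).
  move=> lti; rewrite nth_flatten mem_nth // -(nth_map _ 0) ?szE ?ltr //.
  by rewrite reshape_offsetP // -size_flatten.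
split=> //.
- move=> i j _ _ leij; have := reshape_leq (shape bs) i j; rewrite leij => /esym.
  by rewrite -/(r i) -/(r j) => /orP[/ltnW//|/andP[/eqP-> _]].
- move=> e lte; have lt0 : 0 < nth 0 (shape bs) e.
    by rewrite (nth_map [::]) ?szE //; case: (ti e lte).
  exists (flatten_index (shape bs) e 0); first by rewrite size_flatten flatten_indexP.
  exact: flatten_indexKl.
- by move=> i j lti ltj nij; apply: cr; rewrite ?ltr ?inb.
move=> i j lti ltj nij rij e lte se; apply: (ti (r i) (ltr i lti)).2 => //.
rewrite -(nth_map _ 0) ?szE ?ltr //.
have := @reshape_offsetP (shape bs) i; have := @reshape_offsetP (shape bs) j.
rewrite -size_flatten => /(_ ltj) + /(_ lti); rewrite -/(r i) -/(r j) -rij.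
have : reshape_offset (shape bs) i != reshape_offset (shape bs) j.
  apply: contraNneq nij => oij.
  by rewrite -(reshape_indexK (shape bs) i) -(reshape_indexK (shape bs) j) -/(r i) rij oij.
rewrite -/(shape bs); move: (reshape_offset _ i) (reshape_offset _ j) => c1 c2.
by move: (nth 0 _ _) => n; lia.
Qed.

(** The two words left out are those over which a word may have several decompositions, as a sum or
    a skew sum. [[:: 1; 1]] stays in: tightness allows it only singleton blocks. *)
Definition large_simple s :=
  [/\ simple_cayley s, 1 < size s, s <> [:: 1; 2] & s <> [:: 2; 1]].

(* An interval of w meeting several blocks projects to an interval of s, hence
   meets all of them; if it misses a position of an end block, the letter of
   that block is extreme in s and s has length two. *)
Lemma simple_block s w r a b : block_map s w r -> large_simple s -> order_interval w a b ->
  0 < a \/ b.+1 < size w -> r a = r b.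
Proof.
move=> [ltr rmono rsurj cr ti] [simp szs n12 n21] [/andP[leab ltb] conv] proper.
have lta : a < size w by apply: leq_ltn_trans ltb.
have lerab : r a <= r b by apply: rmono.
apply/eqP; rewrite eqn_leq lerab leqNgt; apply/negP => ltrab.
have ltI i : a <= i <= b -> i < size w by move=> /andP[_ /leq_ltn_trans->].
have pick e : r a <= e <= r b -> exists2 i, a <= i <= b & r i = e.
  move=> /andP[]; rewrite leq_eqVlt => /predU1P[<- _|ltae].
    by exists a; rewrite ?leqnn.
  rewrite leq_eqVlt => /predU1P[->|lteb]; first by exists b; rewrite ?leqnn ?andbT.
  have [i lti ie] := rsurj e (ltn_trans lteb (ltr _ ltb)); exists i => //.
  apply/andP; split; rewrite leqNgt; apply/negP => lt.
    by have := rmono i a; rewrite !inE lti lta ie => /(_ isT isT (ltnW lt)); lia.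
  by have := rmono b i; rewrite !inE lti ltb ie => /(_ isT isT (ltnW lt)); lia.
have I : order_interval s (r a) (r b).
  split; first by rewrite lerab ltr.
  move=> i j k iI jI ltk /andP[leik lekj]; apply: contraT => kI.
  have [x xI xi] := pick _ iI; have [y yI yj] := pick _ jI; have [z ltz zk] := rsurj _ ltk.
  have nxz : r x != r z by rewrite xi zk; apply: contraNneq kI => <-.
  have nzy : r z != r y by rewrite yj zk; apply: contraNneq kI => ->.
  have /andP[leaz lezb] : a <= z <= b.
    have wxz : nth 0 w x <= nth 0 w z by rewrite (cr x z (ltI _ xI) ltz nxz) xi zk.
    have wzy : nth 0 w z <= nth 0 w y by rewrite (cr z y ltz (ltI _ yI) nzy) yj zk.
    by apply: (conv x y z) => //; rewrite wxz wzy.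
  by move: kI; rewrite -zk !rmono ?inE.
have [e|[ra0 rbE]] := simple_order_interval simp I; first by rewrite e ltnn in ltrab.
have full e : e < size s -> exists2 i, a <= i <= b & r i = e.
  by move=> lte; apply: pick; rewrite ra0 /= -ltnS rbE.
suff [|] : s = [:: 1; 2] \/ s = [:: 2; 1] by [].
(* [p] lies outside the interval and [q] inside it, in the same end block. Every block meets the
   interval, so letters of the interval on both sides of the letter at [p] would force [p] inside;
   the letter of the end block is therefore extreme in [s]. *)
have ext p q : p < size w -> ~~ (a <= p <= b) -> a <= q <= b -> r p = r q ->
    r p = 0 \/ (r p).+1 = size s -> s = [:: 1; 2] \/ s = [:: 2; 1].
  move=> ltp pI qI rpq ends; have ltq := ltI _ qI.
  have npq : p != q by apply: contraNneq pI => ->.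
  have uniq_p := ti p q ltp ltq npq rpq.
  apply: (simple_extreme_letter simp szs ends).
  have [lepq|ltqp] := leqP (nth 0 w p) (nth 0 w q); [left|right] => i lti nip.
    have [x xI xi] := full _ lti.
    have nxp : r x != r p by rewrite xi.
    rewrite ltnNge -xi -(cr x p (ltI _ xI) ltp nxp); apply/negP => lexp.
    by case/negP: pI; apply: (conv x q p) => //; rewrite lexp.
  have [x xI xi] := full _ lti.
  have npx : r p != r x by rewrite xi eq_sym.
  rewrite ltnNge -xi -(cr p x ltp (ltI _ xI) npx); apply/negP => lepx.
  by case/negP: pI; apply: (conv q x p) => //; rewrite lepx (ltnW ltqp).
have lt0 : 0 < size w by apply: leq_ltn_trans lta.
have r0 : r 0 = 0 by apply/eqP; rewrite -leqn0; apply: leq_trans (rmono 0 a _ _ _) _; rewrite ?inE ?ra0.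
case: proper => [a0|bw].
  apply: (ext 0 a); rewrite ?leqnn ?leab ?r0 //; first by rewrite leqNgt a0.
  by left.
have ltl : (size w).-1 < size w by rewrite prednK.
have rl : r (size w).-1 = r b.
  apply/eqP; rewrite eqn_leq -ltnS rbE ltr // rmono ?inE //; lia.
apply: (ext (size w).-1 b); rewrite ?leqnn ?leab //; first by lia.
by right; rewrite rl.
Qed.

End Decomposition.

(** * Uniqueness of decompositions *)

Section Uniqueness.
Implicit Types (w t s d : word) (bs us ts ws : seq word).

Lemma block_map0 s w r : block_map s w r -> 0 < size w -> r 0 = 0.
Proof.
move=> [ltr rmono rsurj _ _] lt0; have [i lti ri] := rsurj 0 (leq_ltn_trans (leq0n _) (ltr _ lt0)).
by apply/eqP; rewrite -leqn0 -{2}ri rmono.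
Qed.

Lemma block_map_last s w r : block_map s w r -> 0 < size w ->
  (r (size w).-1).+1 = size s.
Proof.
move=> [ltr rmono rsurj _ _] lt0; have ltl : (size w).-1 < size w by rewrite prednK.
have lts := ltr _ ltl; have s_gt0 := leq_ltn_trans (leq0n _) lts.
have [|i lti ri] := rsurj (size s).-1; first by rewrite prednK.
have lei : i <= (size w).-1 by rewrite -ltnS prednK.
by have := rmono i (size w).-1 lti ltl lei; rewrite ri; lia.
Qed.

Lemma block_map_step s w r i : block_map s w r -> i.+1 < size w ->
  r i.+1 <= (r i).+1.
Proof.
move=> [ltr rmono rsurj _ _] lti; rewrite leqNgt; apply/negP => lt2.
have [|k ltk rk] := rsurj (r i).+1; first exact: ltn_trans lt2 (ltr _ lti).
have [leki|ltik] := leqP k i.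
  by have := rmono k i ltk (ltnW lti) leki; rewrite rk ltnn.
by have := rmono i.+1 k lti ltk ltik; rewrite rk leqNgt lt2.
Qed.

(** By tightness a block of [s] with two positions is an order interval of [w], and a proper one
    since [s] has other blocks; [simple_block] puts it inside one block of [s']. Only [s'] has to be
    large, so that [s] may be the word of a sum or a skew sum. *)
Lemma block_map_stay s w r s' r' i :
  block_map s w r -> 1 < size s ->
  block_map s' w r' -> large_simple s' ->
  i.+1 < size w -> r i = r i.+1 -> r' i = r' i.+1.
Proof.
move=> bm szs bm' lg' lti1 rE; have lti := ltnW lti1.
have [ltr rmono rsurj cr ti] := bm; have [_ rmono' _ _ _] := bm'.
have exb : exists j, (j < size w) && (r j == r i) by exists i; rewrite lti eqxx.
have boundb j : (j < size w) && (r j == r i) -> j <= size w by case/andP=> /ltnW.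
have [a /andP[lta /eqP ra] mina] := ex_minnP exb.
have [b /andP[ltb /eqP rb] maxb] := ex_maxnP exb boundb.
have aib : a <= i by apply: mina; rewrite lti eqxx.
have ib : i.+1 <= b by apply: maxb; rewrite lti1 -rE eqxx.
have leab : a <= b by apply: leq_trans aib (ltnW ib).
have rI k : a <= k <= b -> k < size w /\ r k = r i.
  move=> /andP[leak lekb]; have ltk := leq_ltn_trans lekb ltb; split=> //.
  by apply/eqP; rewrite eqn_leq -[X in r k <= X]rb -[X in X <= r k]ra !rmono.
have uniq_i := ti i i.+1 lti lti1 (negbT (ltn_eqF (ltnSn i))) rE.
have I : order_interval w a b.
  split; first by rewrite leab.
  move=> x y k /rI[ltx rx] /rI[lty ry] ltk /andP[xk ky].
  have [rk|nrk] := eqVneq (r k) (r i); first by rewrite mina ?maxb // ltk rk eqxx.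
  case/eqP: (nrk); apply: (uniq_i (r k) (ltr _ ltk)).
  have nxk : r x != r k by rewrite rx eq_sym.
  have nky : r k != r y by rewrite ry.
  move: xk ky; rewrite (cr x k ltx ltk nxk) (cr k y ltk lty nky) rx ry => xk ky.
  by apply/eqP; rewrite eqn_leq xk ky.
have proper : 0 < a \/ b.+1 < size w.
  have [e lte ne] : exists2 e, e < size s & e != r i.
    by case: (r i) => [|m]; [exists 1|exists 0; rewrite ?(ltnW szs)].
  have [p ltp rp] := rsurj e lte.
  have pI : ~~ (a <= p <= b).
    by apply: contraNN ne => /rI[_]; rewrite rp => ->.
  by lia.
have rab := simple_block bm' lg' I proper.
have leai1 : a <= i.+1 by apply: leqW.
apply/eqP; rewrite eqn_leq rmono' ?inE //= (leq_trans (rmono' i.+1 b _ _ _)) //.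
by rewrite -rab rmono'.
Qed.

Lemma block_map_oiso s w r s' r' : block_map s w r -> block_map s' w r' ->
  size s = size s' -> (forall i, i < size w -> r i = r' i) -> oiso s s'.
Proof.
move=> [ltr rmono rsurj cr _] [_ _ _ cr' _] szE rE; split=> // e f lte ltf.
have [->|nef] := eqVneq e f; first by rewrite !leqnn.
have [i lti ri] := rsurj e lte; have [j ltj rj] := rsurj f ltf.
have nr : r i != r j by rewrite ri rj.
by rewrite -ri -rj -cr // cr' -?rE.
Qed.

(** Both block maps start at 0, grow by steps of at most one and, by [block_map_stay] in both
    directions, stay put at the same positions. *)
Lemma block_map_unique s w r s' r' : block_map s w r -> block_map s' w r' ->
  large_simple s -> large_simple s' ->
  s = s' /\ forall i, i < size w -> r i = r' i.
Proof.
move=> bm bm' lg lg'; have [simp szs _ _] := lg; have [simp' szs' _ _] := lg'.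
have rE i : i < size w -> r i = r' i.
  elim: i => [|i IHi] lti; first by rewrite (block_map0 bm) ?(block_map0 bm').
  have le1 := block_map_step bm lti; have le2 := block_map_step bm' lti.
  have [_ rmono _ _ _] := bm; have [_ rmono' _ _ _] := bm'.
  have le3 := rmono i i.+1 (ltnW lti) lti (leqnSn i).
  have le4 := rmono' i i.+1 (ltnW lti) lti (leqnSn i).
  have := @block_map_stay s w r s' r' i bm szs bm' lg' lti.
  have := @block_map_stay s' w r' s r i bm' szs' bm lg lti.
  by have := IHi (ltnW lti); lia.
have w_gt0 : 0 < size w by have [_ _ /(_ 0 (ltnW szs))[i /(leq_ltn_trans (leq0n _))]] := bm.
split=> //; apply: oiso_cayley; [by case: simp|by case: simp'|].
apply: (block_map_oiso bm bm' _ rE).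
by rewrite -(block_map_last bm w_gt0) -(block_map_last bm' w_gt0) rE ?prednK.
Qed.

(** Here [block_map_stay] works in one direction only and gives [r' <= r]. So [s'] has two letters
    as well, ordered like the first and last letters of [w]. *)
Lemma block_map_two d w r s' r' : block_map d w r -> block_map s' w r' ->
  cayley d -> size d = 2 -> large_simple s' -> s' = d.
Proof.
move=> bm bm' cd szd lg'; have [simp' szs' _ _] := lg'.
have w_gt0 : 0 < size w by have [_ _ /(_ 0 (ltnW szs'))[i /(leq_ltn_trans (leq0n _))]] := bm'.
have rE i : i < size w -> r' i <= r i.
  elim: i => [|i IHi] lti; first by rewrite (block_map0 bm').
  have le2 := block_map_step bm' lti; have [_ rmono _ _ _] := bm.
  have le3 := rmono i i.+1 (ltnW lti) lti (leqnSn i).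
  have := @block_map_stay d w r s' r' i bm _ bm' lg' lti.
  by rewrite szd => /(_ isT); have := IHi (ltnW lti); lia.
have ltl : (size w).-1 < size w by rewrite prednK.
have last' := block_map_last bm' w_gt0; have last_ := block_map_last bm w_gt0.
have sz2 : size s' = 2 by have := rE _ ltl; lia.
apply: oiso_cayley => //; first by case: simp'.
have [_ _ _ cr _] := bm; have [_ _ _ cr' _] := bm'.
have r0 := block_map0 bm w_gt0; have r0' := block_map0 bm' w_gt0.
have r1 : r (size w).-1 = 1 by lia.
have r1' : r' (size w).-1 = 1 by lia.
split=> [|i j]; first by rewrite sz2.
have e01 : (nth 0 s' 0 <= nth 0 s' 1) = (nth 0 d 0 <= nth 0 d 1).
  have := cr' 0 _ w_gt0 ltl; have := cr 0 _ w_gt0 ltl; rewrite r0 r0' r1 r1'.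
  by move=> /(_ isT) <- /(_ isT) <-.
have e10 : (nth 0 s' 1 <= nth 0 s' 0) = (nth 0 d 1 <= nth 0 d 0).
  have := cr' _ 0 ltl w_gt0; have := cr _ 0 ltl w_gt0; rewrite r0 r0' r1 r1'.
  by move=> /(_ isT) <- /(_ isT) <-.
by rewrite sz2; case: i j => [|[|//]] [|[|//]] _ _; rewrite ?leqnn.
Qed.

Lemma shape_unique sh sh' : all (ltn 0) sh -> all (ltn 0) sh' -> sumn sh = sumn sh' ->
  (forall i, i < sumn sh -> reshape_index sh i = reshape_index sh' i) -> sh = sh'.
Proof.
have recons n tl i : reshape_index (n :: tl) i =
    if i < n then 0 else (reshape_index tl (i - n)).+1.
  by rewrite /reshape_index /= subn_eq0; case: ltnP => // le; rewrite subSn.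
elim: sh sh' => [|n sh IHsh] [|n' sh'] //=; try by move=> _ /andP[]; lia.
- by move=> /andP[]; lia.
move=> /andP[n_gt0 pos] /andP[n'_gt0 pos'] sumE rE.
have [ltnn'|ltn'n|enn'] := ltngtP n n'.
- have /rE : n < n + sumn sh by lia.
  by rewrite !recons ltnn ltnn'.
- have /rE : n' < n + sumn sh by lia.
  by rewrite !recons ltnn ltn'n.
subst n'; congr (_ :: _); apply: IHsh => //; first by lia.
move=> i lti; have /rE : n + i < n + sumn sh by lia.
by rewrite !recons ltnNge leq_addr /= addKn => -[].
Qed.

Lemma tight_pos s bs : size bs = size s -> tight s bs -> all (ltn 0) (shape bs).
Proof.
move=> szE ti; apply/(all_nthP 0) => i; rewrite size_map szE => lti.
by rewrite (nth_map [::]) ?szE //=; case: (ti i lti).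
Qed.

Theorem decomp_unique s bs s' bs' w : decomp s bs w -> decomp s' bs' w ->
  large_simple s -> large_simple s' -> s = s' /\ bs = bs'.
Proof.
move=> dec dec' lg lg'.
have [ss rE] := block_map_unique (decomp_block_map dec) (decomp_block_map dec') lg lg'.
split=> //; have [/inflP[szE _] ti wE] := dec; have [/inflP[szE' _] ti' wE'] := dec'.
apply: eq_from_flatten_shape; first by rewrite -wE -wE'.
apply: shape_unique; [exact: tight_pos ti|exact: tight_pos ti'|by rewrite -!size_flatten -wE -wE'|].
by move=> i; rewrite -size_flatten -wE; apply: rE.
Qed.

Lemma decomp_two d bs s' bs' w : decomp d bs w -> cayley d -> size d = 2 ->
  decomp s' bs' w -> simple_cayley s' -> 1 < size s' ->
  s' = [:: 1; 2] \/ s' = [:: 2; 1] \/ s' = d.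
Proof.
move=> dec cd szd dec' simp' szs'.
have [-> | n12] := eqVneq s' [:: 1; 2]; first by left.
have [-> | n21] := eqVneq s' [:: 2; 1]; first by right; left.
right; right; apply: block_map_two (decomp_block_map dec) (decomp_block_map dec') _ _ _ => //.
by split=> //; apply/eqP.
Qed.

Definition is_two d := d = [:: 1; 2] \/ d = [:: 2; 1].

Lemma size_two d : is_two d -> size d = 2.
Proof. by case=> ->. Qed.

Lemma cayley_two d : is_two d -> cayley d.
Proof. by case=> ->; exists 2 => // z; rewrite !inE // orbC. Qed.

Lemma tight_two d a b : is_two d -> a <> [::] -> b <> [::] -> tight d [:: a; b].
Proof.
move=> two /eqP nza /eqP nzb [|[|i]]; rewrite size_two // => _ /=;
  rewrite lt0n size_eq0; split=> //.
  by move=> _ [|[|//]] //=; case: two => ->.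
by move=> _ [|[|//]] //=; case: two => ->.
Qed.

Lemma decomp2P d w : is_two d -> forall bs, decomp d bs w <-> exists b1 b2,
  [/\ bs = [:: b1; b2], w = b1 ++ b2, b1 <> [::], b2 <> [::] &
    forall x y, x \in b1 -> y \in b2 -> (x <= y) = (nth 0 d 0 <= nth 0 d 1) /\ (y <= x) = (nth 0 d 1 <= nth 0 d 0)].
Proof.
move=> two bs; have szd := size_two two.
split=> [[/inflP[]]|[b1 [b2 [-> -> nz1 nz2 cr]]]].
  rewrite szd; case: bs => [|b1 [|b2 [|//]]] // _ cr ti ->; exists b1, b2.
  rewrite /= cats0; split=> //.
  - by move=> b0; case: (ti 0); rewrite ?szd // b0.
  - by move=> b0; case: (ti 1); rewrite ?szd // b0.
  by move=> x y b1x b2y; split; [apply: (cr 0 1)|apply: (cr 1 0)].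
split; [|exact: tight_two|by rewrite /= cats0].
apply/inflP; rewrite szd; split=> // -[|[|//]] [|[|//]] x y _ _ //= _ bx by_.
  by case: (cr x y bx by_).
by case: (cr y x by_ bx).
Qed.

(** The first letter of [w] is smaller than the last one in a sum, and larger in a skew sum. *)
Lemma decomp_two_exclusive w bs bs' :
  decomp [:: 1; 2] bs w -> decomp [:: 2; 1] bs' w -> False.
Proof.
have two1 : is_two [:: 1; 2] by left. have two2 : is_two [:: 2; 1] by right.
move=> /(decomp2P _ two1)[b1 [b2 [_ -> nz1 nz2 cr]]].
move=> /(decomp2P _ two2)[c1 [c2 [_ bcE nc1 nc2 cr']]].
case: b1 nz1 cr bcE => // x b1 _ cr; case/lastP: b2 nz2 cr => // b2 y _ cr.
case: c1 nc1 cr' => // x' c1 _ cr'; case/lastP: c2 nc2 cr' => // c2 y' _ cr'.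
move=> [ex]; rewrite -!rcons_cat => /rcons_inj[_ ey].
have [] := cr x y; rewrite ?mem_head ?mem_rcons ?mem_head // => h1 h2.
have [] := cr' x' y'; rewrite ?mem_head ?mem_rcons ?mem_head // -ex -ey => h3 h4.
by rewrite h3 in h1.
Qed.

Definition indecomp d w := ~ exists bs, decomp d bs w.

(** The first blocks are prefixes of one word; if one were longer, cutting it after the shorter one
    would decompose it. *)
Lemma decomp_two_unique d bs bs' w : is_two d -> decomp d bs w -> decomp d bs' w ->
  indecomp d (nth [::] bs 0) -> indecomp d (nth [::] bs' 0) -> bs = bs'.
Proof.
move=> two.
move=> /(decomp2P _ two)[b1 [b2 [-> -> nz1 nz2 cr]]] /(decomp2P _ two)[c1 [c2 [-> bcE nc1 nc2 cr']]] /=.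
wlog lebc : b1 b2 c1 c2 nz1 nz2 cr nc1 nc2 cr' bcE / size b1 <= size c1.
  move=> wlog_; have [lebc|/ltnW lecb] := leqP (size b1) (size c1); first exact: wlog_.
  by move=> ib ic; rewrite (wlog_ c1 c2 b1 b2).
move=> _ ic; have c1E : c1 = b1 ++ drop (size b1) c1.
  by rewrite -[LHS](cat_take_drop (size b1)) -(@takel_cat _ _ _ c2 lebc) -bcE take_size_cat.
have b2E : b2 = drop (size b1) c1 ++ c2.
  by move: bcE; rewrite c1E -catA drop_size_cat // => /eqP; rewrite eqseq_cat // eqxx => /eqP.
have [g0|nzg] := eqVneq (drop (size b1) c1) [::].
  by rewrite c1E b2E g0 cats0.
case: ic; exists [:: b1; drop (size b1) c1]; apply/(decomp2P _ two).
exists b1, (drop (size b1) c1); split=> //; first exact/eqP.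
by move=> x y xb yg; apply: cr => //; rewrite b2E mem_cat yg.
Qed.

(** The first block is cut again as long as it is decomposable, and its length decreases. *)
Lemma decomp_two_exists d bs w : is_two d -> decomp d bs w ->
  exists2 bs', decomp d bs' w & indecomp d (nth [::] bs' 0).
Proof.
move=> two; have [n] := ubnP (size (nth [::] bs 0)); elim: n bs => // n IHn bs ltn dec.
have [[cs dec1]|] := pselect (exists cs, decomp d cs (nth [::] bs 0)); last by exists bs.
have [b1 [b2 [bsE wE nz1 nz2 cr]]] := (decomp2P w two bs).1 dec.
move: dec1 ltn; rewrite bsE /= => dec1.
have [c1 [c2 [_ b1E nc1 nc2 cr']]] := (decomp2P b1 two cs).1 dec1.
rewrite b1E size_cat => lt; apply: (IHn [:: c1; c2 ++ b2]).
  case: (c2) nc2 lt => // y c _ /=; rewrite addnS ltnS; apply: leq_trans.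
  by rewrite ltnS leq_addr.
apply/(decomp2P _ two); exists c1, (c2 ++ b2); rewrite catA -b1E; split=> //.
  by case: (c2) nc2.
move=> x y xc; rewrite mem_cat => /orP[]; first exact: cr'.
by apply: cr; rewrite b1E mem_cat xc.
Qed.

End Uniqueness.

(** * Existence of decompositions, inflation, and patterns of inflations *)

Section Existence.
Implicit Types (w t s d : word) (bs us ts ws : seq word).

Lemma decomp_st s bs w : decomp s bs w -> decomp (st s) bs w.
Proof.
move=> [inf ti wE]; split=> //; first exact: infl_oiso (oiso_sym (st_oiso s)) inf.
move=> i; rewrite size_st => lti; have [pos uniq_i] := ti i lti; split=> // gt1 j ltj.
rewrite !(nth_map 0) // => /(mono_leq_inj_in (@rank_mono s)) e.
by apply: uniq_i => //; apply: e; apply: mem_nth.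
Qed.

(** A letter of [s] outside an order interval differs from all those inside and compares alike with
    them. The letter at [a] can thus stand for the merged block, and it occurs only once in the
    shortened word, as [tight] demands. *)
Lemma decomp_merge s bs w a b : cayley s -> decomp s bs w -> order_interval s a b ->
  decomp (take a.+1 s ++ drop b.+1 s)
    (take a bs ++ flatten (drop a (take b.+1 bs)) :: drop b.+1 bs) w.
Proof.
move=> cs [/inflP[szE cr] ti wE] [/andP[leab ltb] conv].
have lta : a < size s by apply: leq_ltn_trans ltb.
set s' := _ ++ _; set bs' := _ ++ _ :: _.
(* The position in [s] of the letter number [i] of [s']; the positions after [a] up to [b] have been
   removed. *)
pose idx i := if i <= a then i else i + (b - a).
have szs' : size s' = size s - (b - a).
  by rewrite size_cat size_takel ?size_drop //; lia.
have szbs' : size bs' = size s'.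
  by rewrite szs' size_cat /= size_takel ?size_drop ?szE //; lia.
have nth_s' i : nth 0 s' i = nth 0 s (idx i).
  rewrite nth_cat size_takel // /idx ltnS; case: leqP => [leia|ltai].
    by rewrite nth_take.
  by rewrite nth_drop; congr nth; lia.
have sza : size (take a bs) = a by rewrite size_takel // szE ltnW.
have nth_bs' i : i != a -> nth [::] bs' i = nth [::] bs (idx i).
  move=> nia; rewrite nth_cat sza /idx.
  have [ltia|leai] := ltnP i a; first by rewrite nth_take // (ltnW ltia).
  have ltai : a < i by rewrite ltn_neqAle eq_sym nia.
  rewrite leqNgt ltai /= -[i - a]prednK ?subn_gt0 //= nth_drop; congr nth; lia.
have nth_bs'a : nth [::] bs' a = flatten (drop a (take b.+1 bs)).
  by rewrite nth_cat sza ltnn subnn.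
have mem_a x : x \in nth [::] bs' a -> exists2 e, a <= e <= b & x \in nth [::] bs e.
  rewrite nth_bs'a => /flattenP[c /(nthP [::])[k]].
  rewrite size_drop size_takel ?szE // nth_drop => ltk <-.
  rewrite nth_take; last by lia.
  by exists (a + k) => //; lia.
have mem_bs' i x : i < size s' -> x \in nth [::] bs' i ->
    exists e, [/\ e < size s, x \in nth [::] bs e & (e = idx i) \/ (i = a /\ a <= e <= b)].
  move=> lti; have [->|nia] := eqVneq i a.
    by move=> /mem_a[e eI xe]; exists e; split; [lia | | right].
  rewrite nth_bs' // => xi; exists (idx i); split; [|by []|by left].
  by rewrite /idx; case: ifP; lia.
have out_cmp e f : a <= e <= b -> f < size s -> ~~ (a <= f <= b) ->
    (nth 0 s e <= nth 0 s f) = (nth 0 s a <= nth 0 s f) /\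
    (nth 0 s f <= nth 0 s e) = (nth 0 s f <= nth 0 s a).
  move=> eI ltf fI; have aI : a <= a <= b by rewrite leqnn.
  have := conv e a f eI aI ltf; have := conv a e f aI eI ltf; rewrite (negPf fI).
  by split; lia.
have idx_out i : i < size s' -> i != a -> idx i < size s /\ ~~ (a <= idx i <= b).
  by move=> lti nia; rewrite /idx; case: ifP; lia.
have idx_inj i j : idx i = idx j -> i = j by rewrite /idx; do 2!case: ifP; lia.
have idx_a : idx a = a by rewrite /idx leqnn.
split.
- apply/inflP; split=> // i j x y lti ltj nij xi yj; rewrite !nth_s'.
  have [e [lte xe eP]] := mem_bs' i x lti xi; have [f [ltf yf fP]] := mem_bs' j y ltj yj.
  case: eP fP => [eE|[ia eI]] [fE|[ja fI]].
  + rewrite -eE -fE; apply: cr => //; rewrite eE fE; apply: contraNneq nij => /idx_inj ->.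
    exact: eqxx.
  + have nia : i != a by rewrite -ja.
    have [_ oi] := idx_out _ lti nia; rewrite ja idx_a -eE.
    have nef : e != f by apply: contraNneq oi; rewrite -eE => ->.
    by rewrite (cr e f) //; rewrite -eE in oi; case: (out_cmp f e fI lte oi).
  + have nja : j != a by rewrite -ia eq_sym.
    have [_ oj] := idx_out _ ltj nja; rewrite ia idx_a -fE.
    have nef : e != f by apply: contraNneq oj; rewrite -fE => <-.
    by rewrite (cr e f) //; rewrite -fE in oj; case: (out_cmp e f eI ltf oj).
  by rewrite ia ja eqxx in nij.
- move=> i lti; have [->|nia] := eqVneq i a.
    split=> [|_ j ltj].
      have [pos _] := ti a lta; rewrite nth_bs'a.
      have lta' : a < size (take b.+1 bs) by rewrite size_takel ?szE.
      by rewrite (drop_nth [::] lta') /= nth_take ?ltnS // size_cat ltn_addr.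
    rewrite !nth_s' idx_a => sja; apply/eqP; apply: contraT => nja.
    have [ltij /negP[]] := idx_out j ltj nja; apply: (conv a a) => //.
    - by rewrite leqnn.
    - by rewrite leqnn.
    by rewrite sja leqnn.
  have [ltij out] := idx_out i lti nia; have [pos uniq_i] := ti _ ltij.
  rewrite nth_bs' //; split=> // gt1 j ltj; rewrite !nth_s' => /(uniq_i gt1 (idx j)) e.
  apply: idx_inj; apply: e; have [->|nja] := eqVneq j a; first by rewrite idx_a.
  by case: (idx_out j ltj nja).
rewrite wE flatten_cat /= catA -flatten_cat.
have -> : take a bs = take a (take b.+1 bs) by rewrite take_takel // leqW.
by rewrite cat_take_drop -flatten_cat cat_take_drop.
Qed.

Lemma decomp_self s : decomp s [seq [:: x] | x <- s] s.
Proof.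
split.
- apply/inflP; rewrite size_map; split=> // i j x y lti ltj _.
  by rewrite !(nth_map 0) // !inE => /eqP-> /eqP->.
- by move=> i lti; rewrite (nth_map 0).
by elim: s => //= x s {1}->.
Qed.

(* Merging the blocks of an interval of s shortens s, so a shortest s is simple. *)
Theorem decomp_exists w : cayley w -> 1 < size w -> exists s bs,
  [/\ simple_cayley s, 1 < size s & decomp s bs w].
Proof.
move=> cw szw; suff main n s bs : size s <= n -> cayley s -> 1 < size s -> decomp s bs w ->
    exists s bs, [/\ simple_cayley s, 1 < size s & decomp s bs w].
  exact: (main _ _ _ (leqnn _) cw szw (decomp_self w)).
elim: n s bs => [|n IHn] s bs len cs szs dec; first by move: len szs; lia.
have [simp|nsimp] := pselect (simple_cayley s); first by exists s, bs.
have [a [b [I nab nfull]]] : exists a b, [/\ order_interval s a b, a <> b & ~ (a = 0 /\ b.+1 = size s)].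
  apply: contrapT => none; apply: nsimp; split=> // a b /H_interval_order I.
  apply: contrapT => /not_orP[nab nfull]; apply: none; by exists a, b.
have [/andP[leab ltb] _] := I.
have sz : size (take a.+1 s ++ drop b.+1 s) = size s - (b - a).
  by rewrite size_cat size_takel ?size_drop //; lia.
apply: (IHn (st (take a.+1 s ++ drop b.+1 s))
  (take a bs ++ flatten (drop a (take b.+1 bs)) :: drop b.+1 bs)).
- rewrite size_st sz; lia.
- exact: cayley_st.
- rewrite size_st sz; lia.
exact/decomp_st/decomp_merge.
Qed.

(* The letters are ordered lexicographically: first by the letter of s, then
   within the block. *)
Definition inflate s ws : word := st (flatten
  [seq [seq p.1 * (sumn [seq size w | w <- ws]).+1 + a | a <- st p.2] | p <- zip s ws]).

Lemma leq_sumn_mem (l : seq nat) n : n \in l -> n <= sumn l.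
Proof.
elim: l => //= m l IHl; rewrite inE => /predU1P[->|/IHl le]; first exact: leq_addr.
exact: leq_trans le (leq_addl _ _).
Qed.

Lemma inflate_decomp s ws : size ws = size s -> tight s ws ->
  exists bs, decomp s bs (inflate s ws) /\ map st bs = map st ws.
Proof.
(* A standardized letter is at most the size of its block, so it is below [K] and the letter of [s]
   decides first. *)
move=> szE ti; set K := (sumn [seq size w | w <- ws]).+1.
pose lift := [seq [seq p.1 * K + a | a <- st p.2] | p <- zip s ws].
have szl : size lift = size s by rewrite size_map size_zip szE minnn.
have nth_lift i : i < size s ->
    nth [::] lift i = [seq nth 0 s i * K + a | a <- st (nth [::] ws i)].
  by move=> lti; rewrite (nth_map (0, [::])) ?size_zip ?szE ?minnn // nth_zip.
have ltK i a : i < size s -> a \in st (nth [::] ws i) -> a < K.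
  move=> lti /(cayley_letter (cayley_st _)) /andP[_]; rewrite size_st ltnS => lea.
  by apply: leq_trans lea (leq_sumn_mem _); apply/map_f/mem_nth; rewrite szE.
have inf : infl s lift.
  apply/inflP; split=> // i j x y lti ltj nij.
  rewrite !nth_lift // => /mapP[a ai ->] /mapP[a' aj ->].
  have [ltij|ltji|eij] := ltngtP (nth 0 s i) (nth 0 s j).
  - have := ltK i a lti ai; nia.
  - have := ltK j a' ltj aj; nia.
  (* Positions of [s] with equal letters must receive equal letters: by tightness their blocks are
     singletons, standardized to 1. *)
  rewrite eij leq_add2l; have single k l b : k < size s -> l < size s -> k != l ->
      nth 0 s l = nth 0 s k -> b \in st (nth [::] ws k) -> b = 1.
    move=> ltk ltl nkl slk /(cayley_letter (cayley_st _)); rewrite size_st => lb.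
    have [_ uniq_k] := ti k ltk; have [gt1|] := ltnP 1 (size (nth [::] ws k)); last by lia.
    by rewrite (uniq_k gt1 l ltl slk) eqxx in nkl.
  have nji : j != i by rewrite eq_sym.
  by rewrite (single i j a lti ltj nij _ ai) // (single j i a' ltj lti nji _ aj).
have -> : inflate s ws = flatten (map (map (rank (flatten lift))) lift).
  by rewrite -map_flatten.
have fmono := @rank_mono (flatten lift); clearbody lift.
exists (map (map (rank (flatten lift))) lift); split; last first.
  apply: (@eq_from_nth _ [::]) => [|i]; rewrite !size_map ?szl ?szE // => lti.
  have ltl : i < size lift by rewrite szl.
  rewrite !(nth_map [::]) ?size_map ?szE // st_map.
    rewrite nth_lift // st_map ?st_st // => a a' _ _; exact: leq_add2l.
  move=> x y xl yl; apply: fmono; apply/flattenP.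
    by exists (nth [::] lift i); rewrite ?mem_nth.
  by exists (nth [::] lift i); rewrite ?mem_nth.
split=> //; first exact: infl_map.
move=> i lti; have [pos uniq_i] := ti i lti.
by rewrite (nth_map [::]) ?szl // size_map nth_lift // size_map size_st.
Qed.

Lemma cayley_inflate s ws : cayley (inflate s ws). Proof. exact: cayley_st. Qed.

Lemma tight_st s bs : size bs = size s -> tight s bs -> tight s (map st bs).
Proof.
by move=> szE ti i lti; rewrite (nth_map [::]) ?szE // size_st; apply: ti.
Qed.

Lemma inflate_st s bs w : cayley w -> decomp s bs w -> inflate s (map st bs) = w.
Proof.
move=> cw [inf ti wE]; have /inflP[szE _] := inf.
have szm : size (map st bs) = size s by rewrite size_map.
have [cs [[inf' _ E] stE]] := inflate_decomp szm (tight_st szE ti).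
apply: oiso_cayley => //; first exact: cayley_inflate.
rewrite wE E; apply: (oiso_flatten inf' inf) => i lti; apply/st_oisoE.
have /inflP[szc _] := inf'; move: (congr1 (fun l => nth [::] l i) stE).
by rewrite /= !(nth_map [::]) ?size_map ?szc ?szE // st_st.
Qed.

Lemma decomp_contained s bs w : cayley s -> decomp s bs w -> contained s w.
Proof.
move=> cs [inf ti ->]; apply/(contained_flatten _ inf).
have [inf' _ sE] := decomp_self s.
exists [seq [:: x] | x <- s]; split=> //; split=> // i lti.
rewrite (nth_map 0) //; have [pos _] := ti i lti.
have /inflP[szE _] := inf; case: (nth [::] bs i) pos => // y b _.
exists [:: y]; first by rewrite /= eqxx sub0seq.
apply: oiso_st; split=> // j k; rewrite !ltnS !leqn0 => /eqP-> /eqP->.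
by rewrite !leqnn.
Qed.

Lemma decomp_block_contained s bs w b : decomp s bs w -> b \in bs -> contained (st b) w.
Proof.
by move=> [_ _ ->] bsb; exists b => //; apply: mem_subseq_flatten.
Qed.

Lemma ltn_size_block bs (b : word) : b \in bs -> 1 < size bs -> all (ltn 0) (shape bs) ->
  size b < size (flatten bs).
Proof.
have size_le (cs : seq word) : all (ltn 0) (shape cs) -> size cs <= size (flatten cs).
  by elim: cs => //= c cs IHcs /andP[c_gt0 /IHcs]; rewrite size_cat; lia.
case/path.splitPr=> p1 p2; rewrite size_cat /shape map_cat all_cat flatten_cat /= !size_cat.
by move=> gt1 /and3P[/size_le le1 _ /size_le le2]; lia.
Qed.

(** Monotonicity of inflation in its blocks, the condition under which Higman's theorem applies. *)
Lemma contained_inflate s bs bs' w w' : decomp s bs w -> decomp s bs' w' ->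
  (forall i, i < size s -> contained (st (nth [::] bs i)) (nth [::] bs' i)) ->
  cayley w -> contained w w'.
Proof.
move=> [inf _ wE] [inf' _ ->] con cw; apply/(contained_flatten _ inf').
by exists bs.
Qed.

(* A segment of length at least two of a simple pattern inside w is an
   interval of that pattern, hence everything. *)
Lemma simple_in_decomp s bs w t : decomp s bs w -> simple_cayley t -> contained t w ->
  contained t (st s) \/ exists2 b, b \in bs & contained t (st b).
Proof.
move=> [inf ti ->] simp /(contained_flatten _ inf)[ts [[inf' tE con] ct]].
have /inflP[szE _] := inf; have /inflP[szE' cr'] := inf'.
have [[i lti szi]|small] := pselect (exists2 i, i < size s & size (nth [::] ts i) = size t).
  right; exists (nth [::] bs i); first by rewrite mem_nth ?szE.
  apply/contained_st; rewrite -[t]st_cayley // (_ : t = nth [::] ts i); first exact: con.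
  have sub : subseq (nth [::] ts i) t.
    by rewrite [X in subseq _ X]tE; apply/mem_subseq_flatten/mem_nth; rewrite szE'.
  by apply/esym/eqP; rewrite -(size_subseq_leqif sub) szi.
have le1 i : i < size s -> size (nth [::] ts i) <= 1.
  move=> lti; rewrite leqNgt; apply/negP => gt1; set c := nth [::] ts i in gt1.
  have [A [B [tsE memA memB]]] : exists A B, [/\ t = A ++ c ++ B,
      forall x, x \in A -> exists j, [/\ j < size s, j != i & x \in nth [::] ts j] &
      forall x, x \in B -> exists j, [/\ j < size s, j != i & x \in nth [::] ts j]].
    exists (flatten (take i ts)), (flatten (drop i.+1 ts)); split.
    - by rewrite tE -[in LHS](cat_take_drop i ts) (drop_nth [::]) ?szE' // flatten_cat.
    - move=> x /flattenP[d /(nthP [::])[j]]; rewrite size_takel ?szE' ?(ltnW lti) // => ltji.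
      rewrite nth_take // => <- xj; exists j; split=> //; first exact: ltn_trans ltji lti.
      by rewrite ltn_eqF.
    move=> x /flattenP[d /(nthP [::])[j]]; rewrite size_drop szE' nth_drop => ltj <- xj.
    by exists (i.+1 + j); split=> //; lia.
  have c_gt0 : 0 < size c by apply: ltnW.
  have szt : size t = size A + (size c + size B) by rewrite tsE !size_cat.
  have inc x : size A <= x <= size A + (size c).-1 -> nth 0 t x \in c.
    move=> xI; rewrite tsE nth_cat ltnNge; case/andP: (xI) => -> _ /=.
    by rewrite nth_cat; case: ltnP => [lt|]; [exact: mem_nth|lia].
  have outc k : k < size t -> ~~ (size A <= k <= size A + (size c).-1) ->
      exists j, [/\ j < size s, j != i & nth 0 t k \in nth [::] ts j].
    move=> ltk kI; rewrite tsE nth_cat; case: ltnP => [lt|le]; first exact/memA/mem_nth.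
    rewrite nth_cat; case: ltnP => [lt|le']; first by lia.
    apply/memB/mem_nth; move: ltk le le'; rewrite szt.
    by move: (size A) (size B) (size c) => p q r; lia.
  have I : order_interval t (size A) (size A + (size c).-1).
    split; first by rewrite szt leq_addr /= ltn_add2l -(prednK c_gt0) ltnS leq_addr.
    move=> x y k /inc xc /inc yc ltk /andP[xk ky]; apply: contraT => /(outc k ltk)[j [ltj nji kj]].
    have [_ uniq_i] := ti i lti; case/eqP: (nji); apply: uniq_i => //.
      by apply: leq_trans gt1 _; have := contained_size (con i lti); rewrite size_st.
    have nij : i != j by rewrite eq_sym.
    apply/eqP; rewrite eqn_leq -(cr' j i _ _ ltj lti nji kj yc) ky.
    by rewrite -(cr' i j _ _ lti ltj nij xc kj) xk.
  have [e|[A0 cE]] := simple_order_interval simp I; first by lia.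
  by apply: small; exists i => //; rewrite -/c; lia.
left; apply/contained_st; have [inf0 _ sE] := decomp_self s.
rewrite sE; apply/(contained_flatten _ inf0); exists ts; split=> //; split=> // i lti.
rewrite (nth_map 0) //; have := le1 i lti; case: (nth [::] ts i) => [|y [|//]] _.
  by exists [::]; rewrite ?sub0seq.
exists [:: nth 0 s i] => //; apply: oiso_st; split=> // j k.
by rewrite !ltnS !leqn0 => /eqP-> /eqP->; rewrite !leqnn.
Qed.

End Existence.

(** * Generating functions *)

Section Cardinality.
Implicit Types (T U : choiceType).

(** A relation, so that classes of words, pairs and lists are counted without building finite
    types. *)
Definition has_card T (P : T -> Prop) k :=
  exists s : seq T, [/\ uniq s, forall t, t \in s <-> P t & size s = k].

Lemma has_card_ext T (P P' : T -> Prop) k :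
  (forall t, P t <-> P' t) -> has_card P k -> has_card P' k.
Proof. by move=> PP [s [us sP sk]]; exists s; split=> // t; rewrite sP. Qed.

Lemma has_card_unique T (P : T -> Prop) k l : has_card P k -> has_card P l -> k = l.
Proof.
move=> [s [us sP <-]] [s' [us' sP' <-]]; apply/perm_size/uniq_perm => // t.
by apply/idP/idP => [/sP/sP'|/sP'/sP].
Qed.

Lemma has_card0 T (P : T -> Prop) : (forall t, ~ P t) -> has_card P 0.
Proof. by move=> P0; exists [::]; split=> // t; split=> // /P0. Qed.

Lemma has_card_union T (P P' : T -> Prop) k l : has_card P k -> has_card P' l ->
  (forall t, P t -> P' t -> False) -> has_card (fun t => P t \/ P' t) (k + l).
Proof.
move=> [s [us sP <-]] [s' [us' sP' <-]] dis; exists (s ++ s'); rewrite size_cat; split=> //.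
  rewrite cat_uniq us us' andbT /=; apply/hasPn => t /sP' P't; apply/negP => /sP Pt.
  exact: dis Pt P't.
move=> t; rewrite mem_cat; split=> [/orP[/sP|/sP']|[/sP->|/sP'->]]; rewrite ?orbT //; tauto.
Qed.

Lemma has_card_bigU T (I : eqType) (r : seq I) (P : I -> T -> Prop) (k : I -> nat) :
  uniq r -> (forall i, i \in r -> has_card (P i) (k i)) ->
  (forall i j t, i \in r -> j \in r -> P i t -> P j t -> i = j) ->
  has_card (fun t => exists2 i, i \in r & P i t) (\sum_(i <- r) k i).
Proof.
elim: r => [|i r IHr] /=.
  by move=> _ _ _; rewrite big_nil; apply: has_card0 => t [].
move=> /andP[nir ur] cP dis; rewrite big_cons.
apply: has_card_ext (has_card_union (cP i (mem_head _ _)) (IHr ur _ _) _).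
- move=> t; split=> [[Pt|[j rj Pt]]|[j]]; first by exists i; rewrite ?mem_head.
    by exists j; rewrite // inE rj orbT.
  rewrite inE => /predU1P[->|rj] Pt; first by left.
  by right; exists j.
- by move=> j rj; apply: cP; rewrite inE rj orbT.
- by move=> j l t rj rl; apply: dis; rewrite inE ?rj ?rl orbT.
move=> t Pit [j rj Pjt]; case/negP: nir.
by rewrite (dis i j t) ?mem_head // inE rj orbT.
Qed.

Lemma has_card_bij T U (f : T -> U) (P : T -> Prop) (P' : U -> Prop) k :
  (forall t, P t -> P' (f t)) -> (forall t t', P t -> P t' -> f t = f t' -> t = t') ->
  (forall u, P' u -> exists2 t, P t & f t = u) -> has_card P k -> has_card P' k.
Proof.
move=> fP finj fsurj [s [us sP <-]]; exists (map f s); rewrite size_map; split=> //.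
  by rewrite map_inj_in_uniq // => t t' /sP Pt /sP Pt'; apply: finj.
move=> u; split=> [/mapP[t /sP Pt ->]|/fsurj[t /sP st <-]]; [exact: fP|exact: map_f].
Qed.

Lemma has_card_prod T U (P : T -> Prop) (P' : U -> Prop) k l :
  has_card P k -> has_card P' l ->
  has_card (fun t : T * U => P t.1 /\ P' t.2) (k * l).
Proof.
move=> [s [us sP <-]] [s' [us' sP' <-]]; exists [seq (a, b) | a <- s, b <- s'].
rewrite size_allpairs; split=> //; first by apply: allpairs_uniq => // -[a b] [c d].
move=> [a b]; split=> [/allpairsP[[c d] [/= /sP Pc /sP' Pd [-> ->]]]|[/sP sa /sP' sb]] //.
by apply/allpairsP; exists (a, b).
Qed.

End Cardinality.

Lemma big_iota (R : Type) (idx : R) (op : R -> R -> R) n (F : nat -> R) :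
  \big[op/idx]_(i <- iota 0 n) F i = \big[op/idx]_(i < n) F i.
Proof. by rewrite -(big_mkord xpredT F) /index_iota subn0. Qed.

Section Lists.
Variable T : eqType.

Fixpoint lists (s : seq T) k : seq (seq T) :=
  if k is k'.+1 then [seq a :: l | a <- s, l <- lists s k'] else [:: [::]].

Lemma mem_lists s k l : l \in lists s k = (size l == k) && all (mem s) l.
Proof.
elim: k l => [|k IHk] l /=; first by case: l.
apply/allpairsP/idP => [[[a m] [/= sa]]|].
  by rewrite IHk => /andP[/eqP<- al] ->; rewrite /= eqxx sa.
case: l => [//|a l] /=; rewrite eqSS => /and3P[szl sa al].
by exists (a, l); rewrite /= IHk szl.
Qed.

Lemma uniq_lists s k : uniq s -> uniq (lists s k).
Proof.
move=> us; elim: k => [//|k IHk] /=; apply: allpairs_uniq => // -[a l] [b m] _ _ /=.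
by move=> [-> ->].
Qed.

Lemma size_lists s k : size (lists s k) = size s ^ k.
Proof. by elim: k => [//|k IHk] /=; rewrite size_allpairs IHk expnS. Qed.

End Lists.

Section GeneratingFunctions.
Local Open Scope ring_scope.

Definition has_gf (T : choiceType) (sz : T -> nat) (P : T -> Prop) (G : series) :=
  forall n, exists2 k, has_card (fun t => P t /\ sz t = n) k & G n = k%:R.

Section Laws.
Variables (T : choiceType) (sz : T -> nat).

Lemma has_gf_ext (P P' : T -> Prop) G :
  (forall t, P t <-> P' t) -> has_gf sz P G -> has_gf sz P' G.
Proof.
move=> PP gP n; have [k ck ->] := gP n; exists k => //.
by apply: has_card_ext ck => t; rewrite PP.
Qed.

Lemma has_gf_unique (P : T -> Prop) G G' : has_gf sz P G -> has_gf sz P G' -> G = G'.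
Proof.
move=> gP gP'; apply/funext => n; have [k ck ->] := gP n; have [l cl ->] := gP' n.
by rewrite (has_card_unique ck cl).
Qed.

Lemma has_gf0 (P : T -> Prop) : (forall t, ~ P t) -> has_gf sz P 0.
Proof. by move=> P0 n; exists 0%N => //; apply: has_card0 => t [/P0]. Qed.

Lemma has_gf_union (P P' : T -> Prop) G G' : has_gf sz P G -> has_gf sz P' G' ->
  (forall t, P t -> P' t -> False) -> has_gf sz (fun t => P t \/ P' t) (G + G').
Proof.
move=> gP gP' dis n; have [k ck Gk] := gP n; have [l cl Gl] := gP' n.
exists (k + l)%N; last by rewrite seriesD Gk Gl natrD.
apply: has_card_ext (has_card_union ck cl _) => t; first by tauto.
by move=> [Pt _] [P't _]; apply: dis Pt P't.
Qed.

Lemma has_gf_bigU (I : eqType) (r : seq I) (P : I -> T -> Prop) (G : I -> series) :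
  uniq r -> (forall i, i \in r -> has_gf sz (P i) (G i)) ->
  (forall i j t, i \in r -> j \in r -> P i t -> P j t -> i = j) ->
  has_gf sz (fun t => exists2 i, i \in r & P i t) (\sum_(i <- r) G i).
Proof.
move=> ur gP dis n.
have /choice[k kP] (i : I) : exists k, i \in r ->
    has_card (fun t => P i t /\ sz t = n) k /\ G i n = k%:R.
  have [ri|] := boolP (i \in r); last by exists 0%N.
  by have [k ck Gk] := gP i ri n; exists k.
exists (\sum_(i <- r) k i)%N; last first.
  by rewrite series_sum natr_sum; apply: eq_big_seq => i /kP[].
apply: has_card_ext (has_card_bigU ur (fun i ri => (kP i ri).1) _).
  move=> t; split=> [[i ri [Pt szt]]|[[i ri Pt] szt]]; last by exists i.
  by split=> //; exists i.
by move=> i j t ri rj [Pi _] [Pj _]; apply: dis Pi Pj.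
Qed.

End Laws.

Lemma has_gf_bij (T U : choiceType) (szT : T -> nat) (szU : U -> nat) (f : T -> U)
    (P : T -> Prop) (P' : U -> Prop) G :
  (forall t, P t -> P' (f t) /\ szU (f t) = szT t) ->
  (forall t t', P t -> P t' -> f t = f t' -> t = t') ->
  (forall u, P' u -> exists2 t, P t & f t = u) ->
  has_gf szT P G -> has_gf szU P' G.
Proof.
move=> fP finj fsurj gP n; have [k ck Gk] := gP n; exists k => //.
apply: has_card_bij ck => [t [Pt <-]|t t' [Pt _] [Pt' _]|u [P'u szu]].
- exact: fP.
- exact: finj.
have [t Pt tu] := fsurj u P'u; exists t => //.
by split=> //; rewrite -szu -tu; case: (fP t Pt).
Qed.

Lemma has_gf_prod (T U : choiceType) (szT : T -> nat) (szU : U -> nat)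
    (P : T -> Prop) (P' : U -> Prop) G G' :
  has_gf szT P G -> has_gf szU P' G' ->
  has_gf (fun t : T * U => szT t.1 + szU t.2)%N (fun t => P t.1 /\ P' t.2) (G * G').
Proof.
move=> gP gP' n.
have /choice[k kP] (i : nat) : exists k,
    has_card (fun t => P t /\ szT t = i) k /\ G i = k%:R by have [k] := gP i; exists k.
have /choice[l lP] (i : nat) : exists l,
    has_card (fun t => P' t /\ szU t = i) l /\ G' i = l%:R by have [l] := gP' i; exists l.
exists (\sum_(i <- iota 0 n.+1) k i * l (n - i))%N; last first.
  rewrite seriesM natr_sum -(big_iota _ _ _ (fun i => G i * G' (n - i)%N)).
  by apply: eq_bigr => i _; rewrite natrM (kP i).2 (lP _).2.
apply: (has_card_ext _ (@has_card_bigU _ _ (iota 0 n.+1)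
  (fun i (t : T * U) => (P t.1 /\ szT t.1 = i) /\ (P' t.2 /\ szU t.2 = (n - i)%N))
  (fun i => k i * l (n - i))%N (iota_uniq _ _) _ _)) => [t|i _|i j t _ _].
- split=> [[i]|[[Pt P't] szt]].
    rewrite mem_iota => lti [[Pt szE1] [P't szE]]; split=> //=; rewrite szE1 szE subnKC // -ltnS.
  by exists (szT t.1); [rewrite mem_iota; lia|do 2!split=> //; lia].
- exact: (has_card_prod (kP i).1 (lP (n - i)%N).1).
by move=> [[_ <-] _] [[_ <-] _].
Qed.

Lemma has_gf_lists (T : choiceType) (sz : T -> nat) (I : eqType) (i0 : I) (t0 : T)
    (r : seq I) (P : I -> T -> Prop) (G : I -> series) :
  (forall i, i \in r -> has_gf sz (P i) (G i)) ->
  has_gf (fun l => sumn (map sz l))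
    (fun l => size l = size r /\
       forall j, (j < size r)%N -> P (nth i0 r j) (nth t0 l j))
    (\prod_(i <- r) G i).
Proof.
elim: r => [|i r IHr] gP.
  rewrite big_nil => n; have [->|n0] := eqVneq n 0%N.
    exists 1%N => //; exists [:: [::]]; split=> // -[|a l]; first by [].
    by split=> [//|[[]]].
  exists 0%N; last by rewrite series1 (negPf n0).
  by apply: has_card0 => -[|a l] [[//= _ _] e]; rewrite -e eqxx in n0.
rewrite big_cons; have gP' : forall j, j \in r -> has_gf sz (P j) (G j).
  by move=> j rj; apply: gP; rewrite inE rj orbT.
have := has_gf_prod (gP i (mem_head _ _)) (IHr gP').
apply: (@has_gf_bij _ _ _ _ (fun t : T * seq T => t.1 :: t.2)) => //=.
- by move=> [a l] /= [Pa [szl Pl]]; split=> //; split=> [|[|j]] //=; [rewrite szl|exact: Pl].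
- by move=> [a l] [b m] _ _ /= [-> ->].
move=> [|a l] [//= [szl] Pl]; exists (a, l) => //=; split; first exact: (Pl 0%N).
by split=> // j ltj; apply: (Pl j.+1).
Qed.

Definition word_gf (P : word -> Prop) : series :=
  fun n => (count (fun w => `[< P w >]) (lists (iota 0 n.+1) n))%:R.

Lemma word_gfP (P : word -> Prop) : (forall w, P w -> forall x, x \in w -> (x <= size w)%N) ->
  has_gf size P (word_gf P).
Proof.
move=> Pw n; eexists; last by [].
exists [seq w <- lists (iota 0 n.+1) n | `[< P w >]]; split.
- by apply/filter_uniq/uniq_lists/iota_uniq.
- move=> w; rewrite mem_filter mem_lists; split=> [/and3P[/asboolP Pw' /eqP szw _] //|[Pw' szw]].
  rewrite szw eqxx asboolT //=; apply/allP => x wx.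
  by rewrite -[mem _ x]/(x \in iota 0 n.+1) mem_iota add0n ltnS -szw; apply: Pw.
by rewrite size_filter.
Qed.

Lemma cayley_word_gf (P : word -> Prop) : (forall w, P w -> cayley w) ->
  has_gf size P (word_gf P).
Proof.
move=> Pc; apply: word_gfP => w /Pc [m lem wE] x; rewrite wE mem_iota.
by move=> /andP[_]; rewrite add1n ltnS => /leq_trans->.
Qed.

Lemma gen_funE (C : set word) : gen_fun C = word_gf C.
Proof.
apply/funext => n; congr (_%:R); rewrite cardE.
transitivity (size [seq w <- lists (iota 0 n.+1) n | `[< C w >]]); last by rewrite size_filter.
rewrite -(size_map (fun t : n.-tuple 'I_n.+1 => [seq val i | i <- t])).
apply/perm_size/uniq_perm.
- rewrite map_inj_uniq ?enum_uniq // => t u /(inj_map val_inj) /val_inj; exact.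
- by apply/filter_uniq/uniq_lists/iota_uniq.
move=> w; rewrite mem_filter mem_lists; apply/mapP/and3P => [[t]|[Cw /eqP szw aw]].
  rewrite mem_enum => Ct ->; split=> //; first by rewrite size_map size_tuple.
  apply/allP => x /mapP[i _ ->].
  by rewrite -[mem _ _]/(val i \in iota 0 n.+1) mem_iota ltn_ord.
have wE : w = [seq val i | i <- [seq inord x : 'I_n.+1 | x <- w]].
  rewrite -map_comp -[LHS]map_id; apply/eq_in_map => x wx /=.
  have := allP aw x wx; rewrite -[mem _ x]/(x \in iota 0 n.+1) mem_iota.
  by move=> /inordK.
have sz : size [seq inord x : 'I_n.+1 | x <- w] == n by rewrite size_map szw.
exists (Tuple sz); last by rewrite /= -wE.
by rewrite mem_enum unfold_in /= -wE.
Qed.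

End GeneratingFunctions.

(** * The system of a finite set of simple words *)

Section StateSystem.
Local Open Scope ring_scope.

Variables (S pats : seq word).
Hypothesis S_simple : forall s, s \in S -> simple_cayley s.
Hypothesis S_closed : forall s t, s \in S -> simple_cayley t -> contained t s -> t \in S.
Hypothesis pats_factor : forall A B D, A ++ B ++ D \in pats -> st B \in pats.

(** The largest class whose simple members lie in [S]; the given class is cut out of it by excluded
    patterns. *)
Definition in_closure (w : word) : Prop :=
  cayley w /\ forall t, simple_cayley t -> contained t w -> t \in S.

Lemma in_closure_contained t w : in_closure w -> contained t w -> in_closure t.
Proof.
move=> [cw simw] ctw; split; first exact: contained_cayley ctw.
by move=> u su cut; apply: simw su (contained_trans cut ctw).
Qed.

Lemma in_closure_decomp s bs w : s \in S -> decomp s bs w -> cayley w ->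
  (forall b, b \in bs -> in_closure (st b)) -> in_closure w.
Proof.
move=> Ss dec cw clb; split=> // t simt ctw.
have [cts|[b bsb ctb]] := simple_in_decomp dec simt ctw.
  by apply: S_closed Ss simt _; apply/contained_st.
by case: (clb b bsb) => _; apply.
Qed.

Let n := size pats.
Let Q := {set 'I_n}.
Let pat (i : 'I_n) : word := nth [::] pats i.

Definition state (w : word) : Q := [set i | `[< contained (pat i) w >]].

(* The patterns of an inflation of s, from those of its blocks. *)
Definition combine (s : word) (qs : seq Q) : Q := [set i | `[< exists ts,
  [/\ infl s ts, pat i = flatten ts, cayley (pat i) & forall j, (j < size s)%N ->
     exists2 i', i' \in nth finset.set0 qs j & pat i' = st (nth [::] ts j)] >]].

Lemma state_st w : state (st w) = state w.
Proof. by apply/setP => i; rewrite !inE; apply/asboolP/asboolP => /contained_st. Qed.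

(** A pattern occurring in an inflation is cut into factors. Their standardizations have to be
    listed as well for the states of the blocks to see them; hence the hypothesis [pats_factor]. *)
Lemma state_flatten s bs : infl s bs -> state (flatten bs) = combine s (map state bs).
Proof.
move=> inf; have /inflP[szE _] := inf; apply/setP => i; rewrite !inE.
apply/asboolP/asboolP => [/(contained_flatten _ inf)[ts [[inf' tE con] ct]]|].
  exists ts; split=> // j ltj; have /inflP[szE' _] := inf'.
  have ltj' : (j < size ts)%N by rewrite szE'.
  have : st (nth [::] ts j) \in pats.
    apply: (@pats_factor (flatten (take j ts)) _ (flatten (drop j.+1 ts))).
    have -> : (flatten (take j ts) ++ nth [::] ts j ++ flatten (drop j.+1 ts))%SEQ = pat i.
      by rewrite tE -[in RHS](cat_take_drop j ts) (drop_nth [::] ltj') flatten_cat.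
    exact: mem_nth.
  move=> /(nthP [::])[k ltk kE]; exists (Ordinal ltk) => //.
  rewrite (nth_map [::]) ?szE // inE; apply/asboolP; rewrite /pat /= kE; exact: con.
move=> [ts [inf' tE ct con]]; apply/(contained_flatten _ inf); exists ts; split=> //.
split=> // j ltj; have [i'] := con j ltj.
by rewrite (nth_map [::]) ?szE // inE => /asboolP + <-.
Qed.

Lemma state_sub b w : subseq b w -> state b \subset state w.
Proof.
move=> sbw; apply/fintype.subsetP => i; rewrite !inE => -[u su ut].
by exists u => //; apply: (subseq_trans su sbw).
Qed.

(** The empty word is left out: blocks are nonempty, and the system asks for series without constant
    term. *)
Definition state_class (q : Q) (w : word) : Prop :=
  [/\ in_closure w, w <> [::] & state w = q].

Lemma decomp_state s bs w : decomp s bs w -> state w = combine s (map state bs).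
Proof. by move=> [inf _ ->]; apply: state_flatten. Qed.

Lemma decomp_state_sub s bs w q : decomp s bs w -> q \in map state bs -> q \subset state w.
Proof.
move=> [_ _ ->] /mapP[b bsb ->]; exact/state_sub/mem_subseq_flatten.
Qed.

Lemma indecomp_st d w : indecomp d (st w) <-> indecomp d w.
Proof.
have dec_st u v : st u = st v -> (exists bs, decomp d bs u) -> exists bs, decomp d bs v.
  move=> uv [bs [inf ti uE]]; have /inflP[szE _] := inf.
  have [f fmono vE] : exists2 f, {in u &, {mono f : x y / (x <= y)%N}} & v = map f u.
    by apply/oiso_mapE/st_oisoE.
  exists (map (map f) bs); split; last by rewrite vE uE map_flatten.
    by apply: infl_map => //; rewrite -uE.
  by move=> i lti; rewrite (nth_map [::]) ?szE // size_map; apply: ti.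
by split=> ind ex; apply: ind; apply: dec_st ex; rewrite st_st.
Qed.

Lemma block_class bs s w b : in_closure w -> decomp s bs w -> b \in bs ->
  state_class (state b) (st b).
Proof.
move=> clw dec bsb; split; last exact: state_st.
  exact: in_closure_contained clw (decomp_block_contained dec bsb).
have [/inflP[szE _] ti _] := dec; have [i lti <-] := nthP [::] bsb.
rewrite szE in lti; have [pos _] := ti i lti => /(congr1 size).
by rewrite size_st => e; rewrite e in pos.
Qed.

Definition is_decomposable d (w : word) := exists bs, decomp d bs w.

(** The inclusions hold for the blocks of an actual word; stated here, they make the system
    triangular for all triples of states. *)
Definition pair_rel d (q1 q2 q : Q) : bool :=
  [&& d \in S, combine d [:: q1; q2] == q, q1 \subset q & q2 \subset q].

Lemma size_flatten_st (bs : seq word) : size (flatten bs) = sumn (map size (map st bs)).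
Proof. by rewrite size_flatten -map_comp; congr sumn; apply: eq_map => b /=; rewrite size_st. Qed.

Lemma map_st_id (ws : seq word) : (forall w, w \in ws -> cayley w) -> map st ws = ws.
Proof. by move=> cws; rewrite -[RHS]map_id; apply/eq_in_map => w /cws /st_cayley. Qed.

Lemma inflate_class s ws : s \in S -> size ws = size s -> tight s ws ->
  (forall w, w \in ws -> in_closure w) ->
  [/\ in_closure (inflate s ws), size (inflate s ws) = sumn (map size ws) &
    exists bs, [/\ decomp s bs (inflate s ws), map st bs = ws &
       map state bs = map state ws]].
Proof.
move=> Ss szE ti clw; have [bs [dec stE]] := inflate_decomp szE ti.
have wsE : map st ws = ws by apply: map_st_id => w /clw[].
rewrite wsE in stE; split.
- apply: in_closure_decomp Ss dec (cayley_inflate _ _) _ => b bsb.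
  by apply: clw; rewrite -stE map_f.
- by have [_ _ ->] := dec; rewrite size_flatten_st stE.
by exists bs; split=> //; rewrite -stE -map_comp; apply: eq_map => b /=; rewrite state_st.
Qed.

Let gF q : has_gf size (state_class q) (word_gf (state_class q)).
Proof. by apply: cayley_word_gf => w [[]]. Qed.

Section Pairs.
Variable d : word.
Hypothesis two : is_two d.

Let szd := size_two two.

Definition ind_class q w := state_class q w /\ indecomp d w.

Definition pair_class q (p : Q * Q) w := state_class q w /\
  exists bs, [/\ decomp d bs w, indecomp d (nth [::] bs 0) & map state bs = [:: p.1; p.2]].

(** Inflation of [d] is the bijection, with the standardized blocks as inverse; it is injective
    because the first block is indecomposable. *)
Lemma pair_class_gf q (p : Q * Q) G F : pair_rel d p.1 p.2 q ->
  has_gf size (ind_class p.1) G -> has_gf size (state_class p.2) F ->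
  has_gf size (pair_class q p) (G * F).
Proof.
move=> /and4P[dS /eqP combE _ _] gG gF2; have := has_gf_prod gG gF2.
have infl2 (t : word * word) : ind_class p.1 t.1 /\ state_class p.2 t.2 ->
    [/\ in_closure (inflate d [:: t.1; t.2]),
        size (inflate d [:: t.1; t.2]) = (size t.1 + size t.2)%N &
        exists bs, [/\ decomp d bs (inflate d [:: t.1; t.2]), map st bs = [:: t.1; t.2] &
          map state bs = [:: state t.1; state t.2]]].
  move=> [[[cl1 nz1 _] _] [cl2 nz2 _]].
  have [||//|cl sz [bs [dec bsE stE]]] := @inflate_class d [:: t.1; t.2] dS.
  - by rewrite szd.
  - exact: tight_two.
  - by move=> w; rewrite !inE => /orP[]/eqP->.
  by split=> //; [rewrite sz /= addn0|exists bs].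
apply: (@has_gf_bij _ _ _ _ (fun t : word * word => inflate d [:: t.1; t.2])).
- move=> t Pt; have [cl sz [bs [dec bsE stE]]] := infl2 t Pt; split=> //.
  have [[[_ nz1 st1] ind1] [_ nz2 st2]] := Pt.
  rewrite st1 st2 in stE; split.
    split=> //; last by rewrite (decomp_state dec) stE.
    move=> /(congr1 size); rewrite sz => /eqP; rewrite addn_eq0 size_eq0.
    by move=> /andP[/eqP].
  exists bs; split=> //; apply/indecomp_st.
  case: (bs) bsE => [//|b bs'] /= [-> _]; exact: ind1.
- move=> t t' Pt Pt' E.
  have [_ _ [bs [dec bsE _]]] := infl2 t Pt; have [_ _ [bs' [dec' bsE' _]]] := infl2 t' Pt'.
  have ind (u : word * word) cs : ind_class p.1 u.1 -> map st cs = [:: u.1; u.2] -> indecomp d (nth [::] cs 0).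
    by move=> [_ ind1]; case: cs => [//|c cs] /= [e _]; apply/indecomp_st; rewrite e.
  rewrite E in dec; have := decomp_two_unique two dec dec' (ind _ _ Pt.1 bsE) (ind _ _ Pt'.1 bsE').
  move=> bsbs; rewrite bsbs bsE' in bsE; case: bsE; case: (t) => a b; case: (t') => a' b' /=.
  by move=> -> ->.
move=> w [[clw nzw stw] [bs [dec ind1 stE]]].
have [b1 [b2 [bsE wE nz1 nz2 cr]]] := (decomp2P w two bs).1 dec.
rewrite bsE in dec ind1 stE; case: stE => st1 st2.
exists (st b1, st b2); last by apply: (inflate_st _ dec); case: clw.
have cl1 : state_class (state b1) (st b1).
  by apply: block_class clw dec _; rewrite mem_head.
have cl2 : state_class (state b2) (st b2).
  by apply: block_class clw dec _; rewrite !inE eqxx orbT.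
by rewrite /= -st1 -st2; split=> //; split=> //; apply/indecomp_st.
Qed.

Let gA q : has_gf size (ind_class q) (word_gf (ind_class q)).
Proof. by apply: cayley_word_gf => w [[[]]]. Qed.

Definition pair_sum q : series := \sum_(q1 : Q) \sum_(q2 : Q)
  (pair_rel d q1 q2 q)%:R * (word_gf (ind_class q1) * word_gf (state_class q2)).

Lemma decomposable_gf q :
  has_gf size (fun w => state_class q w /\ is_decomposable d w) (pair_sum q).
Proof.
rewrite /pair_sum pair_big /=; under eq_bigr do rewrite mulr_natl mulrb.
rewrite -big_mkcond /= -big_filter; set r := [seq p <- _ | _].
have ur : uniq r by rewrite filter_uniq // index_enum_uniq.
have mem_r p : p \in r = pair_rel d p.1 p.2 q by rewrite mem_filter mem_index_enum andbT.
have := @has_gf_bigU _ size _ r (pair_class q)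
    (fun p => word_gf (ind_class p.1) * word_gf (state_class p.2)) ur.
move=> /(_ _ _)/wrap[p|i j w|]; first by rewrite mem_r => rp; apply: pair_class_gf.
  rewrite !mem_r => ri rj [_ [bs [dec ind1 stE]]] [_ [bs' [dec' ind1' stE']]].
  move: stE'; rewrite -(decomp_two_unique two dec dec' ind1 ind1') stE.
  by case: (i) (j) => a b [a' b'] /= [-> ->].
apply: has_gf_ext => w; split=> [[p _ [cw [bs [dec _ _]]]]|[cw [bs dec]]].
  by split=> //; exists bs.
have [bs' dec' ind1] := decomp_two_exists two dec.
have [b1 [b2 [bsE wE nz1 nz2 cr]]] := (decomp2P w two bs').1 dec'.
rewrite bsE in dec' ind1; have [clw nzw stw] := cw.
exists (state b1, state b2); last by split=> //; exists [:: b1; b2].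
rewrite mem_r /= /pair_rel -stw -(decomp_state dec') eqxx /=.
rewrite !(decomp_state_sub dec') ?inE ?eqxx ?orbT // !andbT.
have cd := cayley_two two.
have simd : simple_cayley d.
  split=> // a b [/andP[leab ltb] _]; rewrite szd in ltb *; lia.
by case: clw => _; apply=> //; apply: decomp_contained dec'.
Qed.

Lemma pair_equation q :
  word_gf (state_class q) = word_gf (ind_class q) + pair_sum q.
Proof.
apply: has_gf_unique (gF q) _; have := has_gf_union (gA q) (decomposable_gf q).
move=> /(_ _)/wrap[w [_ ind] [_ dec]|]; first exact: ind.
apply: has_gf_ext => w; split=> [[[]|[]]//|cw].
have [dec|ind] := pselect (is_decomposable d w); [by right|by left].
Qed.

End Pairs.
Let d12 : word := [:: 1%N; 2%N].
Let d21 : word := [:: 2%N; 1%N].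
Let two12 : is_two d12. Proof. by left. Qed.
Let two21 : is_two d21. Proof. by right. Qed.

Definition uniq_pos (s : word) i := [forall j : 'I_(size s), (nth 0 s j == nth 0 s i) ==> (j == i :> nat)].

Lemma uniq_posP s i :
  reflect (forall j, (j < size s)%N -> nth 0%N s j = nth 0%N s i -> j = i) (uniq_pos s i).
Proof.
apply: (iffP forallP) => [u j ltj e|u j].
  by have := u (Ordinal ltj); rewrite /= e eqxx => /eqP.
by apply/implyP => /eqP e; apply/eqP/u.
Qed.

(** The block at a repeated letter of [s] has one letter, which contributes the factor $x$. *)
Definition monomial (s : word) (t : seq Q) : seq (option Q) :=
  mkseq (fun i => if uniq_pos s i then Some (nth finset.set0 t i) else None) (size s).

Let one_word : word := [:: 1%N].

Lemma cayley_one (w : word) : cayley w -> size w = 1%N -> w = one_word.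
Proof.
move=> cw sz1; apply: oiso_cayley => //; first by exists 1%N.
by split=> // i j; rewrite sz1 !ltnS !leqn0 => /eqP-> /eqP->; rewrite !leqnn.
Qed.

Definition letter_class (o : option Q) (w : word) : Prop :=
  if o is Some q then state_class q w else w = one_word.

Definition letter_gf (o : option Q) : series :=
  oapp (fun q => word_gf (state_class q)) (series_of_poly 'X) o.

Lemma one_word_gf : has_gf size (fun w : word => w = one_word) (series_of_poly 'X).
Proof.
move=> k; exists (k == 1%N : nat); last by rewrite /series_of_poly coefX.
have [->|k1] := eqVneq k 1%N.
  by exists [:: one_word]; split=> // w; rewrite inE; split=> [/eqP->|[->]].
by apply: has_card0 => w [-> k1']; rewrite -k1' in k1.
Qed.

Lemma letter_classP o : has_gf size (letter_class o) (letter_gf o).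
Proof. by case: o => [q|]; [apply: gF|apply: one_word_gf]. Qed.

Definition big_simples := [seq s <- undup S | [&& (1 < size s)%N, s != d12 & s != d21]].

Lemma big_simplesP s : s \in big_simples -> s \in S /\ large_simple s.
Proof.
rewrite mem_filter mem_undup => /andP[/and3P[szs /eqP n12 /eqP n21] Ss].
by split=> //; split=> //; apply: S_simple.
Qed.

(** [monomial] ignores the state listed at a repeated letter, so this state is fixed to be that of
    the one-letter word; otherwise the same words would be counted for several lists. *)
Definition admissible s (t : seq Q) (q : Q) := [&& combine s t == q, all (fun q' : Q => q' \subset q) t &
  all (fun i => uniq_pos s i || (nth finset.set0 t i == state one_word)) (iota 0 (size s))].

Definition inflation_class s (t : seq Q) (w : word) := in_closure w /\
  exists2 bs, decomp s bs w & map state bs = t.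

Lemma one_in_closure s : s \in S -> (0 < size s)%N -> in_closure one_word.
Proof.
move=> Ss s_gt0; apply: (@in_closure_contained _ s).
  by split=> [|t simt]; [case: (S_simple Ss)|apply: S_closed].
case: s s_gt0 {Ss} => // x s _; exists [:: x]; first by rewrite /= eqxx sub0seq.
exact: cayley_one (cayley_st _) _.
Qed.

Lemma inflation_gf s t q : s \in big_simples -> size t = size s -> admissible s t q ->
  has_gf size (inflation_class s t) (\prod_(o <- monomial s t) letter_gf o).
Proof.
move=> /big_simplesP[Ss lg] szt; have [_ szs _ _] := lg.
move=> /and3P[/eqP combE /allP sub /allP ok].
have szm : size (monomial s t) = size s by rewrite size_mkseq.
have := @has_gf_lists _ size _ None [::] (monomial s t) letter_class letter_gf (fun o _ => letter_classP o).
have infl_ws (ws : seq word) : size ws = size (monomial s t) /\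
      (forall j, (j < size (monomial s t))%N -> letter_class (nth None (monomial s t) j) (nth [::] ws j)) ->
    [/\ in_closure (inflate s ws), size (inflate s ws) = sumn (map size ws) &
    exists bs, [/\ decomp s bs (inflate s ws), map st bs = ws & map state bs = t]].
  rewrite szm => -[szw cw].
  have cw' i : (i < size s)%N -> [/\ nth [::] ws i <> [::], in_closure (nth [::] ws i),
      state (nth [::] ws i) = nth finset.set0 t i &
      (1 < size (nth [::] ws i))%N -> uniq_pos s i].
    move=> lti; have := cw i lti; rewrite nth_mkseq //.
    have : uniq_pos s i || (nth finset.set0 t i == state one_word).
      by apply: ok; rewrite mem_iota.
    case: ifP => /= [_ _ [cl nz st]|_ /eqP -> ->]; split=> //.
    exact: one_in_closure Ss (ltnW szs).
  have [||cl sz [bs [dec bsE stE]]] := @inflate_class s ws Ss szw.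
  - move=> i lti; have [nz _ _ u] := cw' i lti; split; first by rewrite lt0n size_eq0; apply/eqP.
    by move=> /u /uniq_posP.
  - by move=> w /(nthP [::])[i lti <-]; rewrite szw in lti; case: (cw' i lti).
  split=> //; exists bs; split=> //; rewrite stE.
  apply: (@eq_from_nth _ finset.set0) => [|i]; rewrite size_map szw // => lti.
  by rewrite (nth_map [::]) ?szw //; case: (cw' i lti).
apply: (@has_gf_bij _ _ _ _ (fun ws : seq word => inflate s ws)).
- move=> ws /infl_ws[cl sz [bs [dec bsE stE]]]; split=> //; split=> //; by exists bs.
- move=> ws ws' /infl_ws[_ _ [bs [dec wsE _]]] /infl_ws[_ _ [bs' [dec' wsE' _]]] E.
  rewrite E in dec; rewrite -wsE -wsE'.
  by have [_ ->] := decomp_unique dec dec' lg lg.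
move=> w [clw [bs dec stE]]; exists (map st bs); last by apply: inflate_st dec; case: clw.
have [/inflP[szE _] ti _] := dec; rewrite size_map szm; split=> // i lti.
rewrite nth_mkseq // (nth_map [::]) ?szE //.
have bsi : nth [::] bs i \in bs by rewrite mem_nth ?szE.
have cl := block_class clw dec bsi.
case: ifP => [_|nu] /=; first by rewrite -stE (nth_map [::]) ?szE.
apply: cayley_one; first by case: cl => -[].
rewrite size_st; have [pos u] := ti i lti; apply/eqP; rewrite eqn_leq pos andbT leqNgt.
by apply: contraFN nu => /u /uniq_posP.
Qed.

Definition terms q : seq (seq (option Q)) :=
  (if `[< state_class q one_word >] then [:: [:: None]] else [::]) ++
  flatten [seq [seq monomial s t | t <- lists (enum Q) (size s) & admissible s t q]
          | s <- big_simples].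

Definition rest_class q w :=
  [/\ state_class q w, indecomp d12 w & indecomp d21 w].

(** A word that is neither a sum nor a skew sum is a single letter or an inflation of a large simple
    word; [decomp_unique] keeps the pieces disjoint, and [decomp_two] shows that no sum or skew sum
    is among them. *)
Lemma rest_gf q : has_gf size (rest_class q) (\sum_(m <- terms q) \prod_(o <- m) letter_gf o).
Proof.
rewrite /terms big_cat /= big_flatten /= big_map.
under [X in _ + X]eq_bigr do rewrite big_map.
pose P1 (w : word) := state_class q w /\ w = one_word.
pose P2 (w : word) := exists2 s, s \in big_simples & exists2 t,
  t \in [seq t <- lists (enum Q) (size s) | admissible s t q] & inflation_class s t w.
have g1 : has_gf size P1 (\sum_(m <- if `[< state_class q one_word >] then [:: [:: None]] else [::])
    \prod_(o <- m) letter_gf o).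
  case: asboolP => [cq|ncq]; rewrite ?big_seq1 ?big_nil.
    by apply: has_gf_ext one_word_gf => w; split=> [->|[]].
  by apply: has_gf0 => w [cq w1]; apply: ncq; rewrite -w1.
have mem_t s t : t \in [seq t <- lists (enum Q) (size s) | admissible s t q] ->
    size t = size s /\ admissible s t q.
  by rewrite mem_filter mem_lists => /and3P[adm /eqP szt _].
have g2 : has_gf size P2 (\sum_(s <- big_simples)
    \sum_(t <- [seq t <- lists (enum Q) (size s) | admissible s t q])
      \prod_(o <- monomial s t) letter_gf o).
  apply: has_gf_bigU => [|s Ss|s s' w Ss Ss'].
  - by apply/filter_uniq/undup_uniq.
  - apply: has_gf_bigU => [|t /mem_t[szt adm]|t t' w _ _ [_ [bs dec <-]] [_ [bs' dec' <-]]].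
    + by apply/filter_uniq/uniq_lists/enum_uniq.
    + exact: inflation_gf Ss szt adm.
    by have [_ lg] := big_simplesP Ss; have [_ ->] := decomp_unique dec dec' lg lg.
  have [_ lg] := big_simplesP Ss; have [_ lg'] := big_simplesP Ss'.
  move=> [t _ [_ [bs dec _]]] [t' _ [_ [bs' dec' _]]].
  by have [->] := decomp_unique dec dec' lg lg'.
have sz_dec s bs w : (1 < size s)%N -> decomp s bs w -> (1 < size w)%N.
  move=> szs [/inflP[szE _] ti ->]; have := tight_pos szE ti.
  rewrite -szE in szs; case: (bs) szs => [//|b1 [//|b2 bs']] _ /= /and3P[p1 p2 _].
  rewrite !size_cat; lia.
apply: has_gf_ext (has_gf_union g1 g2 _) => w.
  split=> [[[cq w1]|[s Ss [t /mem_t[szt adm] [clw [bs dec stE]]]]]|[cq ind12 ind21]].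
  - have ind d bs : is_two d -> ~ decomp d bs w.
      by rewrite w1 => two dec; have := sz_dec _ _ _ _ dec; case: two => -> /(_ isT).
    by split=> // -[bs /ind]; apply.
  - have [_ [sims szs n12 n21]] := big_simplesP Ss; have szw := sz_dec _ _ _ szs dec.
    have ind d bs' : is_two d -> ~ decomp d bs' w.
      move=> two dec'.
      have [//|[//|e]] := decomp_two dec' (cayley_two two) (size_two two) dec sims szs.
      by case: two; rewrite -e.
    split; [split=> //|by move=> [bs' /ind]; apply|by move=> [bs' /ind]; apply].
      by move=> w0; rewrite w0 in szw.
    by rewrite (decomp_state dec) stE; case/and3P: adm => /eqP.
  have [cl nz stw] := cq; have [cw sim] := cl.
  have [sz1|szw] := leqP (size w) 1.
    left; split=> //; apply: cayley_one => //; apply/eqP; rewrite eqn_leq sz1 lt0n size_eq0.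
    exact/eqP.
  right; have [s [bs [sims szs dec]]] := decomp_exists cw szw.
  have Ss : s \in S by apply: sim => //; apply: decomp_contained dec; case: sims.
  exists s.
    rewrite mem_filter mem_undup szs Ss andbT /=; apply/andP; split; apply/eqP => e.
      by apply: ind12; exists bs; rewrite -e.
    by apply: ind21; exists bs; rewrite -e.
  have [/inflP[szE _] ti _] := dec.
  exists (map state bs); last by split=> //; exists bs.
  rewrite mem_filter mem_lists size_map szE eqxx; apply/andP; split; last first.
    by apply/allP => q' _; apply: mem_enum.
  rewrite /admissible -stw (decomp_state dec) eqxx /=; apply/andP; split.
    by apply/allP => q' q'b; rewrite -(decomp_state dec); apply: decomp_state_sub dec _.
  apply/allP => i; rewrite mem_iota => /= lti; rewrite (nth_map [::]) ?szE //.
  have [u|nu] := boolP (uniq_pos s i) => //=.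
  have bsi : nth [::] bs i \in bs by rewrite mem_nth ?szE.
  have [[cb _] _ _] := block_class cl dec bsi.
  rewrite -state_st (cayley_one cb) //.
  rewrite size_st; have [pos u] := ti i lti; apply/eqP; rewrite eqn_leq pos andbT leqNgt.
  by apply: contraNN nu => /u /uniq_posP.
move=> [_ ->] [s + [t _ [_ [bs dec _]]]]; rewrite mem_filter => /andP[/and3P[szs _ _] _].
by have := sz_dec _ _ _ szs dec.
Qed.

End StateSystem.

(** * Degree bounds for the words of the closure that avoid given patterns *)

Section ClosureBound.
Local Open Scope ring_scope.
Variables (S pats : seq word).
Hypothesis S_simple : forall s, s \in S -> simple_cayley s.
Hypothesis S_closed : forall s t, s \in S -> simple_cayley t -> contained t s -> t \in S.
Hypothesis pats_factor : forall A B D, A ++ B ++ D \in pats -> st B \in pats.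

Let Q := {set 'I_(size pats)}.
Let d12 : word := [:: 1%N; 2%N].
Let d21 : word := [:: 2%N; 1%N].
Let two12 : is_two d12. Proof. by left. Qed.
Let two21 : is_two d21. Proof. by right. Qed.

Let F (q : Q) := word_gf (state_class S q).
Let A (q : Q) := word_gf (ind_class S d12 q).
Let M (q : Q) := word_gf (ind_class S d21 q).

Let gF q : has_gf size (state_class S q) (F q).
Proof. by apply: cayley_word_gf => w [[]]. Qed.

Lemma word_gf_cst (P : word -> Prop) : ~ P [::] -> cst_series (word_gf P) = 0.
Proof. by move=> P0; rewrite /cst_series /word_gf /= asboolF. Qed.

Let F_split q : F q = pair_sum S d12 q + pair_sum S d21 q +
  \sum_(m <- terms S q) \prod_(o <- m) letter_gf S o.
Proof.
apply: has_gf_unique (gF q) _.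
have g12 := decomposable_gf S_closed pats_factor two12 q.
have g21 := decomposable_gf S_closed pats_factor two21 q.
have gr := rest_gf S_simple S_closed pats_factor q.
apply: has_gf_ext (has_gf_union (has_gf_union g12 g21 _) gr _) => w.
- split=> [[[[]|[]]|[]]//|cq].
  have [dec12|ind12] := pselect (is_decomposable d12 w); first by left; left.
  have [dec21|ind21] := pselect (is_decomposable d21 w); first by left; right.
  by right.
- by move=> [_ [bs dec]] [_ [bs' dec']]; apply: decomp_two_exclusive dec dec'.
by move=> [[_ dec]|[_ dec]] [_ ind12 ind21]; [apply: ind12|apply: ind21].
Qed.

Lemma size_flatten_le (I : eqType) (T : Type) (r : seq I) (f : I -> seq T) m :
  (forall i, i \in r -> (size (f i) <= m)%N) -> (size (flatten (map f r)) <= size r * m)%N.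
Proof.
elim: r => [//|i r IHr] fm /=; rewrite size_cat mulSn leq_add ?fm ?mem_head //.
by apply: IHr => j rj; apply: fm; rewrite inE rj orbT.
Qed.

(** There are [2 ^ p] states. A state has at most one monomial for the single letter and one for
    each simple word with a list of states; [l.+1] bounds the lengths of monomials, that of the
    single letter included when [l = 0]. The outer factor pays for summing over states. *)
Definition closure_bound p sigma l :=
  (2 ^ p * system_bound (1 + sigma * (2 ^ p) ^ l) l.+1 (2 ^ p))%N.

Theorem closure_avoiding_bounded (B : word -> Prop) sigma l :
  (size S <= sigma)%N -> (forall s, s \in S -> (size s <= l)%N) ->
  (forall w, B w -> w \in pats) ->
  let D := closure_bound (size pats) sigma l in
  exists v : seq series, [/\ has (fun g => g != 0) v, (size v <= D)%N &
    bounded D v (word_gf (fun w => in_closure S w /\ forall b, B b -> ~ contained b w))].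
Proof.
move=> leS lel Bp; have cardQ : #|{: Q}| = (2 ^ size pats)%N by rewrite -cardsT -powersetT card_powerset cardsT card_ord.
have le_rank (q' q : Q) : q' \subset q -> (q' == q) || (#|q'| < #|q|)%N.
  rewrite -[q' == q]orbF; case: eqVneq => //= nqq sub.
  by apply: proper_card; rewrite finset.properEneq nqq.
have size_big : (size (big_simples S) <= sigma)%N.
  by rewrite size_filter (leq_trans (count_size _ _)) // (leq_trans (size_undup _)).
have big_l s : s \in big_simples S -> (1 < size s <= l)%N.
  by rewrite mem_filter mem_undup => /andP[/and3P[-> _ _] /lel].
have nzF (q : Q) : ~ state_class S q [::] by case.
have nzI d (q : Q) : ~ ind_class S d q [::] by move=> [/nzF].
pose L := (1 + sigma * #|{: Q}| ^ l)%N.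
have [v [nzv szv bv]] : exists v : seq series, let Z := system_bound L l.+1 #|{: Q}| in
    [/\ has (fun g => g != 0) v, (size v <= Z)%N & forall q, bounded Z v (F q)].
  apply: (@system_bounded Q F A M (@pair_rel S pats d12) (@pair_rel S pats d21)
    (@terms S pats) (fun q : Q => #|q|) L l.+1).
- by move=> q; apply: word_gf_cst.
- by move=> q; apply: word_gf_cst.
- by move=> q; apply: word_gf_cst.
- by move=> q1 q2 q /and4P[_ _ s1 s2]; split; apply: le_rank.
- by move=> q1 q2 q /and4P[_ _ s1 s2]; split; apply: le_rank.
- by move=> q; apply: pair_equation.
- by move=> q; apply: pair_equation.
- move=> q.
  (* Words are sums, skew sums or neither: $F=P_1+P_2+r$ with $A=F-P_1$ and $M=F-P_2$, so that
     $A+M=F+r$. *)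
  have e12 : F q = A q + pair_sum S d12 q by apply: pair_equation.
  have e21 : F q = M q + pair_sum S d21 q by apply: pair_equation.
  have : F q = pair_sum S d12 q + pair_sum S d21 q +
    \sum_(m <- terms S q) \prod_(o <- m) oapp F (series_of_poly 'X) o by apply: F_split.
  move: e12 e21; move: (A q) (M q) (F q) (\sum_(m <- _) _) => a m f r -> e21 e.
  move: e21 e; move: (pair_sum S d12 q) (pair_sum S d21 q) => p1 p2 e21 e.
  have -> : m = a + p1 - p2 by rewrite e21 addrK.
  have -> : r = a + p1 - p1 - p2 by rewrite e; ring.
  ring.
- move=> q; rewrite size_cat; apply: leq_add; first by case: ifP.
  apply: (leq_trans (@size_flatten_le _ _ _ _ (#|{: Q}| ^ l)%N _)); last first.
    by rewrite leq_mul2r size_big orbT.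
  move=> s /big_l/andP[_ lesl]; rewrite size_map size_filter.
  apply: leq_trans (count_size _ _) _; rewrite size_lists -cardE.
  by rewrite leq_pexp2l // cardQ expn_gt0.
- move=> q m; rewrite mem_cat => /orP[|/flattenP[ms /mapP[s ss ->] /mapP[t]]].
    by case: ifP => // _; rewrite inE => /eqP->; split=> //; left.
  rewrite mem_filter => /andP[/and3P[_ /allP sub _] tl] ->.
  have /andP[szs lesl] := big_l _ ss.
  rewrite size_mkseq; split; [exact: leqW|by right|].
  move=> q' /mapP[i]; rewrite mem_iota => /= lti; case: ifP => // _ [->].
  apply/le_rank/sub/mem_nth.
  by move: tl; rewrite mem_lists => /andP[/eqP->].
set D := closure_bound _ _ _.
have DE : D = (#|{: Q}| * system_bound L l.+1 #|{: Q}|)%N by rewrite /D /closure_bound /L cardQ.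
have leZ : (system_bound L l.+1 #|{: Q}| <= D)%N.
  by rewrite DE leq_pmull // cardQ expn_gt0.
exists v; split=> //; first exact: leq_trans szv leZ.
pose good (q : Q) := [forall i in q, ~~ `[< B (nth [::] pats i) >]].
have goodP w : good (state pats w) <-> forall b, B b -> ~ contained b w.
  split=> [/forall_inP g b Bb cbw|g].
    have /(nthP [::])[i lti bE] := Bp _ Bb.
    have /asboolP[] : ~~ `[< B (nth [::] pats (Ordinal lti)) >].
      by apply: g; rewrite inE /= bE; apply/asboolP.
    by rewrite /= bE.
  apply/forall_inP => i; rewrite inE => /asboolP ci; apply/asboolP => Bi.
  exact: g Bi ci.
set P := fun w => _; have gP : has_gf size P (word_gf P).
  by apply: cayley_word_gf => w [[]].
(* The states cover nonempty words only, so the empty word is added by hand. *)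
have -> : word_gf P = (if `[< P [::] >] then 1 else 0) + \sum_(q | good q) F q.
  apply: has_gf_unique gP _.
  have g0 : has_gf size (fun w => P w /\ w = [::]) (if `[< P [::] >] then 1 else 0).
    case: asboolP => [P0|nP0]; last by apply: has_gf0 => w [Pw w0]; apply: nP0; rewrite -w0.
    move=> k; exists (k == 0%N : nat) => //; have [->|k0] := eqVneq k 0%N.
      exists [:: [::]]; split=> // w; rewrite inE; split=> [/eqP->|[[_ ->]]] //.
    by apply: has_card0 => w [[_ ->]] /= e; rewrite -e in k0.
  have ur : uniq [seq q <- index_enum {: Q} | good q] by rewrite filter_uniq // index_enum_uniq.
  rewrite -big_filter.
  have g1 : has_gf size (fun w => exists2 q, q \in [seq q <- index_enum {: Q} | good q] & state_class S q w)
      (\sum_(q <- [seq q <- index_enum {: Q} | good q]) F q).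
    by apply: has_gf_bigU => // q q' w _ _ [_ _ <-] [_ _ <-].
  apply: has_gf_ext (has_gf_union g0 g1 _) => w.
    split=> [[[]//|[q]]|[cl av]].
      rewrite mem_filter => /andP[gq _] [cl _ stw]; split=> //.
      by apply/goodP; rewrite stw.
    have [w0|/eqP nzw] := eqVneq w [::]; [by left|right].
    exists (state pats w); last by split.
    by rewrite mem_filter mem_index_enum andbT; apply/goodP.
  by move=> [_ w0] [q _ [_ nzw _]].
rewrite DE -[X in bounded X]add0n; apply: boundedD.
  by case: ifP => _; [apply: bounded1|apply: bounded0].
by apply: bounded_sum_fin => q _; apply: bv.
Qed.

End ClosureBound.

(** * Higman's theorem *)

Section WellQuasiOrder.
Variables (T : Type) (R : T -> T -> Prop).
Hypotheses (R_trans : forall x y z, R x y -> R y z -> R x z).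

Definition good_seq (f : nat -> T) := exists i j, i < j /\ R (f i) (f j).
Definition wqo (V : T -> Prop) := forall f, (forall n, V (f n)) -> good_seq f.

Definition increasing (g : nat -> nat) := forall i, g i < g i.+1.

Lemma increasing_lt g : increasing g -> forall i j, i < j -> g i < g j.
Proof. by move=> gi; apply: (homo_ltn ltn_trans gi). Qed.

Lemma increasing_comp g h : increasing g -> increasing h -> increasing (g \o h).
Proof. by move=> gi hi i; apply: increasing_lt gi _ _ (hi i). Qed.

Lemma infinitely_often (P : nat -> Prop) : (forall n, exists2 m, n < m & P m) ->
  exists2 g, increasing g & forall i, P (g i).
Proof.
move=> inf; have /choice[next nextP] (n : nat) : exists m, n < m /\ P m.
  by have [m lt Pm] := inf n; exists m.
exists (fun i => iter i.+1 next 0) => i; first by rewrite iterS (nextP _).1.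
by rewrite iterS; case: (nextP (iter i next 0)).
Qed.

(** Infinitely many terminal indices, those below no later term, would form a bad sequence. Beyond
    the last of them each term has a later one above it, and transitivity makes the chain. *)
Lemma wqo_chain V f : wqo V -> (forall n, V (f n)) ->
  exists2 g, increasing g & forall i j, i < j -> R (f (g i)) (f (g j)).
Proof.
move=> wV Vf; pose terminal n := forall m, n < m -> ~ R (f n) (f m).
have [N Nterm] : exists N, forall n, N < n -> ~ terminal n.
  apply: contrapT => noN; have [n|g gi tg] := @infinitely_often terminal.
    apply: contrapT => none; apply: noN; exists n => m ltnm tm; apply: none.
    by exists m.
  have [i [j [ltij Rij]]] := wV (f \o g) (fun n => Vf _).
  exact: tg i (g j) (increasing_lt gi ltij) Rij.
have /choice[next nextP] (n : nat) : exists m, N < n -> n < m /\ R (f n) (f m).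
  have [ltNn|] := ltnP N n; last by exists 0.
  by have /existsNP[m /not_implyP[lt /contrapT Rm]] := Nterm n ltNn; exists m.
have gtN i : N < iter i next N.+1.
  elim: i => [//|i IHi]; exact: ltn_trans IHi (nextP _ IHi).1.
exists (fun i => iter i next N.+1) => [i|i j]; first by case: (nextP _ (gtN i)).
elim: j => [//|j IHj]; rewrite ltnS leq_eqVlt => /predU1P[->|/IHj Rij].
  by case: (nextP _ (gtN j)).
by apply: R_trans Rij _; case: (nextP _ (gtN j)).
Qed.

Lemma pigeonhole (L : eqType) (r : seq L) (lab : nat -> L) : (forall n, lab n \in r) ->
  exists2 g, increasing g & exists a, forall i, lab (g i) = a.
Proof.
elim: r lab => [|a r IHr] lab labr; first by have := labr 0.
have [inf|] := pselect (forall n, exists2 m, n < m & lab m = a).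
  by have [g gi ga] := infinitely_often inf; exists g => //; exists a.
move=> /existsNP[N noN]; have [n|g gi [b gb]] := IHr (fun n => lab (N + n.+1)).
  have := labr (N + n.+1); rewrite inE => /predU1P[e|//].
  by case: noN; exists (N + n.+1) => //; rewrite -addSnnS leq_addr.
exists (fun i => N + (g i).+1); last by exists b.
by move=> i; rewrite ltn_add2l ltnS.
Qed.

(** Dickson's lemma for [k]-tuples: the subsequence is refined one coordinate at a time. *)
Lemma wqo_lists V (t0 : T) k (f : nat -> seq T) : wqo V ->
  (forall n c, c < k -> V (nth t0 (f n) c)) ->
  exists2 g, increasing g & forall i j, i < j -> forall c, c < k ->
    R (nth t0 (f (g i)) c) (nth t0 (f (g j)) c).
Proof.
move=> wV; elim: k => [|k IHk] Vf; first by exists id.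
have [n c ltc|g gi Rg] := IHk; first exact/Vf/ltnW.
have [n|h hi Rh] := @wqo_chain V (fun n => nth t0 (f (g n)) k) wV; first exact: Vf.
exists (g \o h); first exact: increasing_comp.
move=> i j ltij c; rewrite ltnS leq_eqVlt => /predU1P[->|ltc]; first exact: Rh.
by apply: Rg => //; apply: increasing_lt hi _ _ ltij.
Qed.

Variables (U : T -> Prop) (sz : T -> nat) (L : eqType) (labels : seq L) (t0 : T).
Variables (lab : T -> L) (parts : T -> seq T).
Hypotheses (lab_in : forall w, U w -> lab w \in labels)
  (partsP : forall w c, U w -> c < size (parts w) ->
     [/\ U (nth t0 (parts w) c), sz (nth t0 (parts w) c) < sz w & R (nth t0 (parts w) c) w])
  (lab_parts : forall w w', U w -> U w' -> lab w = lab w' ->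
     size (parts w) = size (parts w') /\
     ((forall c, c < size (parts w) -> R (nth t0 (parts w) c) (nth t0 (parts w') c)) -> R w w')).

Let bad (f : nat -> T) := (forall n, U (f n)) /\ ~ good_seq f.

(** The device of Nash-Williams: terms are fixed one after the other, each of least size among the
    bad sequences that share the terms already fixed. *)
Let minimal_bad f : bad f -> exists2 m, bad m &
  forall n h, bad h -> (forall i, i < n -> h i = m i) -> sz (m n) <= sz (h n).
Proof.
move=> bf.
have step (n : nat) (h : nat -> T) : exists h', bad h ->
    [/\ bad h', forall i, i < n -> h' i = h i &
       forall h'', bad h'' -> (forall i, i < n -> h'' i = h i) -> sz (h' n) <= sz (h'' n)].
  have [bh|] := pselect (bad h); last by exists h.
  have exk : exists k, `[< exists h', [/\ bad h', forall i, i < n -> h' i = h i & sz (h' n) = k] >].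
    by exists (sz (h n)); apply/asboolP; exists h.
  have [k /asboolP[h' [bh' eh' szk]] mink] := ex_minnP exk.
  exists h' => _; split=> // h'' bh'' eh''; rewrite szk; apply: mink; apply/asboolP.
  by exists h''.
have /choice[next nextP] (p : nat * (nat -> T)) := step p.1 p.2.
pose h := fix h n := if n is n'.+1 then next (n', h n') else f.
have bh n : bad (h n) by elim: n => [//|n IHn] /=; case: (nextP (n, h n) IHn).
have hS n i : i < n -> h n.+1 i = h n i.
  by move=> lti; have [_ e _] := nextP (n, h n) (bh n); apply: e.
have hE i n : i < n -> h n i = h i.+1 i.
  elim: n => [//|n IHn]; rewrite ltnS leq_eqVlt => /predU1P[->//|ltin].
  by rewrite hS // IHn.
exists (fun n => h n.+1 n).
  split=> [n|[i [j [ltij Rij]]]]; first by case: (bh n.+1).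
  case: (bh j.+1) => _; apply; exists i, j; split=> //.
  by rewrite (hE i j.+1) // ltnW.
move=> n g bg eg; have [_ _ mn] := nextP (n, h n) (bh n); apply: mn => //= i lti.
by rewrite eg // (hE i n).
Qed.

(* In a minimal bad sequence the parts of the terms form a well-quasi-order. *)
Theorem higman : wqo U.
Proof.
move=> f Uf; apply: contrapT => badf.
have [m [Um badm] minm] := minimal_bad (conj Uf badf).
pose V t := exists n c, c < size (parts (m n)) /\ t = nth t0 (parts (m n)) c.
have wV : wqo V.
  move=> g Vg; apply: contrapT => badg.
  have /choice[phi phiP] (k : nat) : exists n, exists2 c, c < size (parts (m n)) &
      g k = nth t0 (parts (m n)) c.
    by have [n [c [ltc e]]] := Vg k; exists n, c.
  have exn : exists n, `[< exists k, phi k = n >] by exists (phi 0); apply/asboolP; exists 0.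
  have [n /asboolP[k0 phik0] minn] := ex_minnP exn.
  have len k : n <= phi k by apply: minn; apply/asboolP; exists k.
  have gP k : [/\ U (g k), sz (g k) < sz (m (phi k)) & R (g k) (m (phi k))].
    by have [c ltc ->] := phiP k; apply: partsP.
  (* [n] is the least index whose term supplies a part to [g], and [k0] a place where this happens.
     The sequence [m] before [n], continued by [g] from [k0] on, is bad and smaller than [m] at
     [n]. *)
  pose h i := if i < n then m i else g (k0 + (i - n)).
  have bh : bad h.
    split=> [i|[i [j [ltij]]]]; first by rewrite /h; case: ifP => // _; case: (gP (k0 + (i - n))).
    rewrite /h; case: (ltnP j n) => [ltjn|lenj].
      by rewrite (ltn_trans ltij ltjn) => Rij; apply: badm; exists i, j.
    case: (ltnP i n) => [ltin|leni] Rij.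
      have [_ _ Rk] := gP (k0 + (j - n)); apply: badm; exists i, (phi (k0 + (j - n))).
      by split; [apply: leq_trans ltin (len _)|apply: R_trans Rij Rk].
    by apply: badg; exists (k0 + (i - n)), (k0 + (j - n)); split=> //; lia.
  have hm i : i < n -> h i = m i by rewrite /h => ->.
  have hn : h n = g k0 by rewrite /h ltnn subnn addn0.
  have := minm n h bh hm; rewrite hn.
  by have [_ + _] := gP k0; rewrite phik0 ltnNge => /negP.
have [g gi [a ga]] := pigeonhole (fun n => lab_in (Um n)).
have sizeE i : size (parts (m (g i))) = size (parts (m (g 0))).
  by have [] := lab_parts (Um (g i)) (Um (g 0)); rewrite ?ga.
have [n c ltc|h hi Rh] := @wqo_lists V t0 (size (parts (m (g 0)))) (fun i => parts (m (g i))) wV.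
  by exists (g n), c; rewrite sizeE.
apply: badm; exists (g (h 0)), (g (h 1)); split; first exact/(increasing_lt gi)/hi.
have [|_] := lab_parts (Um (g (h 0))) (Um (g (h 1))); first by rewrite !ga.
by apply=> c; rewrite sizeE => ltc; apply: Rh.
Qed.

End WellQuasiOrder.

(** * The closure of finitely many simple words is well quasi-ordered *)

Section ClosureWqo.
Variable S : seq word.

(** The label of a word is the simple word of a chosen decomposition, and its parts are the
    standardized blocks; a word with fewer than two letters is its own label and has no parts.
    Labels thus form a finite set. *)
Theorem in_closure_wqo : wqo contained (in_closure S).
Proof.
have /choice[dec decP] (w : word) : exists p : word * seq word, in_closure S w ->
    if 1 < size w then [/\ p.1 \in S, 1 < size p.1 & decomp p.1 p.2 w]
    else p = (w, [::]).
  case: (boolP (1 < size w)) => szw; last by exists (w, [::]).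
  have [clw|] := pselect (in_closure S w); last by exists (w, [::]).
  have [cw sim] := clw; have [s [bs [sims szs decw]]] := decomp_exists cw szw.
  exists (s, bs) => _; split=> //; apply: sim => //.
  by apply: decomp_contained decw; case: sims.
have small w : in_closure S w -> (1 < size w) = false -> w \in [:: [::]; [:: 1]].
  move=> [cw _]; case: w cw => [//|x [|//]] cw _; rewrite !inE.
  by rewrite (@cayley_one [:: x]).
have dec_size w : in_closure S w -> 1 < size w -> size (dec w).2 = size (dec w).1.
  by move=> /decP + szw; rewrite szw => -[_ _ [/inflP[]]].
apply: (@higman _ contained contained_trans _ size _ ([:: [::]; [:: 1]] ++ S) [::]
  (fun w => (dec w).1) (fun w => map st (dec w).2)).
- move=> w clw; have := decP w clw; rewrite mem_cat; case: ifP => [_ [-> _ _]|lt ->].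
    by rewrite orbT.
  by rewrite small.
- move=> w c clw; have := decP w clw; case: ifP => [szw|_ -> //] [Ss szs decw].
  rewrite size_map => ltc; rewrite (nth_map [::]) // size_st.
  have inb : nth [::] (dec w).2 c \in (dec w).2 by apply: mem_nth.
  have con := decomp_block_contained decw inb.
  split=> //; first exact: in_closure_contained clw con.
  have [/inflP[szE _] ti wE] := decw; have pos := tight_pos szE ti.
  by rewrite [X in _ < size X]wE; apply: ltn_size_block => //; rewrite szE.
move=> w w' clw clw'; have := decP w clw; have := decP w' clw'.
case: ifP => [szw'|nw'] decw'; case: ifP => [szw|nw] decw.
- have [_ _ dw] := decw; have [_ _ dw'] := decw'; move=> labE.
  rewrite !size_map !dec_size // labE; split=> // con; rewrite -labE in dw'.
  apply: contained_inflate dw dw' _ _; last by case: clw.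
  move=> i lti; have := con i; rewrite -labE !(nth_map [::]) ?dec_size -?labE //.
  by move=> /(_ lti) /contained_st.
- rewrite decw /= => e; have [_ szs _] := decw'; by rewrite -e nw in szs.
- rewrite decw' /= => e; have [_ szs _] := decw; by rewrite e nw' in szs.
rewrite decw decw' /= => ->; split=> // _; apply: contained_refl; by case: clw'.
Qed.

End ClosureWqo.

(** * Computable functions *)

Section Computable.

(** A global copy of the fixpoint local to [computes], on which lemmas can be stated. *)
Fixpoint computes_all (hs : seq recfun) (xs ys : seq nat) : Prop :=
  match hs, ys with
  | [::], [::] => True
  | h :: hs', z :: ys' => computes h xs z /\ computes_all hs' xs ys'
  | _, _ => False
  end.

Lemma computes_Comp g hs xs ys y :
  computes_all hs xs ys -> computes g ys y -> computes (Comp g hs) xs y.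
Proof.
move=> hsP gP; exists ys => //.
by elim: hs ys hsP {gP} => [|h hs IHhs] [|z ys] //= [? ?]; split=> //; apply: IHhs.
Qed.

(** A variable is a position in the list of the [n] arguments; a bound variable is pushed in front,
    which explains [behead] in the rules for binders. *)
Definition computable n (F : seq nat -> nat) :=
  exists f, forall xs, size xs = n -> computes f xs (F xs).

Lemma computable_ext n F G : computable n G -> (forall e, F e = G e) -> computable n F.
Proof. by move=> [f fG] FG; exists f => xs /fG; rewrite FG. Qed.

Lemma computable_var n i : computable n (fun e => nth 0 e i).
Proof. by exists (Proj i). Qed.

Lemma computable_comp n m G (Fs : seq (seq nat -> nat)) : computable m G ->
  size Fs = m -> (forall i, i < m -> computable n (nth (fun=> 0) Fs i)) ->
  computable n (fun e => G [seq F e | F <- Fs]).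
Proof.
move=> [g gP] szF FsP; have [hs hsP] : exists hs, forall xs, size xs = n ->
    computes_all hs xs [seq F xs | F <- Fs].
  elim: Fs m szF FsP {gP} => [|F Fs IHFs] m szF FsP; first by exists [::].
  case: m szF FsP => // m [szF] FsP.
  have [h hP] := FsP 0 isT; have [hs hsP] := IHFs m szF (fun i lti => FsP i.+1 lti).
  by exists (h :: hs) => xs szx /=; split; [apply: hP|apply: hsP].
exists (Comp g hs) => xs szx; apply: computes_Comp (hsP _ szx) _.
by apply: gP; rewrite size_map.
Qed.

Lemma computable_const n k : computable n (fun=> k).
Proof.
elim: k => [|k [f fP]]; first by exists Zero.
by exists (Comp Succ [:: f]) => xs szx; apply: (@computes_Comp _ _ _ [:: k]) => //=; split=> //; apply: fP.
Qed.

Lemma computable_succ n F : computable n F -> computable n (fun e => (F e).+1).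
Proof.
move=> [f fP]; exists (Comp Succ [:: f]) => xs szx.
by apply: (@computes_Comp _ _ _ [:: F xs]) => //=; split=> //; apply: fP.
Qed.

Lemma computable_rec n N A (H : seq nat -> nat -> nat -> nat) :
  computable n N -> computable n A ->
  computable n.+2 (fun e => H (behead (behead e)) (nth 0 e 0) (nth 0 e 1)) ->
  computable n (fun e => nat_rect (fun=> nat) (A e) (H e) (N e)).
Proof.
move=> [fN NP] [fA AP] [fH HP].
(* [PrimRec] takes the number of iterations as first argument, so all the arguments are copied
   behind the value of [N]. *)
exists (Comp (PrimRec fA fH) (fN :: [seq Proj i | i <- iota 0 n])) => xs szx.
apply: (@computes_Comp _ _ _ (N xs :: xs)).
  split; first exact: NP.
  have : [seq nth 0 xs i | i <- iota 0 n] = xs by rewrite -szx; apply: mkseq_nth.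
  move: {2 4}xs => ys; elim: (iota 0 n) ys => [|i r IHr] [|y ys] //= [yE ysE].
  by split=> //; apply: IHr.
rewrite /=; elim: (N xs) => [|k IHk] /=; first exact: AP.
exists (nat_rect (fun=> nat) (A xs) (H xs) k) => //.
by have := HP (k :: nat_rect (fun=> nat) (A xs) (H xs) k :: xs); apply; rewrite /= szx.
Qed.

Lemma computable_comp1 n (h : nat -> nat) F :
  computable 1 (fun e => h (nth 0 e 0)) -> computable n F -> computable n (fun e => h (F e)).
Proof. by move=> hP FP; apply: (computable_comp (Fs := [:: F]) hP) => // -[|i]. Qed.

Lemma computable_comp2 n (h : nat -> nat -> nat) F G :
  computable 2 (fun e => h (nth 0 e 0) (nth 0 e 1)) ->
  computable n F -> computable n G -> computable n (fun e => h (F e) (G e)).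
Proof.
by move=> hP FP GP; apply: (computable_comp (Fs := [:: F; G]) hP) => // -[|[|i]].
Qed.

Lemma computable_comp3 n (h : nat -> nat -> nat -> nat) F G K :
  computable 3 (fun e => h (nth 0 e 0) (nth 0 e 1) (nth 0 e 2)) ->
  computable n F -> computable n G -> computable n K ->
  computable n (fun e => h (F e) (G e) (K e)).
Proof.
by move=> hP FP GP KP; apply: (computable_comp (Fs := [:: F; G; K]) hP) => // -[|[|[|i]]].
Qed.

Lemma computable_comp4 n (h : nat -> nat -> nat -> nat -> nat) F G K M :
  computable 4 (fun e => h (nth 0 e 0) (nth 0 e 1) (nth 0 e 2) (nth 0 e 3)) ->
  computable n F -> computable n G -> computable n K -> computable n M ->
  computable n (fun e => h (F e) (G e) (K e) (M e)).
Proof.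
by move=> hP FP GP KP MP;
  apply: (computable_comp (Fs := [:: F; G; K; M]) hP) => // -[|[|[|[|i]]]].
Qed.

End Computable.

(** Turns an entry of [behead e] into an entry of [e], the form in which [compute_step] recognizes a
    variable. *)
Ltac normalize_env :=
  eapply computable_ext; [|let e := fresh "e" in intros e; cbv beta; rewrite ?nth_behead; reflexivity].

(** * Arithmetic, Boolean and bounded operations are recursive *)

Section Arithmetic.

Lemma computable_add n F G : computable n F -> computable n G ->
  computable n (fun e => F e + G e).
Proof.
move=> FP GP; apply: (computable_ext (G := fun e => nat_rect (fun=> nat) (F e) (fun _ r => r.+1) (G e))).
  by apply: computable_rec => //; apply/computable_succ/computable_var.
by move=> e; elim: (G e) => [|k IHk] /=; rewrite ?addn0 // addnS IHk.
Qed.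

Lemma computable_pred n F : computable n F -> computable n (fun e => (F e).-1).
Proof.
move=> FP; apply: (computable_ext (G := fun e => nat_rect (fun=> nat) 0 (fun i _ => i) (F e))).
  by apply: computable_rec => //; [apply: computable_const|apply: computable_var].
by move=> e; case: (F e).
Qed.

Lemma computable_sub n F G : computable n F -> computable n G ->
  computable n (fun e => F e - G e).
Proof.
move=> FP GP; apply: (computable_ext (G := fun e => nat_rect (fun=> nat) (F e) (fun _ r => r.-1) (G e))).
  by apply: computable_rec => //; apply/computable_pred/computable_var.
by move=> e; elim: (G e) => [|k IHk] /=; rewrite ?subn0 // subnS IHk.
Qed.

Definition bsum N (F : nat -> nat) := nat_rect (fun=> nat) 0 (fun i r => r + F i) N.

Lemma bsumE N F : bsum N F = \sum_(i < N) F i.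
Proof. by elim: N => [|N IHN]; rewrite ?big_ord0 // big_ord_recr -IHN. Qed.

Definition bprod N (F : nat -> nat) := nat_rect (fun=> nat) 1 (fun i r => r * F i) N.

Lemma bprodE N F : bprod N F = \prod_(i < N) F i.
Proof. by elim: N => [|N IHN]; rewrite ?big_ord0 // big_ord_recr -IHN. Qed.

(** Weakening: an idle variable is inserted at place [k]. *)
Lemma computable_skip n k F : computable (k + n) F ->
  computable (k + n.+1) (fun e => F (take k e ++ drop k.+1 e)).
Proof.
pose ix := iota 0 k ++ iota k.+1 n => FP.
have szI : size [seq (fun e => nth 0 e i) | i <- ix] = k + n.
  by rewrite size_map size_cat !size_iota.
have [|f fP] := computable_comp (n := k + n.+1) FP szI.
  move=> i lti; rewrite (nth_map 0) -?(size_map (fun i e => nth 0 e i)) ?szI //.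
  exact: computable_var.
exists f => xs szx; have := fP xs szx; congr computes; congr F.
rewrite -map_comp map_cat.
have lek : k <= size xs by rewrite szx leq_addr.
rewrite (map_nth_iota0 0 lek); congr (_ ++ _).
rewrite map_nth_iota; last by rewrite szx addnS subSS addKn.
by rewrite take_oversize // size_drop szx addnS subSS addKn.
Qed.

Lemma computable_skip_accumulator n (F : seq nat -> nat -> nat) :
  computable n.+1 (fun e => F (behead e) (nth 0 e 0)) ->
  computable n.+2 (fun e => F (behead (behead e)) (nth 0 e 0)).
Proof.
move=> /(@computable_skip n 1) FP; apply: (computable_ext FP).
by move=> -[|x [|y e]] //=; rewrite drop0.
Qed.

Lemma computable_bsum n N (F : seq nat -> nat -> nat) : computable n N ->
  computable n.+1 (fun e => F (behead e) (nth 0 e 0)) ->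
  computable n (fun e => bsum (N e) (F e)).
Proof.
move=> NP FP; apply: computable_rec => //; first exact: computable_const.
by apply: computable_add; [apply: computable_var|apply: computable_skip_accumulator].
Qed.

Lemma computable_mul n F G : computable n F -> computable n G ->
  computable n (fun e => F e * G e).
Proof.
move=> FP GP.
(* With [F e] and [G e] abstracted as variables, [F] need not be weakened under the recursion. *)
apply: (computable_ext (G := fun e => (fun x y => nat_rect (fun=> nat) 0 (fun _ r => r + x) y) (F e) (G e))).
  apply: (computable_comp2 (h := fun x y => nat_rect (fun=> nat) 0 (fun _ r => r + x) y)) => //.
  apply: (computable_rec (H := fun e _ r => r + nth 0 e 0)); [exact: computable_var|exact: computable_const|].
  by apply: computable_add; [apply: computable_var|normalize_env; apply: computable_var].
by move=> e; elim: (G e) => [|k IHk] /=; rewrite ?muln0 // mulnSr IHk.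
Qed.

Lemma computable_bprod n N (F : seq nat -> nat -> nat) : computable n N ->
  computable n.+1 (fun e => F (behead e) (nth 0 e 0)) ->
  computable n (fun e => bprod (N e) (F e)).
Proof.
move=> NP FP; apply: computable_rec => //; first exact: computable_const.
by apply: computable_mul; [apply: computable_var|apply: computable_skip_accumulator].
Qed.

Lemma computable_exp n F G : computable n F -> computable n G ->
  computable n (fun e => F e ^ G e).
Proof.
move=> FP GP; apply: (computable_ext (G := fun e => (fun x y => bprod y (fun=> x)) (F e) (G e))).
  apply: (computable_comp2 (h := fun x y => bprod y (fun=> x))) => //.
  apply: (computable_bprod (F := fun e _ => nth 0 e 0)); first exact: computable_var.
  by normalize_env; apply: computable_var.
by move=> e; elim: (G e) => [|k IHk] //=; rewrite expnSr IHk.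
Qed.

Lemma computable_iter n N A (h : seq nat -> nat -> nat) : computable n N -> computable n A ->
  computable n.+1 (fun e => h (behead e) (nth 0 e 0)) ->
  computable n (fun e => iter (N e) (h e) (A e)).
Proof.
move=> NP AP hP; apply: (computable_ext (G := fun e => nat_rect (fun=> nat) (A e) (fun _ r => h e r) (N e))).
  apply: (computable_rec (H := fun e _ r => h e r)) => //.
  have {}hP := @computable_skip n.+1 0 _ hP; apply: (computable_ext hP).
  by move=> -[|x [|y e]] //=; rewrite drop0.
by move=> e; elim: (N e) => //= k ->.
Qed.

Definition computableb n (B : seq nat -> bool) := computable n (fun e => B e : nat).

Lemma computableb_not n B : computableb n B -> computableb n (fun e => ~~ B e).
Proof.
move=> BP; apply: (computable_ext (computable_sub (computable_const n 1) BP)).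
by move=> e; case: (B e).
Qed.

Lemma computableb_and n B B' : computableb n B -> computableb n B' ->
  computableb n (fun e => B e && B' e).
Proof.
move=> BP B'P; apply: (computable_ext (computable_mul BP B'P)).
by move=> e; case: (B e); case: (B' e).
Qed.

Lemma computableb_or n B B' : computableb n B -> computableb n B' ->
  computableb n (fun e => B e || B' e).
Proof.
move=> /computableb_not BP /computableb_not B'P.
apply: (computable_ext (computableb_not (computableb_and BP B'P))).
by move=> e; rewrite negb_and !negbK.
Qed.

Lemma computableb_leq n F G : computable n F -> computable n G ->
  computableb n (fun e => F e <= G e).
Proof.
move=> FP GP; apply: (computable_ext (computable_sub (computable_const n 1) (computable_sub FP GP))).
by move=> e; rewrite -subn_eq0; case: (F e - G e).
Qed.

Lemma computableb_eq n F G : computable n F -> computable n G ->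
  computableb n (fun e => F e == G e).
Proof.
move=> FP GP; apply: (computable_ext (computableb_and (computableb_leq FP GP) (computableb_leq GP FP))).
by move=> e; rewrite eqn_leq.
Qed.

Lemma computableb_eqb n B B' : computableb n B -> computableb n B' ->
  computableb n (fun e => B e == B' e).
Proof.
move=> BP B'P; apply: (computable_ext (computableb_eq BP B'P)).
by move=> e; case: (B e); case: (B' e).
Qed.

Definition ball N (B : nat -> bool) := bsum N (fun i => ~~ B i) == 0.
Definition bex N (B : nat -> bool) := ~~ ball N (fun i => ~~ B i).

Lemma ballP N (B : nat -> bool) : reflect (forall i, i < N -> B i) (ball N B).
Proof.
rewrite /ball bsumE sum_nat_eq0; apply: (iffP forallP) => [all_B i lti|all_B i] /=.
  by have := all_B (Ordinal lti); rewrite /= eqb0 negbK.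
by rewrite eqb0 negbK all_B.
Qed.

Lemma bexP N (B : nat -> bool) : reflect (exists2 i, i < N & B i) (bex N B).
Proof.
apply: (iffP negP) => [nall|[i lti Bi] /ballP/(_ i lti)]; last by rewrite Bi.
apply: contrapT => none; apply: nall; apply/ballP => i lti; apply/negP => Bi.
by apply: none; exists i.
Qed.

Lemma computableb_all n N (B : seq nat -> nat -> bool) : computable n N ->
  computableb n.+1 (fun e => B (behead e) (nth 0 e 0)) ->
  computableb n (fun e => ball (N e) (B e)).
Proof.
move=> NP BP; apply: computableb_eq (computable_const _ _).
by apply: (computable_bsum (F := fun e i => ~~ B e i)) => //; apply: computableb_not.
Qed.

Lemma computableb_ex n N (B : seq nat -> nat -> bool) : computable n N ->
  computableb n.+1 (fun e => B (behead e) (nth 0 e 0)) ->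
  computableb n (fun e => bex (N e) (B e)).
Proof.
move=> NP BP; apply: computableb_not.
by apply: (computableb_all (B := fun e i => ~~ B e i)) => //; apply: computableb_not.
Qed.

End Arithmetic.

Create HintDb computability.

Ltac compute_application :=
  match goal with
  | |- computable _ (fun e => ?h (@?F e)) =>
      apply (@computable_comp1 _ h F); [solve [auto with computability] |]
  | |- computable _ (fun e => ?h (@?F e) (@?G e)) =>
      apply (@computable_comp2 _ h F G); [solve [auto with computability] | |]
  | |- computable _ (fun e => ?h (@?F e) (@?G e) (@?K e)) =>
      apply (@computable_comp3 _ h F G K); [solve [auto with computability] | | |]
  | |- computable _ (fun e => ?h (@?F e) (@?G e) (@?K e) (@?M e)) =>
      apply (@computable_comp4 _ h F G K M); [solve [auto with computability] | | | |]
  | |- computableb _ (fun e => ?h (@?F e) (@?G e)) =>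
      apply (@computable_comp2 _ (fun x y => nat_of_bool (h x y)) F G);
      [cbv beta; solve [auto with computability] | |]
  | |- computableb _ (fun e => ?h (@?F e) (@?G e) (@?K e)) =>
      apply (@computable_comp3 _ (fun x y z => nat_of_bool (h x y z)) F G K);
      [cbv beta; solve [auto with computability] | | |]
  end.

Ltac compute_step :=
  lazymatch goal with
  | |- computable _ (fun e => nth 0 e ?i) => apply computable_var
  | |- computable _ (fun e => (@?F e).+1) => apply (@computable_succ _ F)
  | |- computable _ (fun e => (@?F e).-1) => apply (@computable_pred _ F)
  | |- computable _ (fun e => @?F e + @?G e) => apply (@computable_add _ F G)
  | |- computable _ (fun e => @?F e - @?G e) => apply (@computable_sub _ F G)
  | |- computable _ (fun e => @?F e * @?G e) => apply (@computable_mul _ F G)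
  | |- computable _ (fun e => @?F e ^ @?G e) => apply (@computable_exp _ F G)
  | |- computable _ (fun e => bsum (@?N e) (@?F e)) =>
      apply (@computable_bsum _ N F); [|normalize_env]
  | |- computable _ (fun e => bprod (@?N e) (@?F e)) =>
      apply (@computable_bprod _ N F); [|normalize_env]
  | |- computable _ (fun e => iter (@?N e) (@?F e) (@?A e)) =>
      apply (@computable_iter _ N A F); [| |normalize_env]
  | |- computable ?n (fun e => nat_of_bool (@?B e)) => change (computableb n B)
  | |- computableb _ (fun e => ~~ @?B e) => apply (@computableb_not _ B)
  | |- computableb _ (fun e => @?B e && @?C e) => apply (@computableb_and _ B C)
  | |- computableb _ (fun e => @?B e || @?C e) => apply (@computableb_or _ B C)
  | |- computableb _ (fun e => @?F e <= @?G e) => apply (@computableb_leq _ F G)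
  | |- computableb _ (fun e => @eq_op _ (@?F e) (@?G e)) =>
      first [apply (@computableb_eq _ F G) | apply (@computableb_eqb _ F G)]
  | |- computableb _ (fun e => ball (@?N e) (@?B e)) =>
      apply (@computableb_all _ N B); [|unfold computableb; normalize_env]
  | |- computableb _ (fun e => bex (@?N e) (@?B e)) =>
      apply (@computableb_ex _ N B); [|unfold computableb; normalize_env]
  | _ => first [apply computable_const | compute_application]
  end.

Ltac computability := repeat compute_step.

(* quot is the quotient for d > 0 only. *)
Definition quot x d := bsum x (fun i => i.+1 * d <= x).
Definition remn x d := x - quot x d * d.
(* CodeSeq.code (n :: s) is 2 ^ n * (2 * CodeSeq.code s + 1). *)
Definition code_head k := bsum k (fun i => quot k (2 ^ i.+1) * 2 ^ i.+1 == k).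
Definition code_tail k := quot (quot k (2 ^ code_head k)) 2.
Definition code_nth k i := code_head (iter i code_tail k).
Definition code_size k := bsum k (fun i => ~~ (iter i code_tail k == 0)).
Definition digit m e i := remn (quot e (m ^ i)) m.

Lemma computable_quot : computable 2 (fun e => quot (nth 0 e 0) (nth 0 e 1)).
Proof. unfold quot; computability. Qed.
#[local] Hint Resolve computable_quot : computability.

Lemma computable_remn : computable 2 (fun e => remn (nth 0 e 0) (nth 0 e 1)).
Proof. unfold remn; computability. Qed.
#[local] Hint Resolve computable_remn : computability.

Lemma computable_code_head : computable 1 (fun e => code_head (nth 0 e 0)).
Proof. unfold code_head; computability. Qed.
#[local] Hint Resolve computable_code_head : computability.

Lemma computable_code_tail : computable 1 (fun e => code_tail (nth 0 e 0)).
Proof. unfold code_tail; computability. Qed.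
#[local] Hint Resolve computable_code_tail : computability.

Lemma computable_code_nth : computable 2 (fun e => code_nth (nth 0 e 0) (nth 0 e 1)).
Proof. unfold code_nth; computability. Qed.
#[local] Hint Resolve computable_code_nth : computability.

Lemma computable_code_size : computable 1 (fun e => code_size (nth 0 e 0)).
Proof. unfold code_size; computability. Qed.
#[local] Hint Resolve computable_code_size : computability.

Lemma computable_digit : computable 3 (fun e => digit (nth 0 e 0) (nth 0 e 1) (nth 0 e 2)).
Proof. unfold digit; computability. Qed.
#[local] Hint Resolve computable_digit : computability.

(* A number e < (n + 1) ^ n stands for the word of length n of its digits in
   base n + 1; p stands in the same way for a sequence of positions. *)
Definition cayley_check n e :=
  bex n.+1 (fun m => ball n (fun i => (0 < digit n.+1 e i) && (digit n.+1 e i <= m)) &&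
    ball m (fun v => bex n (fun i => digit n.+1 e i == v.+1))).

Definition positions_check n l p := ball l (fun i => (digit n.+1 p i < n) &&
  (~~ (i.+1 < l) || (digit n.+1 p i < digit n.+1 p i.+1))).

Definition pattern_check n e b p := ball (code_size b) (fun i => ball (code_size b) (fun j =>
  (code_nth b i <= code_nth b j) ==
  (digit n.+1 e (digit n.+1 p i) <= digit n.+1 e (digit n.+1 p j)))).

Definition contained_check n e b := bex (n.+1 ^ code_size b) (fun p =>
  positions_check n (code_size b) p && pattern_check n e b p).

Definition class_check n e b := cayley_check n e &&
  ball (code_size b) (fun j => ~~ contained_check n e (code_nth b j)).

Definition class_count b n := bsum (n.+1 ^ n) (fun e => class_check n e b).

(** The coefficient of $x^n$ in $G^k$ as a sum over [k]-tuples of exponents at most [n], each tuple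
    being the digits of [e] in base [n.+1]. *)
Definition power_coef b k n := bsum (n.+1 ^ k) (fun e =>
  (bsum k (fun i => digit n.+1 e i) == n) * bprod k (fun i => class_count b (digit n.+1 e i))).

(* Coefficient of x^n in q(x, G(x)) when only the entry side of each coefficient
   code of q is read: 0 for the positive parts and 1 for the negative ones. *)
Definition half_coef b y side n := bsum y (fun k => bsum n.+1 (fun i =>
  code_nth (code_nth (code_nth y k) i) side * power_coef b k (n - i))).

(* The entry 2 is the denominator minus one: only integer polynomials pass. *)
Definition polynomial_check y :=
  bex y (fun k => bex y (fun i => ~~ (code_nth (code_nth (code_nth y k) i) 0 ==
     code_nth (code_nth (code_nth y k) i) 1))) &&
  ball y (fun k => ball y (fun i => code_nth (code_nth (code_nth y k) i) 2 == 0)).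

(** The number of words of length at most [b] with letters from 0 to [b] ([size_small_words]). *)
Definition pattern_count b := bsum b.+1 (fun k => b.+1 ^ k).

(* A code bounds the length of the list that it codes and its entries, so s, b
   and y themselves serve as bounds. *)
Definition order_bound y s b :=
  let D := closure_bound (pattern_count b) s s in D * (y * (y + y * D)).

Definition annihilation_check y s b := polynomial_check y &&
  ball (order_bound y s b).+1 (fun n => half_coef b y 0 n == half_coef b y 1 n).

Lemma computable_cayley_check : computable 2 (fun e => cayley_check (nth 0 e 0) (nth 0 e 1)).
Proof. unfold cayley_check; computability. Qed.
#[local] Hint Resolve computable_cayley_check : computability.

Lemma computable_contained_check :
  computable 3 (fun e => contained_check (nth 0 e 0) (nth 0 e 1) (nth 0 e 2)).
Proof. unfold contained_check, positions_check, pattern_check; computability. Qed.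
#[local] Hint Resolve computable_contained_check : computability.

Lemma computable_class_count : computable 2 (fun e => class_count (nth 0 e 0) (nth 0 e 1)).
Proof. unfold class_count, class_check; computability. Qed.
#[local] Hint Resolve computable_class_count : computability.

Lemma computable_power_coef :
  computable 3 (fun e => power_coef (nth 0 e 0) (nth 0 e 1) (nth 0 e 2)).
Proof. unfold power_coef; computability. Qed.
#[local] Hint Resolve computable_power_coef : computability.

Lemma computable_system_step_bound : computable 4 (fun e =>
  system_step_bound (nth 0 e 0) (nth 0 e 1) (nth 0 e 2) (nth 0 e 3)).
Proof. unfold system_step_bound, extension_bound; cbv zeta; computability. Qed.
#[local] Hint Resolve computable_system_step_bound : computability.

Lemma computable_half_coef : computable 4 (fun e =>
  half_coef (nth 0 e 0) (nth 0 e 1) (nth 0 e 2) (nth 0 e 3)).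
Proof. unfold half_coef; computability. Qed.
#[local] Hint Resolve computable_half_coef : computability.

Lemma computable_order_bound : computable 3 (fun e =>
  order_bound (nth 0 e 0) (nth 0 e 1) (nth 0 e 2)).
Proof.
unfold order_bound, closure_bound, system_bound, pattern_count; cbv zeta; computability.
Qed.
#[local] Hint Resolve computable_order_bound : computability.

Lemma computable_annihilation_check : computable 3 (fun e =>
  annihilation_check (nth 0 e 0) (nth 0 e 1) (nth 0 e 2)).
Proof.
unfold annihilation_check, polynomial_check; computability.
Qed.

(** * Correctness of the decoding and of the tests on words *)

Section CodeCorrectness.

(** Quotients, valuations and sizes are programmed as counts of the [i] below a bound that satisfy a
    condition equivalent to [i < m]. *)
Lemma sum_indicator_lt N m : m <= N -> \sum_(i < N) (i < m : nat) = m.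
Proof.
move=> lemN; rewrite -(big_mkord xpredT (fun i => (i < m : nat))) (big_cat_nat _ (n := m)) //=.
rewrite big_nat (eq_bigr (fun=> 1)) => [|i /andP[_ ->]//].
rewrite -big_nat sum_nat_const_nat subn0 muln1 big_nat big1 ?addn0 //.
by move=> i /andP[lemi _]; rewrite ltnNge lemi.
Qed.

Lemma quotE x d : 0 < d -> quot x d = x %/ d.
Proof.
move=> d_gt0; rewrite /quot bsumE -[RHS](@sum_indicator_lt x); last exact: leq_div.
by apply: eq_bigr => i _; rewrite leq_divRL.
Qed.

Lemma remnE x d : 0 < d -> remn x d = x %% d.
Proof. by move=> d_gt0; rewrite /remn quotE // {1}(divn_eq x d) addnC addnK. Qed.

Lemma digitE m e i : 0 < m -> digit m e i = (e %/ m ^ i) %% m.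
Proof. by move=> m_gt0; rewrite /digit remnE // quotE // expn_gt0 m_gt0. Qed.

Lemma code_head_cons n s : code_head (CodeSeq.code (n :: s)) = n.
Proof.
rewrite /code_head bsumE /=; set m := (CodeSeq.code s).*2.+1; set k := 2 ^ n * m.
have lenk : n <= k by rewrite (leq_trans (ltnW (ltn_expl n (isT : 1 < 2)))) // leq_pmulr.
rewrite -[RHS](sum_indicator_lt lenk); apply: eq_bigr => i _; congr nat_of_bool.
rewrite quotE ?expn_gt0 // -/(2 ^ i.+1 %| k) -dvdn_eq.
have odd_m : odd m by rewrite /m /= odd_double.
apply/idP/idP => [|ltin]; last by rewrite dvdn_mulr // dvdn_exp2l.
rewrite /k Gauss_dvdl; first by rewrite dvdn_Pexp2l.
by rewrite coprimeXl // coprime2n.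
Qed.

Lemma code_tail_cons n s : code_tail (CodeSeq.code (n :: s)) = CodeSeq.code s.
Proof.
rewrite /code_tail code_head_cons !quotE ?expn_gt0 //= mulKn ?expn_gt0 //.
by rewrite divn2 /= uphalf_double.
Qed.

Lemma iter_code_tail s i : iter i code_tail (CodeSeq.code s) = CodeSeq.code (drop i s).
Proof.
elim: i s => [|i IHi] s; first by rewrite drop0.
case: s => [|n s]; last by rewrite iterSr code_tail_cons IHi.
by rewrite iterSr /= -[code_tail 0]/(CodeSeq.code [::]) IHi; case: (i).
Qed.

Lemma code_nthE k i : code_nth k i = nth 0 (CodeSeq.decode k) i.
Proof.
rewrite /code_nth -{1}[k]CodeSeq.decodeK iter_code_tail.
have [lti|lei] := ltnP i (size (CodeSeq.decode k)).
  by rewrite (drop_nth 0) // code_head_cons.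
by rewrite drop_oversize // nth_default.
Qed.

Lemma size_code s : size s <= CodeSeq.code s.
Proof.
elim: s => //= n s IHs; rewrite -[(size s).+1]mul1n leq_mul ?expn_gt0 // ltnS -addnn.
exact: leq_trans IHs (leq_addl _ _).
Qed.

Lemma size_decode k : size (CodeSeq.decode k) <= k.
Proof. by rewrite -[leqRHS]CodeSeq.decodeK size_code. Qed.

Lemma code_sizeE k : code_size k = size (CodeSeq.decode k).
Proof.
rewrite /code_size bsumE -[RHS](sum_indicator_lt (size_decode k)).
apply: eq_bigr => i _; congr nat_of_bool; rewrite -[X in iter _ _ X]CodeSeq.decodeK iter_code_tail.
have [lti|lei] := ltnP i (size (CodeSeq.decode k)); last by rewrite drop_oversize.
by rewrite (drop_nth 0) //= muln_eq0 expn_eq0.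
Qed.

Definition digits m n e := mkseq (digit m e) n.

Lemma digits_surj m n l : l \in lists (iota 0 m) n -> exists2 e, e < m ^ n & digits m n e = l.
Proof.
elim: n l => [|n IHn] l; first by rewrite mem_seq1 => /eqP->; exists 0.
move=> /= /allpairsP[[a l'] [/= + /IHn[e lte <-] ->]]; rewrite mem_iota => /= ltam.
have m_gt0 : 0 < m by apply: leq_ltn_trans ltam.
exists (e * m + a).
  rewrite expnSr (@leq_trans (e * m + m)) // ?ltn_add2l // -mulSnr leq_mul2r lte orbT //.
rewrite /digits /mkseq /= digitE // expn0 divn1 modnMDl modn_small //; congr cons.
rewrite -[1]addn0 iotaDl -map_comp; apply: eq_map => i /=.
by rewrite !digitE // add1n expnS divnMA divnMDl // [a %/ m]divn_small // addn0.
Qed.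

(** Digits reach all the lists and both sides have [m ^ n] members, so the enumeration is without
    repetition. *)
Lemma perm_digits m n : 0 < m ->
  perm_eq (lists (iota 0 m) n) [seq digits m n e | e <- iota 0 (m ^ n)].
Proof.
move=> m_gt0; have sub : {subset lists (iota 0 m) n <= [seq digits m n e | e <- iota 0 (m ^ n)]}.
  by move=> l /digits_surj[e lte <-]; apply: map_f; rewrite mem_iota.
have ul : uniq (lists (iota 0 m) n) by apply/uniq_lists/iota_uniq.
have sz : size [seq digits m n e | e <- iota 0 (m ^ n)] <= size (lists (iota 0 m) n).
  by rewrite size_map size_lists !size_iota.
have [szE eqi] := uniq_min_size ul sub sz.
apply: uniq_perm => //; exact: leq_size_uniq ul sub sz.
Qed.

Lemma sum_digits m n (F : seq nat -> nat) : 0 < m ->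
  \sum_(e < m ^ n) F (digits m n e) = \sum_(l <- lists (iota 0 m) n) F l.
Proof.
move=> m_gt0; by rewrite (perm_big _ (perm_digits n m_gt0)) big_map big_iota.
Qed.

Lemma nth_digits m n e i : i < n -> nth 0 (digits m n e) i = digit m e i.
Proof. exact: nth_mkseq. Qed.

Lemma cayley_checkP n e : reflect (cayley (digits n.+1 n e)) (cayley_check n e).
Proof.
set w := digits _ _ _; have szw : size w = n by rewrite size_mkseq.
have wE i : i < n -> digit n.+1 e i = nth 0 w i by move=> lti; rewrite nth_digits.
apply: (iffP (bexP _ _)) => [[m ltm /andP[/ballP rng /ballP onto]]|[m lem wm]].
  exists m; first by rewrite szw -ltnS.
  move=> x; rewrite mem_iota add1n ltnS; apply/idP/idP => [|/andP[x_gt0 lexm]].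
    by move=> /(nthP 0)[i]; rewrite szw => lti <-; rewrite -wE // rng.
  have /bexP[i lti /eqP] : bex n (fun i => digit n.+1 e i == x.-1.+1) by apply: onto; rewrite prednK.
  by rewrite prednK // wE // => <-; rewrite mem_nth ?szw.
exists m; first by rewrite ltnS -szw.
apply/andP; split.
  apply/ballP => i lti; rewrite wE //.
  have : nth 0 w i \in w by rewrite mem_nth ?szw.
  by rewrite wm mem_iota add1n ltnS.
apply/ballP => v ltv; have : v.+1 \in w by rewrite wm mem_iota add1n ltnS.
by move=> /(nthP 0)[i]; rewrite szw => lti wi; apply/bexP; exists i; rewrite ?wE ?wi.
Qed.

Lemma subseq_positions (u w : seq nat) : subseq u w <-> exists ps : seq nat,
  [/\ size ps = size u, all (gtn (size w)) ps, sorted ltn ps & u = [seq nth 0 w i | i <- ps]].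
Proof.
have wE : w = [seq nth 0 w i | i <- iota 0 (size w)] by rewrite [RHS]mkseq_nth.
split=> [/subseqP[m szm uE]|[ps [_ /allP lt_ps sps ->]]].
  have sub := mask_subseq m (iota 0 (size w)).
  have uE' : u = [seq nth 0 w i | i <- mask m (iota 0 (size w))] by rewrite map_mask -wE.
  exists (mask m (iota 0 (size w))); split=> //; first by rewrite [in RHS]uE' size_map.
    by apply/allP => i /(mem_subseq sub); rewrite mem_iota.
  exact: (subseq_sorted ltn_trans sub (iota_ltn_sorted _ _)).
rewrite [X in subseq _ X]wE; apply: map_subseq.
have -> : ps = [seq i <- iota 0 (size w) | i \in ps]; last exact: filter_subseq.
apply: (irr_sorted_eq ltn_trans ltnn) => //.
  exact: (sorted_filter ltn_trans _ (iota_ltn_sorted _ _)).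
move=> i; rewrite mem_filter mem_iota; apply/idP/andP => [pi|[]//].
by split=> //; apply: lt_ps.
Qed.

Lemma contained_checkP n e b : cayley (CodeSeq.decode b) ->
  reflect (contained (CodeSeq.decode b) (digits n.+1 n e)) (contained_check n e b).
Proof.
set w := digits _ _ _; set t := CodeSeq.decode b => ct.
have szw : size w = n by rewrite size_mkseq.
have wE i : i < n -> digit n.+1 e i = nth 0 w i by move=> lti; rewrite nth_digits.
rewrite /contained_check /positions_check /pattern_check code_sizeE -/t.
apply: (iffP (bexP _ _)) => [[p _ /andP[/ballP pos /ballP pat]]|].
  apply/(contained_oiso _ ct); pose ps := digits n.+1 (size t) p.
  have psE i : i < size t -> digit n.+1 p i = nth 0 ps i by move=> lti; rewrite nth_digits.
  have szps : size ps = size t by rewrite size_mkseq.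
  have ps_lt i : i < size t -> nth 0 ps i < n by move=> lti; have /andP[] := pos i lti; rewrite psE.
  exists [seq nth 0 w i | i <- ps].
    apply/subseq_positions; exists ps; split=> //; first by rewrite size_map.
      by apply/(all_nthP 0) => i; rewrite szps szw => /ps_lt.
    apply/(sortedP 0) => i; rewrite szps => lti1; have lti := ltnW lti1.
    by have /andP[_] := pos i lti; rewrite lti1 /= !psE.
  split=> [|i j]; rewrite size_map szps // => lti ltj.
  have /ballP/(_ j ltj)/eqP := pat i lti.
  rewrite !code_nthE -/t !psE // !wE ?ps_lt // => ->.
  by rewrite (nth_map 0 0 (nth 0 w) (s := ps)) ?szps // (nth_map 0 0 (nth 0 w) (s := ps)) ?szps.
move=> /(contained_oiso _ ct)[u /subseq_positions[ps [szps lt_ps sps uE]] [szu ord]].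
have szt : size ps = size t by rewrite szps.
have ps_lt i : i < size t -> nth 0 ps i < n.
  by move=> lti; have /(all_nthP 0) := lt_ps; rewrite szw => /(_ i); rewrite szt; apply.
have [|p ltp pE] := @digits_surj n.+1 (size t) ps.
  rewrite mem_lists szt eqxx; apply/(all_nthP 0) => i; rewrite szt => lti.
  by rewrite -[mem _ _]/(_ \in iota 0 n.+1) mem_iota /= ltnS ltnW ?ps_lt.
have psE i : i < size t -> digit n.+1 p i = nth 0 ps i.
  by move=> lti; rewrite -pE nth_digits.
exists p => //; apply/andP; split.
  apply/ballP => i lti; rewrite (psE i) // ps_lt //=; case: ltnP => //= lti1.
  by rewrite psE //; move/(sortedP 0): sps; apply; rewrite szt.
apply/ballP => i lti; apply/ballP => j ltj; apply/eqP.
rewrite !code_nthE -/t !psE // !wE ?ps_lt // -ord ?szu //.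
by rewrite uE (nth_map 0 0 (nth 0 w) (s := ps)) ?szt // (nth_map 0 0 (nth 0 w) (s := ps)) ?szt.
Qed.

End CodeCorrectness.

(** * Coefficients and polynomials computed from codes *)

Section SeriesCodes.
Local Open Scope ring_scope.
Variables (C : set word) (b : nat).
Hypothesis b_cayley : forall j, (j < size (CodeSeq.decode b))%N ->
  cayley (CodeSeq.decode (nth 0%N (CodeSeq.decode b) j)).
Hypothesis C_avoid : forall w, C w <-> cayley w /\ forall j,
  (j < size (CodeSeq.decode b))%N ->
  ~ contained (CodeSeq.decode (nth 0%N (CodeSeq.decode b) j)) w.

Lemma class_checkE n e : class_check n e b = `[< C (digits n.+1 n e) >].
Proof.
apply/andP/asboolP => [[/cayley_checkP cw /ballP av]|/C_avoid[cw av]].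
  apply/C_avoid; split=> // j ltj con.
  have := av j; rewrite code_sizeE code_nthE => /(_ ltj) /negP; apply.
  by apply/contained_checkP => //; apply: b_cayley.
split; first exact/cayley_checkP.
apply/ballP => j; rewrite code_sizeE => ltj; rewrite code_nthE; apply/negP.
by move=> /(contained_checkP _ _ (b_cayley ltj)); apply: av.
Qed.

Lemma class_countE n : (class_count b n)%:R = gen_fun C n.
Proof.
rewrite gen_funE /word_gf; congr (_%:R); rewrite /class_count bsumE.
under eq_bigr do rewrite class_checkE.
by rewrite (sum_digits n (fun w => `[< C w >] : nat)) // -sum1_count [RHS]big_mkcond /=;
  by apply: eq_bigr => w _; case: `[< C w >].
Qed.

(** Leaving [m] free, instead of [n.+1], lets the induction on [k] lower [n] with the same range of
    exponents. *)
Lemma exp_series_lists (c : nat -> nat) k n m : (n < m)%N ->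
  exp_series (fun i => (c i)%:R) k n =
  (\sum_(l <- lists (iota 0 m) k) (sumn l == n) * \prod_(a <- l) c a)%N%:R.
Proof.
elim: k n => [|k IHk] n ltnm.
  by rewrite big_seq1 big_nil muln1 /= /one_series eq_sym.
rewrite /= /mul_series.
have -> : (\sum_(l <- [seq a :: l | a <- iota 0 m, l <- lists (iota 0 m) k])
      (sumn l == n) * \prod_(a <- l) c a =
    \sum_(a < m) \sum_(l <- lists (iota 0 m) k) (a + sumn l == n) * (c a * \prod_(a <- l) c a))%N.
  rewrite big_allpairs_dep -[RHS](big_iota _ _ _ (fun a => \sum_(l <- lists (iota 0 m) k)
    (a + sumn l == n) * (c a * \prod_(a <- l) c a))%N).
  by apply: eq_bigr => a _; apply: eq_bigr => l _; rewrite big_cons.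
rewrite natr_sum (big_ord_widen m (fun i => (c i)%:R * exp_series (fun i => (c i)%:R) k (n - i)%N)) //.
rewrite [LHS]big_mkcond; apply: eq_bigr => a _; case: ltnP => [lea|lta].
  rewrite IHk; last by lia.
  rewrite -natrM big_distrr; congr (_%:R); apply: eq_bigr => l _ /=.
  rewrite mulnCA; congr (_ * _)%N; congr nat_of_bool.
  by rewrite -(eqn_add2l a) subnKC.
rewrite big1 // => l _; case: eqP => [e|_]; last by rewrite mul0n.
by exfalso; lia.
Qed.

Lemma power_coefE k n : (power_coef b k n)%:R = exp_series (gen_fun C) k n.
Proof.
have -> : gen_fun C = (fun i => (class_count b i)%:R) :> series.
  by apply/funext => i; rewrite class_countE.
rewrite (exp_series_lists _ _ (ltnSn n)) -sum_digits // /power_coef bsumE; congr (_%:R).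
apply: eq_bigr => e _; rewrite bsumE bprodE; congr (_ * _)%N.
  by rewrite sumnE big_map big_iota.
by rewrite big_map big_iota.
Qed.

Lemma poly_of_code0 : poly_of_code 0 = 0.
Proof. by apply/eqP; rewrite -size_poly_leq0; apply: size_Poly. Qed.

Lemma rat_of_code0 : rat_of_code 0 = 0.
Proof. by rewrite /rat_of_code /= subrr mul0r. Qed.

Lemma coef_bipoly_of_code y k : (bipoly_of_code y)`_k = poly_of_code (code_nth y k).
Proof.
rewrite /bipoly_of_code coef_Poly code_nthE; have [ltk|lek] := ltnP k (size (CodeSeq.decode y)).
  by rewrite (nth_map 0%N).
by rewrite !nth_default ?size_map ?poly_of_code0.
Qed.

Lemma coef_poly_of_code y k : (poly_of_code y)`_k = rat_of_code (code_nth y k).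
Proof.
rewrite /poly_of_code coef_Poly code_nthE; have [ltk|lek] := ltnP k (size (CodeSeq.decode y)).
  by rewrite (nth_map 0%N).
by rewrite !nth_default ?size_map ?rat_of_code0.
Qed.

Lemma size_bipoly_of_code y : (size (bipoly_of_code y) <= y)%N.
Proof. by apply: leq_trans (size_Poly _) _; rewrite size_map size_decode. Qed.

Lemma size_poly_of_code y : (size (poly_of_code y) <= y)%N.
Proof. by apply: leq_trans (size_Poly _) _; rewrite size_map size_decode. Qed.

Lemma code_nth_le y k : (code_nth y k <= y)%N.
Proof.
rewrite code_nthE; have [ltk|lek] := ltnP k (size (CodeSeq.decode y)).
  by have /allP := CodeSeq.gtn_decode y => /(_ _ (mem_nth 0%N ltk)) /ltnW.
by rewrite nth_default.
Qed.

Lemma code_nth_gt y k : (y <= k)%N -> code_nth y k = 0%N.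
Proof. by move=> leyk; rewrite code_nthE nth_default // (leq_trans (size_decode y)). Qed.

Lemma subst_bipoly_of_code y n :
  (forall k i, code_nth (code_nth (code_nth y k) i) 2 = 0%N) ->
  subst_series (bipoly_of_code y) (gen_fun C) n =
  (half_coef b y 0 n)%:R - (half_coef b y 1 n)%:R.
Proof.
move=> den0; have ratE k i : (bipoly_of_code y)`_k`_i =
    (code_nth (code_nth (code_nth y k) i) 0)%:R - (code_nth (code_nth (code_nth y k) i) 1)%:R.
  rewrite coef_bipoly_of_code coef_poly_of_code /rat_of_code -!code_nthE den0.
  by rewrite divr1.
rewrite subst_seriesE (horner_coef_wide _ (leq_trans (size_poly _ _) (size_bipoly_of_code y))).
rewrite series_sum /half_coef !bsumE !natr_sum -sumrB; apply: eq_bigr => k _.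
rewrite !bsumE !natr_sum -sumrB coef_map seriesM; apply: eq_bigr => i _.
by rewrite !natrM power_coefE exp_seriesE -mulrBl -ratE.
Qed.

Lemma polynomial_checkP y : polynomial_check y ->
  bipoly_of_code y != 0 /\ forall k i, code_nth (code_nth (code_nth y k) i) 2 = 0%N.
Proof.
move=> /andP[/bexP[k ltk /bexP[i lti nz]] /ballP den0].
have den k' i' : code_nth (code_nth (code_nth y k') i') 2 = 0%N.
  have [ltk'|lek'] := ltnP k' y; last by rewrite (code_nth_gt lek') !code_nthE !nth_nil.
  have [lti'|lei'] := ltnP i' y; first by have /ballP/(_ i' lti')/eqP := den0 k' ltk'.
  by rewrite [code_nth _ i']code_nth_gt ?(leq_trans (code_nth_le _ _)) // code_nthE nth_nil.
split=> //; apply: contraNneq nz => q0.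
have := congr1 (fun q : {poly {poly rat}} => q`_k`_i) q0.
rewrite /= coef_bipoly_of_code coef_poly_of_code !coef0 /rat_of_code -!code_nthE den divr1.
by move=> /eqP; rewrite subr_eq0 Num.Theory.eqr_nat.
Qed.

Lemma annihilates_scale (q : {poly {poly rat}}) (r : rat) f :
  annihilates q f -> annihilates (r%:P *: q) f.
Proof.
move=> /annihilatesE qf; apply/annihilatesE.
by rewrite -mul_polyC rmorphM /= map_polyC hornerM qf mulr0.
Qed.

(** The search accepts integer polynomials only; the product of all the denominators brings an
    annihilator among them. *)
Lemma integral_multiple (q : {poly {poly rat}}) : q != 0 ->
  exists2 r : rat, r != 0 & forall k i, exists z : int, (r%:P *: q)`_k`_i = z%:~R.
Proof.
move=> nzq.
pose d k i := denq (q`_k`_i).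
(* One bound for the degrees in $x$ of all the coefficients. *)
pose N := (\sum_(k < size q) size (q`_k)%R)%N.
pose D : int := \prod_(k < size q) \prod_(i < N) d k i.
exists D%:~R.
  by rewrite intr_eq0; apply/prodf_neq0 => k _; apply/prodf_neq0 => i _; apply: denq_neq0.
move=> k i; rewrite coefZ coefCM.
have [ltk|lek] := ltnP k (size q); last by exists 0; rewrite [q`_k]nth_default // coef0 mulr0.
have [lti|lei] := ltnP i N; last first.
  exists 0; rewrite [q`_k`_i]nth_default ?mulr0 //; apply: leq_trans lei.
  by rewrite /N (bigD1 (Ordinal ltk)) //= leq_addr.
rewrite /D (bigD1 (Ordinal ltk)) //= (bigD1 (Ordinal lti)) //=.
set A := \prod_(_ < N | _) _; set B := \prod_(_ < size q | _) _.
exists (numq q`_k`_i * A * B); rewrite !rmorphM /= -/(d k i).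
rewrite -[q`_k`_i in LHS]divq_num_den -/(d k i).
have nzd : (d k i)%:~R != 0 :> rat by rewrite intr_eq0 denq_neq0.
by field.
Qed.

Lemma polynomial_check_code (q : {poly {poly rat}}) : q != 0 ->
  (forall k i, exists z : int, q`_k`_i = z%:~R) ->
  exists2 y, polynomial_check y & bipoly_of_code y = q.
Proof.
move=> nzq qz.
have /choice[z zE] (p : nat * nat) : exists z : int, q`_(p.1)`_(p.2) = z%:~R by apply: qz.
(* The first two entries are read as a difference, so the absolute value of a negative integer goes
   second. *)
pose code_int (z : int) := CodeSeq.code (if z is Posz n then [:: n; 0%N] else [:: 0%N; `|z|%N]).
have nth_int (x : int) i : code_nth (code_int x) i =
   nth 0%N (if x is Posz n then [:: n; 0%N] else [:: 0%N; `|x|%N]) i.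
  by rewrite code_nthE CodeSeq.codeK.
pose cs k := [seq code_int (z (k, i)) | i <- iota 0 (size q`_k)].
pose y := CodeSeq.code [seq CodeSeq.code (cs k) | k <- iota 0 (size q)].
have yE k : code_nth y k = if (k < size q)%N then CodeSeq.code (cs k) else 0%N.
  rewrite code_nthE CodeSeq.codeK; case: ltnP => [ltk|lek].
    by rewrite (nth_map 0%N) ?size_iota // nth_iota.
  by rewrite nth_default // size_map size_iota.
have ykE k i : code_nth (code_nth y k) i =
    if (i < size (q`_k)%R)%N then code_int (z (k, i)) else 0%N.
  rewrite yE; case: ltnP => [ltk|lek]; last first.
    by rewrite [q`_k]nth_default // size_poly0 code_nthE nth_nil.
  rewrite code_nthE CodeSeq.codeK; case: ltnP => [lti|lei].
    by rewrite (nth_map 0%N) ?size_iota // nth_iota.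
  by rewrite nth_default // size_map size_iota.
have den0 k i : code_nth (code_nth (code_nth y k) i) 2 = 0%N.
  rewrite ykE; case: ifP => _; last by rewrite code_nthE nth_nil.
  by rewrite nth_int; case: (z _).
have ratE k i : rat_of_code (code_nth (code_nth y k) i) = q`_k`_i.
  rewrite ykE; case: ltnP => [lti|lei]; last by rewrite rat_of_code0 nth_default.
  rewrite (zE (k, i)) /rat_of_code -!code_nthE !nth_int.
  by case: (z _) => m /=; rewrite ?subr0 ?divr1 // NegzE sub0r rmorphN.
have qE : bipoly_of_code y = q.
  apply/polyP => k; apply/polyP => i.
  by rewrite coef_bipoly_of_code coef_poly_of_code ratE.
exists y => //; apply/andP; split; last first.
  by apply/ballP => k _; apply/ballP => i _; rewrite den0.
have [k nzk] : exists k, q`_k != 0.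
  by exists (size q).-1; rewrite -[q`__]/(lead_coef q) lead_coef_eq0.
have [i nzi] : exists i, q`_k`_i != 0.
  by exists (size q`_k).-1; rewrite -[q`_k`__]/(lead_coef q`_k) lead_coef_eq0.
(* The check looks below [y] only, which is enough: beyond [y] every entry read from the code is
   0. *)
have ltk : (k < y)%N.
  by rewrite ltnNge; apply: contraNN nzk => /code_nth_gt e; rewrite -qE coef_bipoly_of_code e poly_of_code0.
have lti : (i < y)%N.
  rewrite ltnNge; apply: contraNN nzi => leyi.
  rewrite -ratE [code_nth _ i]code_nth_gt ?rat_of_code0 //.
  exact: leq_trans (code_nth_le _ _) leyi.
apply/bexP; exists k => //; apply/bexP; exists i => //.
apply: contraNN nzi => /eqP e; rewrite -ratE /rat_of_code -!code_nthE e subrr mul0r //.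
Qed.

End SeriesCodes.

(** * Algebraicity and the algorithm *)

Section Algebraicity.
Local Open Scope ring_scope.

(** The order is the degree bound of [norm_multiple] for $q(x,f)$, itself bounded through
    [bounded_horner]. If $q(x,f)$ vanishes up to there, so does its multiple [m], a polynomial of at
    most that degree. *)
Lemma annihilates_to_order D v f y (q : {poly {poly rat}}) :
  has (fun g => g != 0) v -> (size v <= D)%N -> bounded D v f ->
  (size q <= y)%N -> (forall i, (size (q`_i)%R <= y.+1)%N) ->
  (forall n, (n <= D * (y * (y + y * D)))%N -> subst_series q f n = 0) ->
  annihilates q f.
Proof.
move=> nzv szv bf szq szc order0; apply/annihilatesE; apply/eqP; apply: contraT => nzqf.
have [b _ [m /andP[nzm szm] mE]] :=
  norm_multiple nzv nzqf (bounded_horner szq szc bf).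
case/eqP: nzm; apply/polyP => n; rewrite coef0.
have [ltn|len] := ltnP n (size m); last by rewrite nth_default.
have := congr1 (fun g : series => g n) mE; rewrite /= {1}/series_of_poly => ->.
rewrite seriesM big1 // => i _; rewrite -subst_seriesE order0 ?mulr0 //.
have len : (n <= size v * (y * (y + y * D)))%N by rewrite -ltnS (leq_trans ltn).
apply: leq_trans (leq_subr _ _) (leq_trans len _).
by rewrite leq_mul2r szv orbT.
Qed.

(** A list of patterns that contains every Cayley permutation of length at most [b], is closed under
    standardized factors and has a computable length. *)
Definition small_words b : seq word :=
  flatten [seq lists (iota 0 b.+1) k | k <- iota 0 b.+1].

Lemma mem_small_words b (w : word) :
  (w \in small_words b) = (size w <= b)%N && all (fun x => x <= b)%N w.
Proof.
have memE k : (w \in lists (iota 0 b.+1) k) = (size w == k) && all (fun x => x <= b)%N w.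
  rewrite mem_lists; congr (_ && _); apply: eq_all => x.
  by rewrite -[mem _ _]/(x \in iota 0 b.+1) mem_iota.
apply/flatten_mapP/andP => [[k]|[lew aw]].
  by rewrite mem_iota memE => /= ltk /andP[/eqP-> ->].
by exists (size w); rewrite ?mem_iota // memE eqxx.
Qed.

Lemma size_small_words b : size (small_words b) = pattern_count b.
Proof.
rewrite size_flatten /shape -map_comp sumnE big_map /pattern_count bsumE.
by rewrite big_iota; apply: eq_bigr => k _; rewrite /comp size_lists size_iota.
Qed.

Lemma small_cayley b w : cayley w -> (size w <= b)%N -> w \in small_words b.
Proof.
move=> cw lew; rewrite mem_small_words lew; apply/allP => x /(cayley_letter cw)/andP[_ lex].
exact: leq_trans lex lew.
Qed.

Lemma small_words_factor b (A B D : word) : A ++ B ++ D \in small_words b -> st B \in small_words b.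
Proof.
rewrite (mem_small_words b (A ++ B ++ D)) !size_cat => /andP[le _].
apply: small_cayley; first exact: cayley_st.
by rewrite size_st; apply: leq_trans le; rewrite addnCA leq_addr.
Qed.

Variable C : set word.
Hypothesis C_class : cayley_class C.

Section Simples.
Variable S : seq word.
Hypothesis SE : forall w, w \in S <-> simples C w.

Lemma class_simple s : s \in S -> simple_cayley s. Proof. by move=> /SE[]. Qed.

Lemma class_simple_closed s t :
  s \in S -> simple_cayley t -> contained t s -> t \in S.
Proof.
move=> /SE[Cs _] simt cts; have [_ Cd] := C_class; apply/SE; split=> //.
by apply: (Cd t s _ cts Cs); case: simt.
Qed.

Lemma class_in_closure w : C w -> in_closure S w.
Proof.
move=> Cw; have [Cc Cd] := C_class; split; first exact: Cc.
move=> t simt ctw; apply/SE; split=> //; apply: (Cd t w _ ctw Cw); by case: simt.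
Qed.

Lemma class_bounded (B : word -> Prop) b s :
  (size S <= s)%N -> (forall w, w \in S -> (size w <= s)%N) ->
  (forall w, B w -> cayley w /\ (size w <= b)%N) ->
  (forall w, C w <-> in_closure S w /\ forall t, B t -> ~ contained t w) ->
  let D := closure_bound (pattern_count b) s s in
  exists v : seq series, [/\ has (fun g => g != 0) v, (size v <= D)%N &
    bounded D v (gen_fun C)].
Proof.
move=> szS leS Bb CE; rewrite -size_small_words.
have [|v [nzv szv bv]] := closure_avoiding_bounded class_simple class_simple_closed
  (@small_words_factor b) szS leS (B := B).
  by move=> w /Bb[cw lew]; apply: small_cayley.
exists v; split=> //; rewrite gen_funE; congr (bounded _ _ (word_gf _)): bv.
by apply/funext => w; apply/propext; split=> [/CE|/CE].
Qed.

(* Otherwise one builds a sequence of words of the closure outside C, each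
   containing none of the previous ones, against Higman's theorem. *)
Lemma finite_relative_basis : exists B : seq word, (forall w, w \in B -> cayley w) /\
  forall w, C w <-> in_closure S w /\ forall t, t \in B -> ~ contained t w.
Proof.
have [Cc Cd] := C_class.
pose bad w := in_closure S w /\ ~ C w.
apply: contrapT => noB.
have step (B : seq word) : exists w, (forall t, t \in B -> bad t) ->
    bad w /\ forall t, t \in B -> ~ contained t w.
  have [badB|] := pselect (forall t, t \in B -> bad t); last by exists [::].
  (* If every bad word contained a member of [B], then [B] itself would define the class inside the
     closure. *)
  apply: contrapT => none; apply: noB; exists B; split=> [w /badB[[]]//|w].
  split=> [Cw|[clw av]].
    split=> [|t tB ctw]; first exact: class_in_closure.
    by have [[ct _] nCt] := badB t tB; apply: nCt; apply: (Cd t w ct ctw Cw).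
  by apply: contrapT => nCw; apply: none; exists w.
have /choice[next nextP] := step.
pose h := fix h n := if n is n'.+1 then next (h n') :: h n' else [::].
have badh n : forall t, t \in h n -> bad t.
  elim: n => [//|n IHn] t; rewrite inE => /predU1P[->|/IHn//].
  by case: (nextP (h n) IHn).
have [n|i [j [ltij cij]]] := @in_closure_wqo S (fun n => next (h n)).
  by case: (nextP (h n) (badh n)) => -[].
have [_ av] := nextP (h j) (badh j); apply: av cij.
elim: j ltij => [//|j IHj]; rewrite ltnS leq_eqVlt inE => /predU1P[->|/IHj->].
  by rewrite eqxx.
by rewrite orbT.
Qed.

End Simples.

Lemma class_algebraic : finite_set (simples C) -> algebraic_series (gen_fun C).
Proof.
move=> /finite_seqP[S SE0]; have SE w : w \in S <-> simples C w.
  by rewrite SE0.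
have [B [cB CE]] := finite_relative_basis SE.
pose b := sumn [seq size w | w <- B]; pose s := (size S + sumn [seq size w | w <- S])%N.
have [|w Sw|w Bw|v [nzv szv bv]] := @class_bounded S SE (fun w => w \in B) b s _ _ _ CE.
- exact: leq_addr.
- by apply: leq_trans (leq_addl _ _); apply/leq_sumn_mem/map_f.
- by split; [apply: cB|apply/leq_sumn_mem/map_f].
have [q [nzq _ _ qf]] := annihilator nzv bv.
by exists q => //; apply/annihilatesE.
Qed.

(** A word outside the class contains a shortest pattern outside it, which is minimal because a
    pattern of the same length is the word itself. *)
Lemma basis_characterization (B : seq word) : (forall w, w \in B <-> basis C w) ->
  forall w, C w <-> cayley w /\ forall t, t \in B -> ~ contained t w.
Proof.
move=> BE w; have [Cc Cd] := C_class; split=> [Cw|[cw av]].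
  split=> [|t /BE[ct nCt _] ctw]; [exact: Cc|exact: nCt (Cd t w ct ctw Cw)].
apply: contrapT => nCw.
have exk : exists k, `[< exists t, [/\ cayley t, ~ C t, contained t w & size t = k] >].
  by exists (size w); apply/asboolP; exists w; split=> //; apply: contained_refl.
have [k /asboolP[t [ct nCt ctw szt]] mink] := ex_minnP exk.
apply: (av t) => //; apply/BE; split=> // u cu nCu cut.
apply: contained_size_eq => //; apply/eqP; rewrite eqn_leq contained_size //= szt.
apply: mink; apply/asboolP; exists u; split=> //; exact: contained_trans cut ctw.
Qed.

End Algebraicity.

Lemma code_words_nth (B : seq word) j : j < size B ->
  CodeSeq.decode (nth 0 (CodeSeq.decode (code_words B)) j) = nth [::] B j.
Proof. by move=> ltj; rewrite CodeSeq.codeK (nth_map [::]) // CodeSeq.codeK. Qed.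

Lemma size_code_words (S : seq word) : size S <= code_words S.
Proof. by rewrite -(size_map CodeSeq.code); apply: size_code. Qed.

Lemma size_le_code_words (S : seq word) w : w \in S -> size w <= code_words S.
Proof.
move=> Sw; apply: leq_trans (size_code w) _; apply: ltnW.
by have /allP := CodeSeq.ltn_code [seq CodeSeq.code w | w <- S]; apply; apply: map_f.
Qed.

Theorem theorem7p14 :
  (forall C : set word,
     cayley_class C -> finite_set (simples C) -> algebraic_series (gen_fun C))
  /\
  (exists f : recfun,
     forall (C : set word) (S B : seq word),
       cayley_class C ->
       (forall w : word, w \in S <-> simples C w) ->
       (forall w : word, w \in B <-> basis C w) ->
       exists k : nat,
         computes f [:: code_words S; code_words B] k /\
         (bipoly_of_code k != 0)%R /\
         annihilates (bipoly_of_code k) (gen_fun C)).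
Proof.
split; first exact: class_algebraic.
(* [Mu] looks for the value 0, hence the negated check. *)
have [g gP] : computable 3 (fun e => ~~ annihilation_check (nth 0 e 0) (nth 0 e 1) (nth 0 e 2)).
  exact: (computableb_not computable_annihilation_check).
exists (Mu g) => C S B Ccl SE BE; set s := code_words S; set b := code_words B.
have CB := basis_characterization Ccl BE.
have szB : size (CodeSeq.decode b) = size B by rewrite CodeSeq.codeK size_map.
have cB w : w \in B -> cayley w by move=> /BE[].
have b_cayley j : j < size (CodeSeq.decode b) ->
    cayley (CodeSeq.decode (nth 0 (CodeSeq.decode b) j)).
  by rewrite szB => ltj; rewrite code_words_nth //; apply/cB/mem_nth.
have C_avoid w : C w <-> cayley w /\ forall j, j < size (CodeSeq.decode b) ->
    ~ contained (CodeSeq.decode (nth 0 (CodeSeq.decode b) j)) w.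
  split=> [/CB[cw av]|[cw av]].
    by split=> // j; rewrite szB => ltj; rewrite code_words_nth //; apply/av/mem_nth.
  apply/CB; split=> // t /(nthP [::])[j ltj <-]; rewrite -code_words_nth //.
  by apply: av; rewrite szB.
have CE w : C w <-> in_closure S w /\ forall t, t \in B -> ~ contained t w.
  split=> [Cw|[[cw _] av]]; last exact/CB.
  by split; [apply: class_in_closure Cw|case/CB: Cw].
have [|w Sw|w Bw|v [nzv szv bv]] := @class_bounded C Ccl S SE (fun w => w \in B) b s _ _ _ CE.
- exact: size_code_words.
- exact: size_le_code_words.
- by split; [apply: cB|apply: size_le_code_words].
(* The family [v] is only known to exist; the check uses nothing but its bound. *)
have sound y : annihilation_check y s b ->
    (bipoly_of_code y != 0)%R /\ annihilates (bipoly_of_code y) (gen_fun C).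
  move=> /andP[/polynomial_checkP[nzq den0] /ballP half]; split=> //.
  apply: (annihilates_to_order nzv szv bv (size_bipoly_of_code y)) => [i|n len].
    by rewrite coef_bipoly_of_code; apply/leqW/(leq_trans (size_poly_of_code _))/code_nth_le.
  rewrite (subst_bipoly_of_code b_cayley C_avoid) //.
  have /eqP-> : half_coef b y 0 n == half_coef b y 1 n by apply: half; rewrite ltnS.
  by apply/eqP; rewrite subr_eq0.
(* The search ends: an annihilator, once made integral, passes the check whatever the order. *)
have [y check_y] : exists y, annihilation_check y s b.
  have [q0 [nzq0 _ _ /annihilatesE q0f]] := annihilator nzv bv.
  have [r nzr rz] := integral_multiple nzq0.
  have nzq : (r%:P *: q0 != 0)%R by rewrite -mul_polyC mulf_neq0 ?polyC_eq0.
  have [y chk yE] := polynomial_check_code nzq rz.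
  have qf := annihilates_scale r q0f; exists y; rewrite /annihilation_check chk /=.
  have [_ den0] := polynomial_checkP chk.
  apply/ballP => n _; have := qf n; rewrite -yE (subst_bipoly_of_code b_cayley C_avoid) //.
  by move=> /eqP; rewrite subr_eq0 Num.Theory.eqr_nat.
have ex_check : exists y, annihilation_check y s b by exists y.
have [k chk mink] := ex_minnP ex_check.
have [nzq qf] := sound k chk; exists k; split=> //; split.
  by have := gP [:: k; s; b] erefl; rewrite /= chk.
(* Unbounded search also requires a defined positive value at each smaller [z]; a failed check gives
   1. *)
move=> z ltz; exists 0; have := gP [:: z; s; b] erefl.
by rewrite /=; case: (boolP (annihilation_check z s b)) => // /mink; rewrite leqNgt ltz.
Qed.
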